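(* Let $(\mathbf Z(t),t\ge0)$ be a self-similar growth fragmentation of index $-\beta$ such that $\kappa(q)<0$ for some $q>0$ with $\beta\in(0,q]$, and let $\check{\mathcal T}$ be the compact $\mathbb R$-tree which is the almost sure Gromov-Hausdorff limit, as $n\to\infty$, of the genealogical trees $\check{\mathcal T}_n$ up to generation $n$. Then the height of $\check{\mathcal T}$ has finite moment $\mathbb E[{\rm ht}(\check{\mathcal T})^p]<\infty$ of order $p$ for all $0<p<\sup\{q>0:\kappa(q)<0\}/\beta$.
   Context: Lévy process and $\kappa$. Let $Y$ be a real Lévy process with characteristics $(k,b,\sigma^2,\nu)$: killing rate $k\ge0$, $b\in\mathbb R$, $\sigma^2\ge0$, Lévy measure $\nu$ (with $\int_{\{y>1\}}e^y\nu(dy)<\infty$), so that $\mathbb E[e^{qY_1}]=e^{\psi(q)}$ with $\psi(q)=-k+\frac12\sigma^2q^2+bq+\int_{\mathbb R}(e^{qy}-1+q(1-e^y))\nu(dy)$ (where $e^{qY_1}:=0$ if killed before time $1$). Put, for $q>0$, $$\kappa(q)=-k+\tfrac12\sigma^2q^2+bq+\int_{\mathbb R}\big(e^{qy}-1+q(1-e^y)+(1-e^y)^q\mathbf 1_{\{y<0\}}\big)\nu(dy)\in(-\infty,\infty].$$ It is assumed that $Y$ drifts to $-\infty$ or is killed. Let $\beta>0$. $Z$ is the positive self-similar Markov process started from $1$ given by Lamperti's transform: $Z(t)=\exp(Y_{\tau(t)})$, $\tau(t)=\inf\{r\ge0:\int_0^r e^{\beta Y_s}ds\ge t\}$, for $t<\int_0^\infty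 e^{\beta Y_s}ds$ (integral up to the killing time), and $Z(t)=0$ afterwards; then $(xZ(x^{-\beta}t))_{t\ge0}$ is the process started from $x>0$. Growth fragmentation. $\mathbb U=\bigcup_{n\ge0}\mathbb N^n$ with $\mathbb N^0=\{\varnothing\}$. Let $(Z_u)_{u\in\mathbb U}$ be i.i.d. copies of $Z$. Set $\mathcal Z_\varnothing=Z_\varnothing$. Recursively, for $u\in\mathbb U$ let $\zeta_u=\inf\{t\ge0:\mathcal Z_u(t)=0\}$ and let $P_{u1}\ge P_{u2}\ge\cdots$ be the ranked absolute values $|\Delta\mathcal Z_u(X_{uj})|$ of the negative jumps of $\mathcal Z_u$ during $(0,\zeta_u)$, with $X_{uj}$ the corresponding jump times (padded by $P_{uj}=0$ if there are finitely many jumps); put $\mathcal Z_{uj}(t)=P_{uj}Z_{uj}(P_{uj}^{-\beta}t)$, $t\ge0$ (and $\mathcal Z_{uj}=0$ if $P_{uj}=0$). With birth times $b_u=\sum_{i=1}^{|u|}X_{u_1\ldots u_i}$, the process $\mathbf Z(t)$, the decreasing rearrangement of the collection $(\mathcal Z_u(t-b_u):u\in\mathbb U,\ b_u\le t<b_u+\zeta_u)$, $t\ge0$, is the self-similar growth fragmentation of index $-\beta$. Genealogical trees. $\check{\mathcal T}_0$ is the interval $[0,\zeta_\varnothing]$ rooted at $0$; $\check{\mathcal T}_{n+1}$ is obtained from $\check{\mathcal T}_n$ by attaching, for each $u\in\mathbb N^n$ and $j\ge1$, an interval of length $\zeta_{uj}$, its left endpoint being identified with the point at position $X_{uj}$ of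 the interval $[0,\zeta_u]$ associated with $u$ (path metric). Under the stated assumption these trees converge a.s. in the pointed Gromov-Hausdorff distance to a compact rooted $\mathbb R$-tree $\check{\mathcal T}$. ${\rm ht}(T)=\sup_{x\in T}d(\rho,x)$ is the height of a tree $T$ with root $\rho$. *)

(* Defs.v *)
From HB Require Import structures.
From mathcomp Require Import all_boot all_order all_algebra.
From mathcomp Require Import all_classical all_reals all_analysis.
From mathcomp Require Import measurable_realfun metric_structure.

Set Implicit Arguments.
Unset Strict Implicit.
Unset Printing Implicit Defensive.

Import Order.TTheory GRing.Theory Num.Theory.
Import numFieldNormedType.Exports.

Local Open Scope classical_set_scope.
Local Open Scope ring_scope.

(* Processes and paths are functions of a real time, but only their values at
   nonnegative times matter. *)
Definition cadlag {R : realType} (z : R -> R) : Prop :=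
  (forall t, 0 <= t -> z @ t^'+ --> z t) /\
  (forall t, 0 < t -> cvg (z @ t^'-)).

Definition cylinder {R : realType} {T : Type} (X : R -> T -> R)
    (n : nat) (t : nat -> R) (B : nat -> set R) : set T :=
  [set w | forall i, (i < n)%N -> B i (X (t i) w)].

Definition same_law {R : realType} d (T : measurableType d)
    (P : probability T R) (X : R -> T -> R) d' (T' : measurableType d')
    (P' : probability T' R) (X' : R -> T' -> R) : Prop :=
  forall n (t : nat -> R) (B : nat -> set R),
    (forall i, 0 <= t i) -> (forall i, measurable (B i)) ->
    P (cylinder X n t B) = P' (cylinder X' n t B).

(* There is no loss of generality in using the same number [n] of time
   constraints for every member of the family, since [B u i] can be [setT]. *)
Definition independent_processes {R : realType} d (T : measurableType d)
    (P : probability T R) (I : eqType) (X : I -> R -> T -> R) : Prop :=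
  forall (us : seq I) n (t : I -> nat -> R) (B : I -> nat -> set R),
    uniq us ->
    (forall u i, 0 <= t u i) -> (forall u i, measurable (B u i)) ->
    P (\big[setI/setT]_(u <- us) cylinder (X u) n (t u) (B u)) =
    (\prod_(u <- us) P (cylinder (X u) n (t u) (B u)))%E.

Definition levy_measure {R : realType} (nu : {measure set R -> \bar R}) : Prop :=
  [/\ nu [set 0] = 0%E,
      (\int[nu]_y (Num.min 1 (y ^+ 2))%:E < +oo)%E &
      (\int[nu]_(y in `]1%R, +oo[) (expR y)%:E < +oo)%E].

(* For q >= 0 the integrand of [levy_psi] has constant sign in y (it is
   x ^ q - 1 - q (x - 1) with x = e ^ y).  In [levy_kappa] the integrand is
   nonnegative for q >= 1 and has an integrable negative part for 0 < q < 1.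
   So both integrals are meaningful in ]-oo, +oo]. *)
Definition levy_psi {R : realType} (k b sigma2 : R)
    (nu : {measure set R -> \bar R}) (q : R) : \bar R :=
  ((- k + 2^-1 * sigma2 * q ^+ 2 + b * q)%:E +
   \int[nu]_y (expR (q * y) - 1 + q * (1 - expR y))%:E)%E.

Definition levy_kappa {R : realType} (k b sigma2 : R)
    (nu : {measure set R -> \bar R}) (q : R) : \bar R :=
  ((- k + 2^-1 * sigma2 * q ^+ 2 + b * q)%:E +
   \int[nu]_y (expR (q * y) - 1 + q * (1 - expR y) +
               (if y < 0 then (1 - expR y) `^ q else 0))%:E)%E.

Record levy_process {R : realType} d (T : measurableType d)
    (P : probability T R) (xi : R -> T -> R) : Prop := LevyProcess {
  levy_measurable : forall t, 0 <= t -> measurable_fun setT (xi t) ;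
  levy_start : {ae P, forall w, xi 0 w = 0} ;
  levy_cadlag : forall w, cadlag (xi ^~ w) ;
  levy_independent_increments :
    forall n (t : nat -> R) (B : nat -> set R),
      0 <= t 0%N -> (forall i, t i <= t i.+1) ->
      (forall i, measurable (B i)) ->
      P [set w | forall i, (i < n)%N -> B i (xi (t i.+1) w - xi (t i) w)] =
      (\prod_(i < n) P [set w | B i (xi (t i.+1) w - xi (t i) w)%R])%E ;
  levy_stationary_increments :
    forall s h (B : set R), 0 <= s -> 0 <= h -> measurable B ->
      P [set w | B (xi (s + h) w - xi s w)] = P [set w | B (xi h w)] }.

(* The killed process is represented by a pair: a Lévy process [xi] without
   killing and an independent killing time [e], exponential with parameter k
   (e = +oo almost surely if k = 0).  The characteristics enter through the
   Laplace transform of Y_1, which determines the law of the process. *)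
Record killed_levy_process {R : realType} d (T : measurableType d)
    (P : probability T R) (k b sigma2 : R) (nu : {measure set R -> \bar R})
    (xi : R -> T -> R) (e : T -> \bar R) : Prop := KilledLevyProcess {
  klevy_levy : levy_process P xi ;
  klevy_measurable : measurable_fun setT e ;
  klevy_exponential :
    forall s, 0 <= s -> P [set w | (s%:E < e w)%E] = (expR (- k * s))%:E ;
  klevy_independent :
    forall (A : set (\bar R)) n (t : nat -> R) (B : nat -> set R),
      measurable A -> (forall i, 0 <= t i) -> (forall i, measurable (B i)) ->
      P (e @^-1` A `&` cylinder xi n t B) =
      (P (e @^-1` A) * P (cylinder xi n t B))%E ;
  klevy_laplace :
    forall q, 0 <= q ->
      (\int[P]_w (if (1%:E < e w)%E then expR (q * xi 1 w) else 0)%:E)%E =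
      expeR (levy_psi k b sigma2 nu q) }.

(* [-oo] is the cemetery state. *)
Definition killed_path {R : realType} (x : R -> R) (e : \bar R) (s : R) : \bar R :=
  if (s%:E < e)%E then (x s)%:E else -oo%E.

(* As [expeR -oo = 0], this integral only sees the time before killing. *)
Definition lamperti_clock {R : realType} (beta : R) (y : R -> \bar R)
    (A : set R) : \bar R :=
  (\int[lebesgue_measure]_(s in A) expeR (beta%:E * y s))%E.

Definition lamperti_tau {R : realType} (beta : R) (y : R -> \bar R) (t : R) : R :=
  inf [set r | 0 <= r /\ (t%:E <= lamperti_clock beta y `[0%R, r])%E].

Definition lamperti {R : realType} (beta : R) (y : R -> \bar R) (t : R) : R :=
  if (t%:E < lamperti_clock beta y `[0%R, +oo[)%E
  then fine (expeR (y (lamperti_tau beta y t))) else 0.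

Definition lifetime {R : realType} (z : R -> R) : \bar R :=
  ereal_inf [set t%:E | t in [set t | 0 <= t /\ z t = 0]].

Definition neg_jump_size {R : realType} (z : R -> R) (t : R) : R :=
  lim (z @ t^'-) - z t.

Definition neg_jump_times {R : realType} (z : R -> R) : set R :=
  [set t | [/\ 0 < t, (t%:E < lifetime z)%E & 0 < neg_jump_size z t]].

(* The order of jumps of equal size is fixed by time: a choice that looks at the
   descendants would change the law of the cell system. *)
Definition jump_before {R : realType} (z : R -> R) (s t : R) : Prop :=
  neg_jump_size z t < neg_jump_size z s \/
  neg_jump_size z s = neg_jump_size z t /\ s < t.

Definition is_jump_rank {R : realType} (z : R -> R) (j : nat) (t : R) : Prop :=
  neg_jump_times z t /\
  ([set s | neg_jump_times z s /\ jump_before z s t] #= `I_j)%card.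

(* Jumps are numbered from 0.  When there are at most j of them, the time is set
   to 0 and the size to 0. *)
Definition jump_time {R : realType} (z : R -> R) (j : nat) : R :=
  xget 0 [set t | is_jump_rank z j t].

Definition jump_size {R : realType} (z : R -> R) (j : nat) : R :=
  if `[< exists t, is_jump_rank z j t >] then neg_jump_size z (jump_time z j)
  else 0.

(* This path is identically 0 if p = 0. *)
Definition rescaled {R : realType} (beta p : R) (z : R -> R) : R -> R :=
  fun t => p * z (p `^ (- beta) * t).

(* Individuals are finite sequences of natural numbers.  The [Z u] are paths of
   copies of the process started from 1, and [cell beta Z u] is the path of the
   individual u.  [cell_from beta Z v z u] is the path of the individual v ++ u
   when z is the path of v. *)
Fixpoint cell_from {R : realType} (beta : R) (Z : seq nat -> R -> R)
    (v : seq nat) (z : R -> R) (u : seq nat) : R -> R :=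
  if u is j :: u' then
    cell_from beta Z (rcons v j)
      (rescaled beta (jump_size z j) (Z (rcons v j))) u'
  else z.

Definition cell {R : realType} (beta : R) (Z : seq nat -> R -> R)
    (u : seq nat) : R -> R :=
  cell_from beta Z [::] (Z [::]) u.

Lemma cell_nil {R : realType} (beta : R) (Z : seq nat -> R -> R) :
  cell beta Z [::] = Z [::].
Proof. by []. Qed.

Lemma cell_rcons {R : realType} (beta : R) (Z : seq nat -> R -> R) u j :
  cell beta Z (rcons u j) =
  rescaled beta (jump_size (cell beta Z u) j) (Z (rcons u j)).
Proof.
rewrite /cell; suff H v z : cell_from beta Z v z (rcons u j) =
  rescaled beta (jump_size (cell_from beta Z v z u) j) (Z (rcons (v ++ u) j)).
  exact: H.
by elim: u v z => [|i u IHu] v z /=; rewrite ?cats0// IHu cat_rcons.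
Qed.

Definition birth_time {R : realType} (beta : R) (Z : seq nat -> R -> R)
    (u : seq nat) : R :=
  \sum_(i < size u) jump_time (cell beta Z (take i u)) (nth 0%N u i).

Definition alive {R : realType} (beta : R) (Z : seq nat -> R -> R) (t : R) :
    set (seq nat) :=
  [set u | birth_time beta Z u <= t /\
    (t%:E < (birth_time beta Z u)%:E + lifetime (cell beta Z u))%E].

(* The family (x_i)_{i in D} of nonnegative numbers in decreasing order, padded
   by zeros if D is finite: its entry of index n (starting from 0) is the least
   r >= 0 such that at most n members of the family exceed r. *)
Definition decreasing_rearrangement {R : realType} (I : Type) (D : set I)
    (x : I -> R) (n : nat) : R :=
  inf [set r | 0 <= r /\ ([set i | D i /\ r < x i] #<= `I_n)%card].

(* ZZ is the growth fragmentation driven by the process X (the positive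
   self-similar Markov process started from 1) and constructed from the family
   Z of independent copies of X. *)
Record growth_fragmentation {R : realType} (beta : R)
    d' (T' : measurableType d') (P' : probability T' R) (X : R -> T' -> R)
    d (T : measurableType d) (P : probability T R)
    (Z : seq nat -> R -> T -> R) (ZZ : R -> T -> nat -> R) : Prop :=
  GrowthFragmentation {
  gf_measurable : forall u t, 0 <= t -> measurable_fun setT (Z u t) ;
  gf_cadlag : forall u, {ae P, forall w, cadlag (Z u ^~ w)} ;
  gf_copies : forall u, same_law P (Z u) P' X ;
  gf_independent : independent_processes P Z ;
  gf_rearrangement : forall t w, 0 <= t ->
    let Zw u s := Z u s w in
    ZZ t w = decreasing_rearrangement (alive beta Zw t)
               (fun u => cell beta Zw u (t - birth_time beta Zw u)) }.

(* [rdist] may be a mere pseudo-distance: points at distance 0 are implicitly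
   identified. *)
Record rooted_space (R : realType) := RootedSpace {
  rpoint :> Type ;
  rdist : rpoint -> rpoint -> R ;
  rroot : rpoint }.

Definition is_geodesic {R : realType} (S : metricType R) (x y : S) (f : R -> S) :
    Prop :=
  [/\ f 0 = x, f (mdist x y) = y &
      {in `[0, mdist x y] &, forall s t, mdist (f s) (f t) = `|s - t|}].

Definition real_tree {R : realType} (S : metricType R) : Prop :=
  forall x y : S, exists f : R -> S,
    [/\ is_geodesic x y f,
        (forall g, is_geodesic x y g -> {in `[0, mdist x y], f =1 g}) &
        (forall c : R -> S, {within `[0, 1], continuous c} ->
          {in `[0, 1] &, injective c} -> c 0 = x -> c 1 = y ->
          c @` `[0, 1] = f @` `[0, mdist x y])].

Record compact_rtree (R : realType) := CompactRTree {
  rtree_space :> metricType R ;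
  rtree_root : rtree_space ;
  rtree_compact : compact [set: rtree_space] ;
  rtree_real_tree : real_tree rtree_space }.

Definition rooted_of_rtree {R : realType} (S : compact_rtree R) :
    rooted_space R :=
  @RootedSpace R S (@mdist R S) (rtree_root S).

Definition hausdorff_dist {R : realType} (S : metricType R) (A B : set S) :
    \bar R :=
  maxe
    (ereal_sup [set ereal_inf [set (mdist a b)%:E | b in B] | a in A])
    (ereal_sup [set ereal_inf [set (mdist a b)%:E | a in A] | b in B]).

Definition preserves_dist {R : realType} (X : rooted_space R)
    (S : metricType R) (f : X -> S) : Prop :=
  forall x y, mdist (f x) (f y) = rdist x y.

Definition gromov_hausdorff_dist {R : realType} (X Y : rooted_space R) :
    \bar R :=
  ereal_inf [set r | exists (S : metricType R) (f : X -> S) (g : Y -> S),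
    [/\ preserves_dist f, preserves_dist g &
        r = maxe (hausdorff_dist (range f) (range g))
                 (mdist (f (rroot X)) (g (rroot Y)))%:E]].

Definition tree_height {R : realType} (X : rooted_space R) : \bar R :=
  ereal_sup [set (rdist (rroot X) x)%:E | x in [set: X]].

(* The point (u, x) stands for the position x on the interval of u. *)
Definition genealogical_points {R : realType} (beta : R)
    (Z : seq nat -> R -> R) (n : nat) : set (seq nat * R) :=
  [set a | [/\ (size a.1 <= n)%N, 0 <= a.2 &
               (a.2%:E <= lifetime (cell beta Z a.1))%E]].

(* Where the left endpoint of the interval of u <> [::] is attached. *)
Definition attachment_point {R : realType} (beta : R) (Z : seq nat -> R -> R)
    (u : seq nat) : seq nat * R :=
  let v := take (size u).-1 u in
  (v, jump_time (cell beta Z v) (last 0%N u)).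

(* A path that leaves a newly attached interval goes through its left endpoint.
   The points (u, 0) and [attachment_point u] are thus at distance 0. *)
Fixpoint genealogical_dist {R : realType} (beta : R) (Z : seq nat -> R -> R)
    (n : nat) (a a' : seq nat * R) : R :=
  if n is m.+1 then
    let new (c : seq nat * R) := size c.1 == m.+1 in
    let base c := if new c then attachment_point beta Z c.1 else c in
    let excess c := if new c then c.2 else 0 in
    if new a && (a.1 == a'.1) then `|a.2 - a'.2|
    else excess a + genealogical_dist beta Z m (base a) (base a') + excess a'
  else `|a.2 - a'.2|.

Lemma genealogical_root_subproof {R : realType} (beta : R)
    (Z : seq nat -> R -> R) (n : nat) :
  genealogical_points beta Z n ([::], 0).
Proof.
by split=> //=; apply/ereal_infP => _ [t [t0 _] <-]; rewrite lee_fin.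
Qed.

Definition genealogical_tree {R : realType} (beta : R) (Z : seq nat -> R -> R)
    (n : nat) : rooted_space R :=
  @RootedSpace R {a | genealogical_points beta Z n a}
    (fun a a' => genealogical_dist beta Z n (sval a) (sval a'))
    (exist _ ([::], 0) (genealogical_root_subproof beta Z n)).

(* Main.v *)
(** Fix q with kappa(q) < 0, q >= beta and p beta < q, and put p1 = q / beta >= 1.

    A cell of size s is the rescaling of a copy of Z: its lifetime is s^beta times
    the lifetime of the copy and its children have s times the sizes of the negative
    jumps of the copy.  Let M be the expected sum of the q-th powers of these jumps and a the
    moment of order p1 of the lifetime.  By independence, the sum over the individuals
    u of generation m of the lifetimes to the power p1 has expectation at most a M^m.
    If M < lam^p1 < 1, the lifetimes L_0, L_1, ... along any line of descent satisfy
    sum L_m <= (1 - lam)^-1 sup_m lam^-m L_m, so the height to the power p1 is at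
    most a constant times the sum over all u of lam^(-p1 |u|) L_u^p1, which is
    integrable.  A bound on the heights of all the finite trees passes to the limit.

    To see that M < 1, write kappa(q) = psi(q) + G with G the integral of (1 - e^y)^q
    over y < 0, so that psi(q) < 0.  Lamperti's time change preserves the jumps, and
    the q-th powers of the jumps of e^Y are approximated by those of the increments of
    Y on dyadic grids.  Since N E f(xi_(1/N)) tends to the integral of f against nu
    when f is supported away from 0, the expectation is at most G / (- psi(q)) < 1.  The
    lifetime is at most the integral of e^(beta Y), whose moment of order p1 is
    finite because E e^(q Y_t) = e^(t psi(q)) decays exponentially.

    Jump sizes and lifetimes of paths are replaced by upper bounds which only involve the
    values of the path at rational times, and are thus determined by its law. *)
Require Import Defs.
From HB Require Import structures.
From mathcomp Require Import all_boot all_order all_algebra.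
From mathcomp Require Import all_classical all_reals all_analysis.
From mathcomp Require Import measurable_realfun metric_structure.
From mathcomp Require Import ring lra.

Set Implicit Arguments.
Unset Strict Implicit.
Unset Printing Implicit Defensive.

Import Order.TTheory GRing.Theory Num.Theory.
Import numFieldNormedType.Exports.

Local Open Scope classical_set_scope.
Local Open Scope ring_scope.

(** The law of [xi] is known only through real exponential moments, whose finiteness is secured only
    for exponents between 0 and q. The convergence of N E f(xi_(1/N)) has to be extracted from
    these. A weight with a double zero at 0 removes constants and drift and leaves a symmetric
    interval of exponents [-q/4, q/4]; a determinacy argument with real exponentials then reaches
    continuous functions of compact support.

    The value G / (- psi) comes from a geometric series. On a grid of mesh h, the i-th cell
    contributes at most e^(i h psi) E f(xi_h), where f is the truncated loss. The sum is at most E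
    f(xi_h) / (1 - e^(h psi)); numerator and denominator are both of order h.

    Nothing asserts that the height of [Tree w] is a measurable function of w, so integrals are
    compared through measurable majorants. Only upper bounds are ever required: the majorants are
    built from lower limits, which exist without any convergence and pass through expectations by
    Fatou's lemma. *)

Lemma le_integral_nonmeasurable d (T : measurableType d) (R : realType)
    (mu : {measure set T -> \bar R}) (f g : T -> \bar R) :
  (forall x, 0 <= f x)%E -> (forall x, f x <= g x)%E ->
  (\int[mu]_x f x <= \int[mu]_x g x)%E.
Proof.
move=> f0 fg; have g0 x : (0 <= g x)%E := le_trans (f0 x) (fg x).
(* The integral of a nonnegative function is a supremum over the simple functions below it, and a
   simple function below [f] is also below [g]. *)
rewrite !ge0_integralTE//; apply: ereal_sup_le => _ [h hf <-].
by exists h => // x; exact: le_trans (fg x).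
Qed.

(** The exceptional set lies in a measurable null set, on which the majorant is raised to +oo. Its
    integral is unchanged, and the inequality now holds everywhere. *)
Lemma ae_le_integral_nonmeasurable d (T : measurableType d) (R : realType)
    (mu : {measure set T -> \bar R}) (f g : T -> \bar R) :
  (forall x, 0 <= f x)%E -> (forall x, 0 <= g x)%E -> measurable_fun setT g ->
  {ae mu, forall x, f x <= g x}%E ->
  (\int[mu]_x f x <= \int[mu]_x g x)%E.
Proof.
move=> f0 g0 mg [N [mN muN fgN]].
pose h x := (g x + +oo * (\1_N x)%:E)%E.
have h0 x : (0 <= h x)%E by rewrite adde_ge0// mule_ge0// lee_fin.
have mh : measurable_fun setT h.
  apply: emeasurable_funD => //; apply: measurable_funeM.
  exact/measurable_EFinP/measurable_indic.
apply: (@le_trans _ _ (\int[mu]_x h x)%E).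
  apply: le_integral_nonmeasurable => // x; rewrite /h.
  have [xN|xN] := pselect (N x).
    rewrite indicE mem_set//= mule1 addey ?leey// gt_eqF//.
    by rewrite (lt_le_trans _ (g0 x)).
  rewrite indicE memNset//= mule0 adde0.
  by apply: contrapT => fg; apply: xN; exact: fgN.
apply: ae_ge0_le_integral => //; exists N; split=> // x /= hg.
apply: contrapT => xN; apply: hg => _.
by rewrite /h indicE memNset//= mule0 adde0.
Qed.

Lemma cvge_near_gt (R : realType) (I : Type) (F : set_system I) (f : I -> \bar R)
    (a l : \bar R) : (a < l)%E -> f @ F --> l -> \forall x \near F, (a < f x)%E.
Proof. by move=> al fl; apply: (fl (fun y => a < y)%E); exact: open_ereal_gt'. Qed.

(** * Measurability and independence of path functionals *)

Section weighted_law.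
Context d d' (T : measurableType d) (S : measurableType d') (R : realType).
Variables (mu : {measure set T -> \bar R}) (V : T -> S) (H : T -> \bar R).
Variable c : \bar R.
Hypotheses (mV : measurable_fun setT V) (mH : measurable_fun setT H).
Hypotheses (H0 : forall w, (0 <= H w)%E) (c0 : (0 <= c)%E).
Hypothesis VH : forall B, measurable B ->
  (\int[mu]_w ((\1_B (V w))%:E * H w) = c * \int[mu]_w (\1_B (V w))%:E)%E.

Import HBNNSimple.

Let VHs (f : {nnsfun S >-> R}) :
  (\int[mu]_w ((f (V w))%:E * H w) = c * \int[mu]_w (f (V w))%:E)%E.
Proof.
have mi r : measurable_fun setT (fun w => (\1_(f @^-1` [set r]) (V w))%:E : \bar R).
  by apply/measurable_EFinP/measurableT_comp => //; exact: measurable_indic.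
have fE w : (f (V w))%:E =
    (\sum_(r \in range f) r%:E * (\1_(f @^-1` [set r]) (V w))%:E)%E.
  by rewrite fimfunE -fsumEFin.
have r0 r w : (0 <= r%:E * (\1_(f @^-1` [set r]) (V w))%:E)%E.
  exact: nnfun_muleindic_ge0.
transitivity (\sum_(r \in range f) (\int[mu]_w
    (r%:E * (\1_(f @^-1` [set r]) (V w))%:E * H w)))%E.
  rewrite -ge0_integral_fsum//.
  - by apply: eq_integral => w _; rewrite fE ge0_mule_fsuml.
  - by move=> r; apply: emeasurable_funM => //; apply: measurable_funeM.
  - by move=> r w _; rewrite mule_ge0.
transitivity (\sum_(r \in range f) c * (\int[mu]_w
    (r%:E * (\1_(f @^-1` [set r]) (V w))%:E)))%E.
  apply: eq_fsbigr => r; rewrite inE => -[s _ <-].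
  under eq_integral do rewrite -muleA.
  have fs0 : (0 <= (f s)%:E)%E by rewrite lee_fin.
  have HV0 w : (0 <= (\1_(f @^-1` [set f s]) (V w))%:E * H w)%E.
    by rewrite mule_ge0// lee_fin.
  have mVH := emeasurable_funM (mi (f s)) mH.
  rewrite (ge0_integralZl _ _ mVH)//.
  rewrite VH// ge0_integralZl ?lee_fin//; first by rewrite muleCA.
rewrite -ge0_mule_fsumr; last by move=> r; apply: integral_ge0.
rewrite -ge0_integral_fsum//; last by move=> r; exact: measurable_funeM.
by congr (_ * _)%E; apply: eq_integral => w _; rewrite fE.
Qed.

(** The hypothesis [VH] on indicators passes to simple functions by linearity and to [F] by monotone
    convergence. With a product of other factors or the indicator of an event as [H], independence
    of events becomes a factorisation of integrals. *)
Lemma integral_weighted_law (F : S -> \bar R) : measurable_fun setT F ->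
  (forall s, 0 <= F s)%E ->
  (\int[mu]_w (F (V w) * H w) = c * \int[mu]_w F (V w))%E.
Proof.
move=> mF F0; pose g := nnsfun_approx measurableT mF.
have gcvg s : (g n s)%:E @[n --> \oo] --> F s.
  exact: (@cvg_nnsfun_approx _ _ _ _ measurableT _ mF (fun s _ => F0 s) s).
have gnd s : {homo (fun n => (g n s)%:E) : n m / (n <= m)%N >-> (n <= m)%E}.
  move=> n m nm; rewrite lee_fin.
  by have /lefP := @nd_nnsfun_approx _ _ _ _ measurableT _ mF n m nm; exact.
have mgV n : measurable_fun setT (fun w => (g n (V w))%:E).
  exact/measurable_EFinP/measurableT_comp.
have c1 : (\int[mu]_w (g n (V w))%:E @[n --> \oo] --> \int[mu]_w F (V w))%E.
  have -> : (\int[mu]_w F (V w) =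
      \int[mu]_w (limn (fun n => (g n (V w))%:E)))%E.
    by apply: eq_integral => w _; apply/esym/cvg_lim => //; exact: gcvg.
  apply: cvg_monotone_convergence => //.
  - by move=> n w _; rewrite lee_fin.
have c2 : (\int[mu]_w ((g n (V w))%:E * H w) @[n --> \oo]
    --> \int[mu]_w (F (V w) * H w))%E.
  have -> : (\int[mu]_w (F (V w) * H w) =
      \int[mu]_w (limn (fun n => (g n (V w))%:E * H w)))%E.
    apply: eq_integral => w _; apply/esym/cvg_lim => //.
    (* Multiplication by +oo is not continuous at 0. If [F (V w)] is 0, so are the approximations
       below it; otherwise they are eventually positive and the products are eventually +oo. The
       case where [c] is +oo is treated likewise below. *)
    have [Hoo|Hfin] := eqVneq (H w) +oo%E; last first.
      by apply: cvgeZr; [rewrite ge0_fin_numE// ltey|exact: gcvg].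
    rewrite Hoo; have := F0 (V w); rewrite le_eqVlt => /predU1P[FV|FV].
      rewrite -FV mul0e.
      have g0 n : g n (V w) = 0.
        apply/eqP; rewrite eq_le fun_ge0 andbT -lee_fin [leRHS]FV.
        by rewrite nnsfun_approxE le_approx.
      by under eq_fun do rewrite g0 mul0e; exact: cvg_cst.
    rewrite gt0_muley//; apply: cvg_near_cst.
    have : \forall n \near \oo, (0 < (g n (V w))%:E)%E by exact: cvge_near_gt FV (gcvg _).
    by apply: filterS => n gn; rewrite gt0_muley.
  apply: cvg_monotone_convergence => //.
  - by move=> n; exact: emeasurable_funM.
  - by move=> n w _; rewrite mule_ge0// lee_fin.
  - by move=> w _ n m nm; rewrite lee_wpmul2r// gnd.
have := cvg_unique _ c2; apply => //.
rewrite (_ : (fun n => _) = (fun n => c * \int[mu]_w (g n (V w))%:E)%E); last first.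
  by apply/funext => n; exact: VHs.
have [coo|cfin] := eqVneq c +oo%E; last first.
  by apply: cvgeZl => //; rewrite ge0_fin_numE// ltey.
have : (0 <= \int[mu]_w F (V w))%E by exact: integral_ge0.
rewrite coo le_eqVlt => /predU1P[FV|FV].
  rewrite -FV mule0.
  have g0 n : (\int[mu]_w (g n (V w))%:E = 0)%E.
    apply/eqP; rewrite eq_le integral_ge0 ?andbT; last by move=> w _; rewrite lee_fin.
    rewrite FV; apply: ge0_le_integral => //.
    - by move=> w _; rewrite lee_fin.
    - exact: measurableT_comp.
    - by move=> w _; rewrite nnsfun_approxE le_approx.
  by apply: cvg_near_cst; apply: nearW => n; rewrite (g0 n) mule0.
rewrite gt0_mulye//; apply: cvg_near_cst.
by apply: filterS (cvge_near_gt FV c1) => n gn; rewrite gt0_mulye.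
Qed.
End weighted_law.

Lemma emeasurable_prod d (T : measurableType d) (R : realType) (I : Type)
    (s : seq I) (Q : pred I) (f : I -> T -> \bar R) :
  (forall i, measurable_fun setT (f i)) ->
  measurable_fun setT (fun w => \prod_(i <- s | Q i) f i w)%E.
Proof.
move=> mf; elim: s => [|i s IH].
  by rewrite (_ : (fun w => _) = cst 1%E)//; apply/funext => w; rewrite big_nil.
rewrite (_ : (fun w => _) = (fun w => (if Q i then f i w else 1) *
    \prod_(i <- s | Q i) f i w)%E); last first.
  by apply/funext => w; rewrite big_cons; case: ifP => //; rewrite mul1e.
by apply: emeasurable_funM => //; case: (Q i) => //; exact: measurable_cst.
Qed.

Section independent_integral.
Context d d' (T : measurableType d) (S : measurableType d') (R : realType).
Variables (P : probability T R) (I : eqType) (V : I -> T -> S).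
Hypothesis mV : forall u, measurable_fun setT (V u).
Variable us : seq I.
Hypothesis uus : uniq us.
Hypothesis indep : forall B : I -> set S, (forall u, measurable (B u)) ->
  P (\big[setI/setT]_(u <- us) (V u @^-1` B u)) =
  (\prod_(u <- us) P (V u @^-1` B u))%E.

Lemma integral_prod_independent (F : I -> S -> \bar R) :
  (forall u, measurable_fun setT (F u)) -> (forall u s, (0 <= F u s)%E) ->
  (\int[P]_w \prod_(u <- us) F u (V u w) =
   \prod_(u <- us) \int[P]_w F u (V u w))%E.
Proof.
move=> mF F0.
(* [D] lists the indices whose factor may be arbitrary, the others being indicators. The induction
   on [D] frees one factor at a time, with the product of the other factors as the weight in
   [integral_weighted_law]. *)
suff: forall D : seq I, forall F : I -> S -> \bar R,
    (forall u, measurable_fun setT (F u)) -> (forall u s, (0 <= F u s)%E) ->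
    (forall u, u \notin D ->
      exists2 B, measurable B & F u = (fun s => (\1_B s)%:E)) ->
    (\int[P]_w \prod_(u <- us) F u (V u w) =
     \prod_(u <- us) \int[P]_w F u (V u w))%E.
  move=> /(_ us (fun u => if u \in us then F u else cst 1%E)) FE.
  transitivity (\int[P]_w
      \prod_(u <- us) (if u \in us then F u else cst 1%E) (V u w))%E.
    apply: eq_integral => w _; rewrite big_seq [RHS]big_seq.
    by apply: eq_bigr => u uus'; rewrite uus'.
  rewrite FE.
  - by rewrite big_seq [RHS]big_seq; apply: eq_bigr => u uus'; rewrite uus'.
  - by move=> u; case: ifP => // _; exact: measurable_cst.
  - by move=> u s; case: ifP => //= _; rewrite lee_fin.
  - by move=> u /negbTE ->; exists setT => //; apply/funext => s; rewrite indicT.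
elim=> [|u D IH] {mF F0}F mF F0 FD.
  have /choice[B B_] u : exists B, measurable B /\ F u = (fun s => (\1_B s)%:E).
    by have [//|B mB FE] := FD u; exists B.
  transitivity (\int[P]_w (\1_(\big[setI/setT]_(u <- us) (V u @^-1` B u)) w)%:E)%E.
    apply: eq_integral => w _; elim: (us) => [|v vs IHv].
      by rewrite !big_nil indicT.
    by rewrite !big_cons IHv (B_ v).2 indicI EFinM.
  rewrite integral_indic//; last first.
    apply: bigsetI_measurable => u _; rewrite -[X in measurable X]setTI.
    by apply: mV => //; exact: (B_ u).1.
  rewrite setIT; transitivity (\prod_(u <- us) P (V u @^-1` B u))%E.
    by apply: indep => u; exact: (B_ u).1.
  apply: eq_bigr => u _; rewrite (B_ u).2.
  transitivity (\int[P]_w (\1_(V u @^-1` B u) w)%:E)%E; last by [].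
  rewrite integral_indic ?setIT// -[X in measurable X]setTI.
  by apply: mV => //; exact: (B_ u).1.
have [uus'|uus'] := boolP (u \in us); last first.
  pose G v := if v == u then cst 1%E else F v.
  have FG v : v \in us -> F v = G v.
    by move=> vus; rewrite /G; case: eqP vus uus' => // -> ->.
  transitivity (\int[P]_w \prod_(u <- us) G u (V u w))%E.
    apply: eq_integral => w _; rewrite big_seq [RHS]big_seq.
    by apply: eq_bigr => v vus; rewrite FG.
  rewrite IH.
  - by rewrite big_seq [RHS]big_seq; apply: eq_bigr => v vus; rewrite FG.
  - by move=> v; rewrite /G; case: ifP => // _; exact: measurable_cst.
  - by move=> v s; rewrite /G; case: ifP => //= _; rewrite lee_fin.
  - move=> v vD; rewrite /G; case: eqP => [_|/eqP vu].
      by exists setT => //; apply/funext => s; rewrite indicT.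
    by apply: FD; rewrite inE negb_or vu.
have mFV v : measurable_fun setT (fun w => F v (V v w)) by exact: measurableT_comp.
pose H w := (\prod_(v <- us | v != u) F v (V v w))%E.
pose c := (\prod_(v <- us | v != u) \int[P]_w F v (V v w))%E.
transitivity (\int[P]_w (F u (V u w) * H w))%E.
  by apply: eq_integral => w _; rewrite (bigD1_seq u).
rewrite [RHS](bigD1_seq u)//= muleC.
apply: integral_weighted_law => //.
- exact: emeasurable_prod.
- by move=> w; apply: prode_ge0.
- by apply: prode_ge0 => v _; exact: integral_ge0.
move=> B mB; pose G v := if v == u then (fun s => (\1_B s)%:E) else F v.
have GF v : v != u -> G v = F v by rewrite /G => /negbTE ->.
have Gu : G u = (fun s => (\1_B s)%:E) by rewrite /G eqxx.
have := IH G; rewrite [in X in _ -> _ -> _ -> _ = X](bigD1_seq u)//= Gu muleC => GE.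
rewrite /c (eq_bigr (fun v => \int[P]_w G v (V v w))%E); last first.
  by move=> v vu; rewrite GF.
rewrite -GE.
- apply: eq_integral => w _; rewrite (bigD1_seq u)//= Gu.
  by congr (_ * _)%E; apply: eq_bigr => v vu; rewrite GF.
- move=> v; rewrite /G; case: ifP => // _.
  exact/measurable_EFinP/measurable_indic.
- by move=> v s; rewrite /G; case: ifP => // _; rewrite lee_fin.
- move=> v vD; rewrite /G; case: eqP => [_|/eqP vu]; first by exists B.
  by apply: FD; rewrite inE negb_or vu.
Qed.

End independent_integral.

Section path_space.
Variable R : realType.

(** Only nonnegative times are constrained, because the measurability and the laws of the processes
    are specified for these times only. *)
Definition path_cylinders : set (set (R -> R)) :=
  [set C | exists n (t : nat -> R) (B : nat -> set R),
    [/\ forall i, 0 <= t i, forall i, measurable (B i) &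
        C = [set z | forall i, (i < n)%N -> B i (z (t i))]]].

Definition path_space := g_sigma_algebraType path_cylinders.

Lemma setI_closed_path_cylinders : setI_closed path_cylinders.
Proof.
move=> _ _ [n [t [B [t0 mB ->]]]] [m [s [C [s0 mC ->]]]].
exists (n + m)%N, (fun i => if (i < n)%N then t i else s (i - n)%N),
  (fun i => if (i < n)%N then B i else C (i - n)%N); split.
- by move=> i; case: ifP.
- by move=> i; case: ifP.
- apply/seteqP; split => [z [zB zC] i inm /=|z zBC]; last split=> i im.
  + case: ifPn => [/zB//|]; rewrite -leqNgt => ni.
    by apply: zC; rewrite ltn_subLR.
  + by have := zBC i; rewrite /= im; apply; rewrite ltn_addr.
  + have := zBC (n + i)%N; by rewrite /= ltn_add2l [(n + i < n)%N]ltnNge leq_addr/= addKn => /(_ im).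
Qed.

Lemma measurable_eval (t : R) : 0 <= t ->
  measurable_fun setT (fun z : path_space => z t).
Proof.
move=> t0 _ B mB; rewrite setTI; apply: sub_sigma_algebra.
exists 1%N, (fun=> t), (fun=> B); split=> //.
by apply/seteqP; split => [z zB i _//|z /(_ 0%N)]; exact.
Qed.

Lemma measurable_path d (T : measurableType d) (X : R -> T -> R) :
  (forall t, 0 <= t -> measurable_fun setT (X t)) ->
  measurable_fun setT ((fun w t => X t w) : T -> path_space).
Proof.
move=> mX; apply: (@measurability _ _ T path_space setT _ path_cylinders erefl).
move=> _ [_ [n [t [B [t0 mB ->]]]] <-].
rewrite setTI (_ : _ @^-1` _ = \bigcap_(i < n) (X (t i) @^-1` B i)).
  by apply: bigcap_measurableType => i _; rewrite -[X in measurable X]setTI; exact: mX.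
by apply/seteqP; split=> z /= zB i; exact: zB.
Qed.

(** Cylinders are stable under intersection and include the whole space, so the uniqueness theorem
    for finite measures applies. *)
Lemma path_measure_unique (m1 m2 : {measure set path_space -> \bar R}) :
  (m1 setT < +oo)%E ->
  (forall A, path_cylinders A -> m1 A = m2 A) ->
  forall A : set path_space, measurable A -> m1 A = m2 A.
Proof.
move=> m1oo m12 A mA.
have GT : path_cylinders setT.
  by exists 0%N, (fun=> 0), (fun=> setT); split=> //; apply/seteqP; split.
apply: (@g_sigma_algebra_measure_unique _ _ path_space path_cylinders _ (fun=> setT)) => //.
- by move=> B; exact: sub_sigma_algebra.
- exact: bigcup_const.
- exact: setI_closed_path_cylinders.
Qed.

End path_space.

Section path_law.
Variable R : realType.

Lemma same_law_integral d (T : measurableType d) (P : probability T R)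
    (X : R -> T -> R) d' (T' : measurableType d') (P' : probability T' R)
    (X' : R -> T' -> R) (F : path_space R -> \bar R) :
  (forall t, 0 <= t -> measurable_fun setT (X t)) ->
  (forall t, 0 <= t -> measurable_fun setT (X' t)) ->
  same_law P X P' X' ->
  measurable_fun setT F -> (forall z, 0 <= F z)%E ->
  (\int[P]_w F (X ^~ w) = \int[P']_w F (X' ^~ w))%E.
Proof.
move=> mX mX' XX' mF F0.
pose V : {mfun T >-> path_space R} :=
  HB.pack (fun w => X ^~ w) (isMeasurableFun.Build _ _ _ _ _ (measurable_path mX)).
pose V' : {mfun T' >-> path_space R} :=
  HB.pack (fun w => X' ^~ w) (isMeasurableFun.Build _ _ _ _ _ (measurable_path mX')).
transitivity (\int[pushforward P V]_z F z)%E.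
  by rewrite ge0_integral_pushforward// preimage_setT.
transitivity (\int[pushforward P' V']_z F z)%E; last first.
  by rewrite ge0_integral_pushforward// preimage_setT.
apply: eq_measure_integral => A mA _.
apply: path_measure_unique => //.
  by rewrite /= /pushforward preimage_setT; exact: (le_lt_trans (probability_le1 P measurableT) (ltry 1)).
by move=> _ [n [t [B [t0 mB ->]]]]; exact: XX'.
Qed.

(** [independent_processes] speaks of cylinders. General path events are reached one index at a
    time: once the other events are fixed, both sides of the product formula are finite measures in
    the remaining event. *)
Lemma independent_path_integral (I : eqType) d (T : measurableType d)
    (P : probability T R) (X : I -> R -> T -> R) (us : seq I)
    (F : I -> path_space R -> \bar R) :
  (forall u t, 0 <= t -> measurable_fun setT (X u t)) ->
  independent_processes P X -> uniq us ->
  (forall u, measurable_fun setT (F u)) -> (forall u z, (0 <= F u z)%E) ->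
  (\int[P]_w \prod_(u <- us) F u (X u ^~ w) =
   \prod_(u <- us) \int[P]_w F u (X u ^~ w))%E.
Proof.
move=> mX indep uus mF F0.
pose V u (w : T) : path_space R := X u ^~ w.
have mV u : measurable_fun setT (V u) by apply: measurable_path => t; exact: mX.
apply: (@integral_prod_independent _ _ _ _ _ _ _ V mV _ uus _ F mF F0).
have mVB u (B : set (path_space R)) : measurable B -> measurable (V u @^-1` B).
  by move=> mB; rewrite -[X in measurable X]setTI; exact: mV.
(* Events are arbitrary along [us] and cylinders along [vs]. The induction on [us] moves its head to
   [vs], since only cylinders need be tested for it. *)
suff: forall us vs : seq I, uniq (us ++ vs) -> forall B : I -> set (path_space R),
    (forall u, measurable (B u)) ->
    (forall u, u \in vs -> path_cylinders (B u)) ->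
    P (\big[setI/setT]_(u <- us ++ vs) (V u @^-1` B u)) =
    (\prod_(u <- us ++ vs) P (V u @^-1` B u))%E.
  by move=> /(_ us [::]); rewrite cats0 => /(_ uus) + B mB; apply.
move=> {uus mF F0 F}{}us.
elim: us => [|u us IH] vs uusvs B mB cB.
  have : forall u, exists ntB : (nat * (nat -> R) * (nat -> set R)),
    (forall i, 0 <= ntB.1.2 i) /\ (forall i, measurable (ntB.2 i)) /\
    (u \in vs -> B u = [set z | forall i, (i < ntB.1.1)%N -> ntB.2 i (z (ntB.1.2 i))]).
    move=> u; have [uvs|uvs] := boolP (u \in vs).
      by have [n [t [C [t0 mC BE]]]] := cB u uvs; exists (n, t, C).
    exists (0%N, (fun=> 0), (fun=> setT)); split=> [i /=|]; first exact: lexx.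
    by split=> // i /=; exact: measurableT.
  move=> /choice[ntB ntBP].
  (* Independence is stated with one number of constraints for all indices: shorter cylinders are
     padded with the constraint [setT]. *)
  pose N := \max_(u <- vs) (ntB u).1.1.
  pose C u i := if (i < (ntB u).1.1)%N then (ntB u).2 i else setT.
  have cylE u : u \in vs -> V u @^-1` B u = cylinder (X u) N (ntB u).1.2 (C u).
    move=> uvs; rewrite ((ntBP u).2.2 uvs); apply/seteqP; split => w wB i /=.
      by move=> _; rewrite /C; case: ifPn => // /wB.
    move=> iu; have := wB i; rewrite /C iu; apply.
    by rewrite (leq_trans iu)// /N (big_rem u)//= leq_maxl.
  rewrite !cat0s big_seq (eq_bigr _ (fun u uvs => cylE u uvs)) -big_seq.
  rewrite indep//.
  - by rewrite big_seq [RHS]big_seq; apply: eq_bigr => u /cylE ->.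
  - by move=> u i; exact: (ntBP u).1.
  - by move=> u i; rewrite /C; case: ifP => // _; exact: (ntBP u).2.1.
rewrite /= !big_cons.
pose D := \big[setI/setT]_(v <- us ++ vs) (V v @^-1` B v).
have mD : measurable D by apply: bigsetI_measurable => v _; exact: mVB.
have PD : P D = (\prod_(v <- us ++ vs) P (V v @^-1` B v))%E.
  apply: IH => //; first by move: uusvs; rewrite cat_cons cons_uniq => /andP[].
rewrite -PD -/D.
have PDfin : P D \is a fin_num by exact: fin_num_measure.
have PD0 : (0 <= fine (P D)) by rewrite fine_ge0.
pose Vu : {mfun T >-> path_space R} :=
  HB.pack (V u) (isMeasurableFun.Build _ _ _ _ _ (mV u)).
pose m1 := pushforward (mrestr P mD) Vu.
pose m2 := pushforward (mscale (NngNum PD0) P) Vu.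
suff m12 : forall A : set (path_space R), measurable A -> m1 A = m2 A.
  have := m12 _ (mB u).
  by rewrite /m1 /m2 /pushforward/= /mrestr /mscale/= fineK// muleC.
apply: path_measure_unique => /=.
  rewrite /m1 /pushforward /mrestr preimage_setT setTI.
  by rewrite (le_lt_trans (probability_le1 P mD))// ltry.
move=> A cA; have mA : measurable (A : set (path_space R)) by exact: sub_sigma_algebra.
have perm_us : perm_eq (u :: us ++ vs) (us ++ u :: vs).
  by rewrite perm_sym perm_catC/= perm_cons perm_catC.
pose B' v := if v == u then A else B v.
have B'E v : v \in us ++ vs -> B' v = B v.
  move=> vusvs; rewrite /B'; case: eqP => // vu.
  by move: uusvs; rewrite /= -vu vusvs.
have := IH (u :: vs) _ B' _ _.
rewrite -!(perm_big _ perm_us)/= !big_cons.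
rewrite [in X in X -> _]/B' eqxx.
rewrite -(perm_uniq perm_us) => /(_ uusvs) E.
rewrite /m1 /m2 /pushforward/= /mrestr /mscale/= fineK// muleC.
have DE : D = \big[setI/setT]_(v <- us ++ vs) (V v @^-1` B' v).
  by rewrite /D big_seq [RHS]big_seq; apply: eq_bigr => v /B'E ->.
rewrite PD DE E.
- transitivity (P (V u @^-1` A) *
      \prod_(v <- us ++ vs) P (V v @^-1` B' v))%E; first by [].
  congr (_ * _)%E; rewrite big_seq [RHS]big_seq.
  by apply: eq_bigr => v /B'E ->.
- by move=> v; rewrite /B'; case: ifP.
- move=> v; rewrite inE /B'; case: eqP => //= vu; exact: cB.
Qed.

End path_law.

(** * Asymptotically vanishing functionals *)

Section elementary.
Variable R : realType.
Implicit Types (x c : R).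

Lemma expR_sub1_le x : expR x - 1 <= x * expR x.
Proof.
have := expR_ge1Dx (- x); rewrite expRN => h.
have : (1 - x) * expR x <= (expR x)^-1 * expR x.
  by rewrite ler_wpM2r ?expR_ge0.
rewrite mulVf ?expR_eq0// => {}h; lra.
Qed.

Lemma expR_taylor1 x : `|expR x - 1 - x| <= x ^+ 2 * expR `|x|.
Proof.
have h1 := expR_ge1Dx x; have h2 := expR_sub1_le x.
rewrite ger0_norm; last lra.
have [x0|x0] := leP 0 x.
  rewrite ger0_norm//.
  have : x * (expR x - 1) <= x * (x * expR x) by rewrite ler_wpM2l.
  by rewrite mulrA -expr2; lra.
rewrite ltr0_norm//.
have e1 : 1 <= expR (- x) by rewrite -[leLHS]expR0 ler_expR; lra.
apply: (@le_trans _ _ (x ^+ 2)).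
  have : x * (expR x - 1) <= x * x by rewrite ler_wnM2l; lra.
  by rewrite -expr2; lra.
by rewrite ler_peMr// sqr_ge0.
Qed.

(** For a positive exponent m, the inequality y <= e^y at y = c |x| / m is raised to the power m. *)
Lemma pow_le_expR m c : 0 < c ->
  exists C : R, 0 <= C /\ forall x, `|x| ^+ m <= C * expR (c * `|x|).
Proof.
move=> c0; case: m => [|m].
  exists 1; split=> // x; rewrite expr0 mul1r -[leLHS]expR0 ler_expR.
  by rewrite mulr_ge0// ltW.
exists ((m.+1%:R / c) ^+ m.+1); split.
  by rewrite exprn_ge0// divr_ge0// ltW.
move=> x; pose y := c * `|x| / m.+1%:R.
have cxE : c * `|x| = m.+1%:R * y by rewrite /y mulrCA divff ?mulr1 ?gt_eqF.
rewrite cxE.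
rewrite expRM_natl -exprMn; apply: lerXn2r; rewrite ?nnegrE//.
  by rewrite mulr_ge0 ?expR_ge0// divr_ge0// ltW.
apply: (@le_trans _ _ (m.+1%:R / c * y)).
  by rewrite mulrAC -cxE mulrAC divff ?mul1r ?gt_eqF.
rewrite ler_wpM2l//; first by rewrite divr_ge0// ltW.
by have := expR_ge1Dx y; lra.
Qed.

(** For k >= N, |x|^k / k! is at most 2^-N (2 |x|)^k / k!, so the tail is compared with the
    exponential series at 2 |x|. The factor 2^-N makes the convergence uniform relative to an
    exponential weight. *)
Lemma sin_taylor x N :
  `|sin x - series (sin_coeff x) N| <= 2^-1 ^+ N * expR (2 * `|x|).
Proof.
have cs : series (sin_coeff x) @ \oo --> sin x.
  by rewrite sin.unlock; exact: is_cvg_series_sin_coeff.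
have cabs : `|series (sin_coeff x) M - series (sin_coeff x) N| @[M --> \oo]
    --> `|sin x - series (sin_coeff x) N|.
  by apply: cvg_norm; apply: cvgB => //; exact: cvg_cst.
have le1 M : (N <= M)%N -> `|series (sin_coeff x) M - series (sin_coeff x) N| <=
    2^-1 ^+ N * expR (2 * `|x|).
  move=> NM; rewrite sub_series_geq//.
  have x0 : 0 <= 2 * `|x| by rewrite mulr_ge0.
  apply: (@le_trans _ _ (\sum_(N <= k < M) 2^-1 ^+ N * exp_coeff (2 * `|x|) k)).
    apply: le_trans (ler_norm_sum _ _ _) _.
    rewrite big_nat_cond [leRHS]big_nat_cond; apply: ler_sum => k.
    rewrite andbT => /andP[Nk _].
    apply: (@le_trans _ _ (`|x| ^+ k / k`!%:R)).
      rewrite /sin_coeff/= !normrM normrX normfV !normr_nat normrX normrN1 expr1n mulr1.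
      rewrite ler_wpM2r ?invr_ge0// ler_piMl ?exprn_ge0//.
      by case: (odd k).
    rewrite /exp_coeff/= exprMn mulrA mulrA ler_wpM2r ?invr_ge0//.
    rewrite ler_peMl ?exprn_ge0//.
    rewrite -(subnKC Nk) exprD mulrA -exprMn mulVf ?gt_eqF// expr1n mul1r.
    by rewrite exprn_ege1// ler1n.
  rewrite -mulr_sumr ler_wpM2l ?exprn_ge0 ?invr_ge0//.
  apply: (@le_trans _ _ (series (exp_coeff (2 * `|x|)) M)).
    rewrite /series/= [leRHS](@big_cat_nat _ _ _ N)//= lerDr sumr_ge0// => k _.
    by rewrite exp_coeff_ge0.
  apply: nondecreasing_cvgn_le.
    move=> a b ab; rewrite -subr_ge0 sub_series_geq// sumr_ge0// => k _.
    by rewrite exp_coeff_ge0.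
  exact: is_cvg_series_exp_coeff.
rewrite -(cvg_lim _ cabs)//; apply: limr_le.
  by apply/cvg_ex; eexists; exact: cabs.
by exists N => // M /= NM; exact: le1.
Qed.

End elementary.

Section bernstein.
Variable R : realType.
Implicit Types (h g : nat -> R) (u a : R).

(* The expectation of [h] under the binomial distribution of parameters n, u,
   i.e. a Bernstein polynomial in u. *)
Fixpoint bernstein n h u : R :=
  if n is m.+1 then u * bernstein m (h \o S) u + (1 - u) * bernstein m h u
  else h 0%N.

Lemma bernstein_le n h g u : 0 <= u <= 1 -> (forall k, h k <= g k) ->
  bernstein n h u <= bernstein n g u.
Proof.
move=> /andP[u0 u1]; elim: n h g => [|n IH] h g hg //=.
by rewrite lerD// ler_wpM2l ?subr_ge0//; apply: IH => k; exact: hg.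
Qed.

Lemma bernsteinD n h g u :
  bernstein n (fun k => h k + g k) u = bernstein n h u + bernstein n g u.
Proof.
elim: n h g => [//|n IH] h g /=.
rewrite IH (_ : _ \o _ = (fun k => (h \o S) k + (g \o S) k))// IH; ring.
Qed.

Lemma bernsteinZ n a h u : bernstein n (fun k => a * h k) u = a * bernstein n h u.
Proof.
elim: n h => [//|n IH] h /=.
rewrite IH (_ : _ \o _ = (fun k => a * (h \o S) k))// IH; ring.
Qed.

Lemma bernstein_cst n a u : bernstein n (fun=> a) u = a.
Proof. by elim: n => //= n IH; rewrite (_ : _ \o _ = fun=> a)// IH; ring. Qed.

Lemma bernstein_var n a u :
  bernstein n (fun k => (k%:R - a) ^+ 2) u = (n%:R * u - a) ^+ 2 + n%:R * u * (1 - u).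
Proof.
elim: n a => [|n IH] a /=; first by rewrite !mul0r addr0.
rewrite IH (_ : _ \o _ = (fun k => (k%:R - (a - 1)) ^+ 2)); last first.
  by apply/funext => k /=; rewrite -natr1; ring.
rewrite IH -natr1; ring.
Qed.

(** Chebyshev's argument: where F(k/n) and F(u) differ by more than e, k/n is at distance at least d
    from u, and the difference is at most 2 M (k/n - u)^2 / d^2. The variance u (1 - u) / n of k/n
    makes the average of this bound at most e for n large. *)
Lemma bernstein_approx (F : R -> R) (M e d : R) : 0 < e -> 0 < d ->
  (forall u, `|F u| <= M) ->
  (forall u v, 0 <= u <= 1 -> `|u - v| < d -> `|F u - F v| <= e) ->
  exists n, forall u, 0 <= u <= 1 ->
    `|bernstein n (fun k => F (k%:R / n%:R)) u - F u| <= 2 * e.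
Proof.
move=> e0 d0 FM Fd.
have M0 : 0 <= M := le_trans (normr_ge0 _) (FM 0).
pose K := 2 * M / d ^+ 2.
have K0 : 0 <= K by apply: divr_ge0; [exact: mulr_ge0|exact: sqr_ge0].
have [n nK] : exists n : nat, K / e < n%:R.
  by exists (Num.truncn (K / e)).+1; exact: truncnS_gt.
have n0 : 0 < n%:R :> R by apply: le_lt_trans nK; rewrite divr_ge0// ltW.
exists n => u u01.
have hF k : `|F (k%:R / n%:R) - F u| <= e + K / n%:R ^+ 2 * (k%:R - n%:R * u) ^+ 2.
  have -> : K / n%:R ^+ 2 * (k%:R - n%:R * u) ^+ 2 = K * (u - k%:R / n%:R) ^+ 2.
    by field; rewrite gt_eqF.
  have [ud|ud] := ltP `|u - k%:R / n%:R| d.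
    rewrite distrC (le_trans (Fd _ _ u01 ud))// lerDl mulr_ge0// sqr_ge0.
    by [].
  apply: (@le_trans _ _ (2 * M)).
    have -> : 2 * M = M + M by ring.
    by rewrite (le_trans (ler_normB _ _))// lerD.
  rewrite -[leLHS]add0r lerD ?(ltW e0)//.
  have -> : K * (u - k%:R / n%:R) ^+ 2 = 2 * M * ((u - k%:R / n%:R) ^+ 2 / d ^+ 2).
    by rewrite /K mulrA mulrAC.
  rewrite ler_peMr ?mulr_ge0// ler_pdivlMr ?exprn_gt0// mul1r.
  rewrite -[leRHS]real_normK ?num_real//.
  by rewrite ler_pXn2r ?nnegrE ?(ltW d0).
pose A := bernstein n (fun k => e + K / n%:R ^+ 2 * (k%:R - n%:R * u) ^+ 2) u.
have AE : A <= 2 * e.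
  rewrite /A bernsteinD bernstein_cst bernsteinZ bernstein_var subrr expr0n/= add0r.
  have -> : K / n%:R ^+ 2 * (n%:R * u * (1 - u)) = K / n%:R * (u * (1 - u)).
    by field; rewrite gt_eqF.
  have Kn : K / n%:R <= e.
    by rewrite ler_pdivrMr// mulrC -ler_pdivrMr// ltW.
  have u1 : 0 <= u * (1 - u) <= 1 by nra.
  have : K / n%:R * (u * (1 - u)) <= K / n%:R * 1.
    by apply: ler_wpM2l; [apply: divr_ge0 => //; exact: ltW|case/andP: u1].
  lra.
rewrite -[X in _ - X](bernstein_cst n _ u) -mulN1r -bernsteinZ -bernsteinD.
rewrite (le_trans _ AE)// ler_norml; apply/andP; split.
  rewrite /A -[- bernstein _ _ _]mulN1r -bernsteinZ; apply: bernstein_le => // k.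
  by have := hF k; rewrite ler_norml => /andP[]; lra.
apply: bernstein_le => // k.
by have := hF k; rewrite ler_norml => /andP[]; lra.
Qed.

End bernstein.

Lemma leq_increasing_seq (f : nat -> nat) n : increasing_seq f -> (n <= f n)%N.
Proof.
move=> fi; elim: n => // n IH; apply: (leq_ltn_trans IH).
have fS : (f n <= f n.+1)%N by have := fi n n.+1; rewrite !leEnat leqnSn.
have : ~~ (f n.+1 <= f n)%N by have := fi n.+1 n; rewrite !leEnat ltnn => ->.
by rewrite -ltnNge.
Qed.

(** [v] is free because [bernstein_le] compares functions at every integer k, and k / n may leave
    the unit interval. As [u] stays in it, counterexamples with smaller and smaller distances would
    accumulate at a point. *)
Lemma continuous_itv01_uniform (R : realType) (F : R -> R) (e : R) : 0 < e ->
  continuous F -> exists2 d, 0 < d & forall u v, 0 <= u <= 1 -> `|u - v| < d ->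
    `|F u - F v| <= e.
Proof.
move=> e0 cF; apply: contrapT => nd.
have /choice[uv uvP] n : exists uv : R * R, [/\ 0 <= uv.1 <= 1,
    `|uv.1 - uv.2| < n.+1%:R^-1 & e < `|F uv.1 - F uv.2|].
  apply: contrapT => nuv; apply: nd; exists n.+1%:R^-1; first by rewrite invr_gt0.
  move=> u v u01 uv; rewrite leNgt; apply/negP => Fuv.
  by apply: nuv; exists (u, v).
have bu : bounded_fun (fun n => (uv n).1).
  exists 1; split; first exact: num_real.
  move=> x x1 n _ /=; have [/andP[u0 u1] _ _] := uvP n.
  by rewrite ger0_norm// (le_trans u1)// ltW.
have [f fi /cvg_ex[l ul]] := bolzano_weierstrass bu.
have dl : (uv (f n)).1 - (uv (f n)).2 @[n --> \oo] --> 0.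
  apply/cvgr0Pnorm_lt => x x0.
  have [N _ HN] : \forall n \near \oo, n.+1%:R^-1 < x :> R.
    exact: near_infty_natSinv_lt (PosNum x0).
  exists N => // n /= Nn; have [_ + _] := uvP (f n); move=> /lt_trans; apply.
  by apply: HN => /=; rewrite (leq_trans Nn)// leq_increasing_seq.
have vl : (uv (f n)).2 @[n --> \oo] --> l.
  rewrite (_ : (fun n => (uv (f n)).2) =
      (fun n => (uv (f n)).1 - ((uv (f n)).1 - (uv (f n)).2))); last first.
    by apply/funext => n; ring.
  by rewrite -[l]subr0; exact: cvgB ul dl.
have Fu : F (uv (f n)).1 @[n --> \oo] --> F l by apply: continuous_cvg => //; exact: cF.
have Fv : F (uv (f n)).2 @[n --> \oo] --> F l by apply: continuous_cvg => //; exact: cF.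
have Fuv : F (uv (f n)).1 - F (uv (f n)).2 @[n --> \oo] --> 0.
  by rewrite -[X in _ --> X](subrr (F l)); exact: cvgB Fu Fv.
have /cvgr0Pnorm_lt /(_ _ e0)[N _ /(_ N (leqnn N))/=] := Fuv.
by have [_ _ h] := uvP (f N); rewrite ltNge (ltW h).
Qed.

Section determinacy.
Variables (R : realType) (eta : R) (L : nat -> (R -> R) -> R) (B : R).
Hypotheses (eta0 : 0 < eta) (B0 : 0 <= B).

Definition exp_growth (f : R -> R) := measurable_fun setT f /\
  exists C, forall y, `|f y| <= C * expR (eta * `|y|).

Hypothesis L_linear : forall n a f g, exp_growth f -> exp_growth g ->
  L n (fun y => a * f y + g y) = a * L n f + L n g.
Hypothesis L_bounded : forall n (f : R -> R) C, measurable_fun setT f ->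
  (forall y, `|f y| <= C * expR (eta * `|y|)) -> `|L n f| <= C * B.
Hypothesis L_exp : forall theta, `|theta| <= eta ->
  L n (fun y => expR (theta * y)) @[n --> \oo] --> 0.

(** [L n] will be the error made in a convergence of measures. The functions on which it vanishes
    asymptotically form a vector space which, by the uniform bound, is closed for the norm sup
    |f(y)| e^(- eta |y|). *)
Let null f := exp_growth f /\ L n f @[n --> \oo] --> 0.

Let exp_growth0 : exp_growth (cst 0).
Proof.
split; first exact: measurable_cst.
by exists 0 => y; rewrite normr0 mul0r.
Qed.

Let exp_growth_lin a f g : exp_growth f -> exp_growth g ->
  exp_growth (fun y => a * f y + g y).
Proof.
move=> [mf [C fC]] [mg [D gD]]; split.
  by apply: measurable_funD => //; apply: measurable_funM => //; exact: measurable_cst.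
exists (`|a| * C + D) => y; rewrite (le_trans (ler_normD _ _))// mulrDl lerD//.
by rewrite normrM -mulrA ler_wpM2l.
Qed.

Let L0 n : L n (cst 0) = 0.
Proof.
have := L_linear n 1 exp_growth0 exp_growth0.
rewrite (_ : (fun _ => _) = cst 0); last by apply/funext => y /=; rewrite mul1r addr0.
by rewrite mul1r => /eqP; rewrite -subr_eq subrr eq_sym => /eqP.
Qed.

Let null_lin a f g : null f -> null g -> null (fun y => a * f y + g y).
Proof.
move=> [ef Lf] [eg Lg]; split; first exact: exp_growth_lin.
under eq_fun do rewrite (L_linear _ _ ef eg).
have : a * L n f + L n g @[n --> \oo] --> a * 0 + 0.
  by apply: cvgD => //; exact: cvgMr.
by rewrite mulr0 addr0.
Qed.

Let null0 : null (cst 0).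
Proof. by split=> //; under eq_fun do rewrite L0; exact: cvg_cst. Qed.

Let null_scale a f : null f -> null (fun y => a * f y).
Proof.
move=> nf; have := null_lin a nf null0.
by rewrite (_ : (fun _ => _) = fun y => a * f y)//; apply/funext => y /=; rewrite addr0.
Qed.

Let null_approx (f : R -> R) : measurable_fun setT f ->
  (forall e, 0 < e -> exists2 g, null g &
    forall y, `|f y - g y| <= e * expR (eta * `|y|)) ->
  null f.
Proof.
move=> mf fg; have ef : exp_growth f.
  have [g [[mg [C gC]] _] fgC] := fg 1 ltr01; split=> //.
  exists (C + 1) => y; rewrite mulrDl -[f y](subrK (g y)) addrC.
  by rewrite (le_trans (ler_normD _ _))// lerD.
split=> //; apply/cvgr0Pnorm_le => e e0.
have [g [eg Lg] fgC] := fg (e / (2 * (B + 1))) (divr_gt0 e0 (mulr_gt0 (ltr0Sn _ _) (ltr_wpDl B0 ltr01))).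
have e20 : 0 < e / 2 by rewrite divr_gt0.
have /cvgr0Pnorm_le/(_ _ e20) := Lg.
apply: filterS => n Lgn.
have := L_linear n (-1) eg ef.
set h := (fun y => _) => hE.
have hB : `|L n h| <= e / (2 * (B + 1)) * B.
  apply: L_bounded; first by have [] := exp_growth_lin (-1) eg ef.
  by move=> y; rewrite /h mulN1r addrC.
have : `|L n h| <= e / 2.
  rewrite (le_trans hB)// mulrAC ler_pdivrMr; last by move: B0; lra.
  by move: B0 e0; nra.
have -> : L n f = L n h + L n g by rewrite hE; ring.
by move=> ?; rewrite (le_trans (ler_normD _ _))// [leRHS](splitr e) lerD.
Qed.

Let mexp c : measurable_fun setT (fun y : R => expR (c * y)).
Proof.
by apply: measurableT_comp => //; apply: measurable_funM => //; exact: measurable_cst.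
Qed.

(** A difference quotient in theta of step h raises the power of y by one. Half of the margin eta -
    |theta| absorbs the factor e^(h |y|) of the Taylor remainder and the other half the power |y|^(k
    + 2). *)
Let null_pow_exp k theta : `|theta| < eta -> null (fun y => y ^+ k * expR (theta * y)).
Proof.
elim: k theta => [|k IH] theta theta_eta.
  rewrite (_ : (fun _ => _) = (fun y => expR (theta * y))); last first.
    by apply/funext => y; rewrite expr0 mul1r.
  split; last exact/L_exp/ltW.
  split=> //; exists 1 => y; rewrite mul1r ger0_norm ?expR_ge0// ler_expR.
  by rewrite (le_trans (ler_norm _))// normrM ler_wpM2r// ltW.
pose c := (eta - `|theta|) / 2.
have c0 : 0 < c by rewrite divr_gt0// subr_gt0.
have [C [C0 HC]] := pow_le_expR k.+2 c0.
apply: null_approx.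
  by apply: measurable_funM.
move=> e e0; pose h := Num.min c (e / (C + 1)).
have h0 : 0 < h by rewrite lt_min c0 divr_gt0// ltr_wpDl.
have hc : h <= c by rewrite ge_min lexx.
have hC : h * C <= e.
  have : h <= e / (C + 1) by rewrite ge_min lexx orbT.
  rewrite ler_pdivlMr ?ltr_wpDl// => /(le_trans _); apply.
  by rewrite ler_wpM2l ?(ltW h0)//; lra.
have th_eta : `|theta + h| < eta.
  have := ler_normD theta h; rewrite (gtr0_norm h0).
  by move: hc; rewrite /c; lra.
exists (fun y => h^-1 * (-1 * (y ^+ k * expR (theta * y)) + y ^+ k * expR ((theta + h) * y))).
  by apply: null_scale; apply: null_lin; apply: IH.
move=> y.
have -> : y ^+ k.+1 * expR (theta * y) -
    h^-1 * (-1 * (y ^+ k * expR (theta * y)) + y ^+ k * expR ((theta + h) * y)) =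
    - (y ^+ k * expR (theta * y) * h^-1 * (expR (h * y) - 1 - h * y)).
  rewrite mulrDl expRD exprS; field; by rewrite gt_eqF.
rewrite normrN normrM.
have t1 := expR_taylor1 (h * y).
apply: (le_trans (ler_wpM2l _ t1)) => //.
rewrite !normrM normrX normfV (gtr0_norm h0) (ger0_norm (expR_ge0 _)) exprMn.
have -> : `|y| ^+ k * expR (theta * y) / h * (h ^+ 2 * y ^+ 2 * expR (h * `|y|)) =
    h * (`|y| ^+ k.+2 * (expR (theta * y) * expR (h * `|y|))).
  have E (a x z w t : R) : t != 0 ->
      a * x / t * (t ^+ 2 * z ^+ 2 * w) = t * (z * (z * a) * (x * w)).
    by move=> t_neq0; field.
  by rewrite -(real_normK (num_real y)) (exprS _ k.+1) (exprS _ k) E ?gt_eqF.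
rewrite -expRD.
apply: (@le_trans _ _ (h * (C * expR (c * `|y|) * expR ((eta - c) * `|y|)))).
  rewrite ler_wpM2l ?(ltW h0)// ler_pM ?exprn_ge0 ?expR_ge0// ler_expR.
  have : theta * y <= `|theta| * `|y| by rewrite -normrM ler_norm.
  have : h * `|y| <= c * `|y| by rewrite ler_wpM2r.
  have -> : (eta - c) * `|y| = `|theta| * `|y| + c * `|y| by rewrite /c; field.
  lra.
have -> : h * (C * expR (c * `|y|) * expR ((eta - c) * `|y|)) =
    h * C * (expR (c * `|y|) * expR ((eta - c) * `|y|)) by ring.
by rewrite -expRD -mulrDl addrC subrK ler_wpM2r ?expR_ge0.
Qed.

Let null_pow k : null (fun y => y ^+ k).
Proof.
have := @null_pow_exp k 0; rewrite normr0 => /(_ eta0).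
rewrite (_ : (fun _ => _) = (fun y => y ^+ k))//.
by apply/funext => y; rewrite mul0r expR0 mulr1.
Qed.

(** A Taylor polynomial of sin multiplies f by powers of y, so all moments are carried along;
    boundedness controls the product of f with the Taylor remainder. *)
Let moments_null (f : R -> R) := [/\ measurable_fun setT f, exists C, forall y, `|f y| <= C &
  forall k, null (fun y => y ^+ k * f y)].

Let moments_null1 : moments_null (cst 1).
Proof.
split; [exact: measurable_cst|by exists 1 => y; rewrite normr1|move=> k].
by rewrite (_ : (fun _ => _) = fun y => y ^+ k)//; apply/funext => y; rewrite mulr1.
Qed.

Let moments_null_lin a f g : moments_null f -> moments_null g ->
  moments_null (fun y => a * f y + g y).
Proof.
move=> [mf [C fC] nf] [mg [D gD] ng]; split.
- by apply: measurable_funD => //; apply: measurable_funM => //; exact: measurable_cst.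
- exists (`|a| * C + D) => y; rewrite (le_trans (ler_normD _ _))// lerD//.
  by rewrite normrM ler_wpM2l.
- move=> k; have := null_lin a (nf k) (ng k).
  rewrite (_ : (fun _ => _) = (fun y => y ^+ k * (a * f y + g y)))//.
  by apply/funext => y; ring.
Qed.

(** The Taylor remainder of sin (s y) is controlled by e^(2 s |y|), hence by e^(eta |y| / 2) as 4 s
    <= eta; the other half of the exponent pays for |y|^k. *)
Let moments_null_sin s f : 0 < s -> 4 * s <= eta -> moments_null f ->
  moments_null (fun y => sin (s * y) * f y).
Proof.
move=> s0 s_eta [mf [C fC] nf].
have C0 : 0 <= C := le_trans (normr_ge0 _) (fC 0).
have msin : measurable_fun setT (fun y : R => sin (s * y)).
  apply: continuous_measurable_fun => y.
  by apply: continuous_comp; [exact: mulrl_continuous|exact: continuous_sin].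
split.
- exact: measurable_funM.
- exists C => y; rewrite normrM (le_trans _ (fC y))// ler_piMl//.
  by rewrite ler_norml sin_geN1 sin_le1.
move=> k.
have eta20 : 0 < eta / 2 by rewrite divr_gt0.
have [D [D0 HD]] := pow_le_expR k eta20.
apply: null_approx; first by apply: measurable_funM => //; exact: measurable_funM.
move=> e e0.
have [N HN] : exists N, 2^-1 ^+ N * (C * D) <= e.
  have : 2^-1 ^+ N * (C * D) @[N --> \oo] --> 0 * (C * D).
    by apply: cvgMl; apply: cvg_expr; rewrite ger0_norm; lra.
  rewrite mul0r => /cvgr0Pnorm_le /(_ _ e0) [N _ /(_ N (leqnn N)) /=].
  by move=> /(le_trans (ler_norm _)); exists N.
exists (fun y => y ^+ k * (series (sin_coeff (s * y)) N * f y)).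
  elim: N {HN} => [|N IH].
    rewrite (_ : (fun _ => _) = cst 0)//; apply/funext => y.
    by rewrite /series/= big_geq// mul0r mulr0.
  have := null_lin ((odd N)%:R * (-1) ^+ N.-1./2 * (N`!%:R)^-1 * s ^+ N) (nf (k + N)%N) IH.
  rewrite (_ : (fun _ => _) =
    (fun y => y ^+ k * (series (sin_coeff (s * y)) N.+1 * f y)))//.
  apply/funext => y; rewrite /series/= big_nat_recr//= /sin_coeff/= exprMn exprD.
  ring.
move=> y; rewrite -mulrBr -mulrBl !normrM normrX.
apply: (@le_trans _ _ (D * expR (eta / 2 * `|y|) *
    (2^-1 ^+ N * expR (2 * `|s * y|) * C))).
  by apply: ler_pM => //; apply: ler_pM => //; exact: sin_taylor.
have -> : D * expR (eta / 2 * `|y|) * (2^-1 ^+ N * expR (2 * `|s * y|) * C) =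
   2^-1 ^+ N * (C * D) * (expR (eta / 2 * `|y|) * expR (2 * `|s * y|)) by ring.
rewrite -expRD ler_pM ?expR_ge0//.
  by rewrite mulr_ge0 ?exprn_ge0 ?mulr_ge0.
rewrite ler_expR normrM (gtr0_norm s0).
have : 4 * s * `|y| <= eta * `|y| by rewrite ler_wpM2r.
lra.
Qed.

Let moments_null_bernstein s n h : 0 < s -> 4 * s <= eta ->
  moments_null (fun y => bernstein n h ((1 + sin (s * y)) / 2)).
Proof.
move=> s0 s_eta; elim: n h => [|n IH] h /=.
  have := moments_null_lin (h 0%N) moments_null1
    (moments_null_lin (-1) moments_null1 moments_null1).
  rewrite (_ : (fun _ => _) = (fun=> h 0%N))//.
  by apply/funext => y /=; ring.
have H1 := IH (h \o S); have H2 := IH h.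
have H := moments_null_lin (-1) H2 H1.
have H0 := moments_null_lin (-1) moments_null1 moments_null1.
have := moments_null_lin 2^-1 (moments_null_sin s0 s_eta H)
  (moments_null_lin 2^-1 H1 (moments_null_lin 2^-1 H2 H0)).
rewrite (_ : (fun _ => _) = (fun y => (1 + sin (s * y)) / 2 *
    bernstein n (h \o S) ((1 + sin (s * y)) / 2) +
    (1 - (1 + sin (s * y)) / 2) * bernstein n h ((1 + sin (s * y)) / 2)))//.
by apply/funext => y /=; field.
Qed.

(* Difference quotients of exponentials show that [L n] tends to 0 on polynomials,
   Taylor expansion extends this to products with powers of [sin (s * y)], hence to
   Bernstein polynomials in [(1 + sin (s * y)) / 2], which approximate [g]. *)
Lemma L_compact_support (g : R -> R) (K0 : R) : continuous g ->
  (forall y, K0 < `|y| -> g y = 0) -> L n g @[n --> \oo] --> 0.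
Proof.
move=> cg gK0.
have [M gM] : exists M, forall y, `|g y| <= M.
  have K0le : - (`|K0| + 1) <= `|K0| + 1 :> R.
    by rewrite (@le_trans _ _ 0)// ?oppr_le0 addr_ge0.
  have cng : {within `[- (`|K0| + 1), `|K0| + 1], continuous (fun y => `|g y|)}.
    apply: continuous_subspaceT => y.
    by apply: continuous_comp; [exact: cg|exact: norm_continuous].
  have [c _ cmax] := EVT_max K0le cng.
  exists `|g c| => y; have [yK|yK] := leP `|y| (`|K0| + 1).
    by apply: cmax; rewrite in_itv/= -ler_norml.
  rewrite gK0 ?normr0//; apply: le_lt_trans yK.
  by rewrite (le_trans (ler_norm _))// lerDl.
have M0 : 0 <= M := le_trans (normr_ge0 _) (gM 0).
suff [_ //] : null g.
apply: null_approx; first exact: continuous_measurable_fun.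
move=> e e0.
(* The three bounds put the support of g in |y| <= K / 2, make 4 / K at most eta, and give M <= e
   eta |y| beyond K, where g vanishes but its periodic approximation does not. *)
pose K := Num.max (2 * `|K0| + 1) (Num.max (4 / eta) (M / e / eta)).
have K1 : 2 * `|K0| + 1 <= K by rewrite le_max lexx.
have K2 : 4 / eta <= K by rewrite !le_max lexx orbT.
have K3 : M / e / eta <= K by rewrite !le_max lexx !orbT.
have Kgt0 : 0 < K by rewrite (lt_le_trans _ K1)// ltr_wpDl// mulr_ge0.
pose t (u : R) : R := 2 * u - 1.
(* For |y| <= K, y is recovered from u = (1 + sin (y / K)) / 2, so g(y) is F(u). The extension by 0
   is continuous because g already vanishes where |2 u - 1| exceeds sin (1/2). *)
pose F u := if `|t u| < 1 then g (K * asin (t u)) else 0.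
have FM u : `|F u| <= M by rewrite /F; case: ifP => _//; rewrite normr0.
have ct : continuous t.
  move=> u; apply: cvgB; last exact: cvg_cst.
  exact: mulrl_continuous.
have half_pi : (2^-1 : R) \in `[(- (pi / 2)), pi / 2].
  by rewrite in_itv/=; have := @pihalf_ge1 R; lra.
have Nhalf_pi : (- 2^-1 : R) \in `[(- (pi / 2)), pi / 2].
  by rewrite in_itv/=; have := @pihalf_ge1 R; lra.
have F0 u : sin 2^-1 < `|t u| -> F u = 0.
  rewrite /F => tu; case: ifPn => // t1; apply: gK0.
  have t11 : -1 <= t u <= 1 by rewrite -ler_norml ltW.
  have asin_pi : asin (t u) \in `[(- (pi / 2)), pi / 2].
    by rewrite in_itv/= asin_geNpi2// asin_lepi2.
  have : 2^-1 < `|asin (t u)|.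
    rewrite ltNge; apply/negP; rewrite ler_norml => /andP[a1 a2].
    move: tu; rewrite ltNge => /negP; apply; rewrite ler_norml.
    rewrite -sinN -[t u]asinK ?in_itv//=.
    by rewrite !leNgt !ltr_sin// -!leNgt a1.
  rewrite normrM gtr0_norm// => ha.
  have : K * 2^-1 < K * `|asin (t u)| by rewrite ltr_pM2l.
  have := ler_norm K0; move: K1; lra.
have cF : continuous F.
  move=> u; have [tu|tu] := ltP `|t u| 1.
    have FE : {near u, (fun u => g (K * asin (t u))) =1 F}.
      have : \forall v \near u, `|t v| < 1.
        exact: (cvgr_norm_lt _ (ct u)).
      by apply: filterS => v tv; rewrite /F tv.
    rewrite /continuous_at {2}/F tu.
    apply: (cvg_trans (near_eq_cvg FE)).
    apply: continuous_cvg; first exact: cg.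
    apply: cvgMr; apply: continuous_cvg; last exact: ct.
    by apply: continuous_asin; rewrite -ltr_norml.
  have su : sin 2^-1 < `|t u|.
    rewrite (lt_le_trans _ tu)// -[ltRHS]sin_pihalf ltr_sin//.
      by have := @pihalf_ge1 R; lra.
    by rewrite in_itv/=; have := @pihalf_ge1 R; lra.
  rewrite /continuous_at F0//; apply: cvg_near_cst.
  have : \forall v \near u, sin 2^-1 < `|t v|.
    exact: (cvgr_norm_gt _ (ct u)).
  by apply: filterS => v; exact: F0.
have e20 : 0 < e / 2 by rewrite divr_gt0.
have [d d0 Fd] := continuous_itv01_uniform e20 cF.
have [n Fn] := bernstein_approx e20 d0 FM Fd.
pose s := K^-1; have s0 : 0 < s by rewrite invr_gt0.
have s_eta : 4 * s <= eta by rewrite /s ler_pdivrMr// -ler_pdivrMl// mulrC.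
exists (fun y => bernstein n (fun k => F (k%:R / n%:R)) ((1 + sin (s * y)) / 2)).
  have [_ _ /(_ 0%N)] := moments_null_bernstein n (fun k => F (k%:R / n%:R)) s0 s_eta.
  by rewrite (_ : (fun y => y ^+ 0 * _) = (fun y =>
    bernstein n (fun k => F (k%:R / n%:R)) ((1 + sin (s * y)) / 2)))//;
    apply/funext => y; rewrite expr0 mul1r.
move=> y; pose u := (1 + sin (s * y)) / 2.
have u01 : 0 <= u <= 1.
  by have := sin_geN1 (s * y); have := sin_le1 (s * y); rewrite /u; lra.
have tuE : t u = sin (s * y) by rewrite /t /u; field.
have := Fn u u01; rewrite (_ : 2 * (e / 2) = e); last by field.
rewrite -/u => Fne.
have [yK|yK] := leP `|y| K.
  have sy1 : `|s * y| <= 1.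
    by rewrite normrM (gtr0_norm s0) /s mulrC ler_pdivrMr// mul1r.
  have sy_pi : s * y \in `[(- (pi / 2)), pi / 2].
    by move: sy1; rewrite in_itv/= ler_norml; have := @pihalf_ge1 R; lra.
  have gF : g y = F u.
    rewrite /F tuE sinK// {2}/s mulrA divff ?gt_eqF// mul1r.
    case: ifPn => //; rewrite -leNgt => sin1.
    apply: gK0; rewrite ltNge; apply/negP => yK0.
    have : `|s * y| <= 2^-1.
      rewrite normrM (gtr0_norm s0) /s mulrC ler_pdivrMr//.
      by move: (ler_norm K0) K1 yK0; lra.
    rewrite ler_norml => /andP[a1 a2].
    have : `|sin (s * y)| <= sin 2^-1.
      by rewrite ler_norml -sinN !leNgt !ltr_sin// -!leNgt a1.
    move=> /(le_trans sin1); rewrite leNgt -[X in _ < X]sin_pihalf ltr_sin//.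
      by have := @pihalf_ge1 R; lra.
    by rewrite in_itv/=; have := @pihalf_ge1 R; lra.
  rewrite gF distrC (le_trans Fne)// ler_peMr ?(ltW e0)//.
  by rewrite -[leLHS]expR0 ler_expR mulr_ge0// ltW.
rewrite gK0 ?sub0r ?normrN; last first.
  by move: (ler_norm K0) K1 yK (normr_ge0 K0); lra.
apply: (@le_trans _ _ (M + e)).
  rewrite -[X in `|X|](subrK (F u)) (le_trans (ler_normD _ _))// addrC lerD//.
apply: (@le_trans _ _ (e * (1 + eta * `|y|))); last first.
  by rewrite ler_wpM2l ?(ltW e0)// expR_ge1Dx.
rewrite mulrDr mulr1 addrC lerD2l mulrA -ler_pdivrMl ?mulr_gt0//.
apply: (le_trans _ (ltW yK)); apply: le_trans K3.
by rewrite invfM mulrC mulrA.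
Qed.

End determinacy.

(** * Increments of the killed process *)

Section event_path.
Variable R : realType.

Lemma integral_event_path_independent d (T : measurableType d) (P : probability T R)
    (X : R -> T -> R) (D : set T) (F : path_space R -> \bar R) :
  (forall t, 0 <= t -> measurable_fun setT (X t)) -> measurable D ->
  (forall n (t : nat -> R) (B : nat -> set R), (forall i, 0 <= t i) ->
    (forall i, measurable (B i)) ->
    P (D `&` cylinder X n t B) = (P D * P (cylinder X n t B))%E) ->
  measurable_fun setT F -> (forall z, 0 <= F z)%E ->
  (\int[P]_w (F (X ^~ w) * (\1_D w)%:E) = P D * \int[P]_w F (X ^~ w))%E.
Proof.
move=> mX mD indep mF F0.
pose V (w : T) : path_space R := X ^~ w.
have mV : measurable_fun setT V by exact: measurable_path.
apply: (@integral_weighted_law _ _ _ _ _ _ V) => //.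
  by apply/measurable_EFinP; exact: measurable_indic.
move=> B mB.
have mVB : measurable (V @^-1` B) by rewrite -[X in measurable X]setTI; exact: mV.
transitivity (P (D `&` V @^-1` B)).
  transitivity (\int[P]_w (\1_(D `&` V @^-1` B) w)%:E)%E; last first.
    by rewrite integral_indic ?setIT//; exact: measurableI.
  by apply: eq_integral => w _; rewrite indicI EFinM muleC.
transitivity (P D * P (V @^-1` B))%E; last first.
  congr (_ * _)%E; transitivity (\int[P]_w (\1_(V @^-1` B) w)%:E)%E => //.
  by rewrite integral_indic ?setIT.
have PDfin : P D \is a fin_num by exact: fin_num_measure.
have PD0 : (0 <= fine (P D)) by rewrite fine_ge0.
pose V' : {mfun T >-> path_space R} := HB.pack V (isMeasurableFun.Build _ _ _ _ _ mV).
pose m1 := pushforward (mrestr P mD) V'.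
pose m2 := pushforward (mscale (NngNum PD0) P) V'.
suff m12 : forall A : set (path_space R), measurable A -> m1 A = m2 A.
  have := m12 _ mB.
  by rewrite /m1 /m2 /pushforward/= /mrestr /mscale/= fineK// setIC.
apply: path_measure_unique => /=.
  rewrite /m1 /pushforward /mrestr preimage_setT setTI.
  by rewrite (le_lt_trans (probability_le1 P mD))// ltry.
move=> _ [n [t [C [t0 mC ->]]]].
rewrite /m1 /m2 /pushforward/= /mrestr /mscale/= fineK// setIC.
exact: indep.
Qed.

End event_path.

Section levy_integrand.
Variable R : realType.
Implicit Types (theta y : R).

Definition levy_integrand theta y : R := expR (theta * y) - 1 + theta * (1 - expR y).

Lemma measurable_levy_integrand theta : measurable_fun setT (levy_integrand theta).
Proof.
apply: continuous_measurable_fun => y; rewrite /levy_integrand.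
apply: cvgD; first (apply: cvgB; last exact: cvg_cst).
  apply: (continuous_comp (f := fun y => theta * y) (g := expR)).
    exact: mulrl_continuous.
  exact: continuous_expR.
by apply: cvgMr; apply: cvgB; [exact: cvg_cst|exact: continuous_expR].
Qed.

(** For theta > 1 this is Young's inequality for the product of e^y and 1 with the conjugate
    exponents theta and theta / (theta - 1). *)
Lemma levy_integrand_ge0 theta y : 1 <= theta -> 0 <= levy_integrand theta y.
Proof.
rewrite le_eqVlt => /predU1P[<-|th1]; first by rewrite /levy_integrand !mul1r; lra.
have th0 : 0 < theta by rewrite (lt_trans _ th1).
have := @conjugate_powR _ (expR y) 1 theta (theta / (theta - 1)) (expR_ge0 _) ler01 th0.
rewrite divr_gt0 ?subr_gt0// => /(_ isT).
have thn0 : theta != 0 by rewrite gt_eqF.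
have thn1 : theta - 1 != 0 by rewrite subr_eq0 gt_eqF.
have -> : theta^-1 + (theta / (theta - 1))^-1 = 1 by rewrite invf_div; field.
move=> /(_ erefl); rewrite -expRM [y * theta]mulrC powR1 mulr1 mul1r invf_div => h.
have : theta * expR y <= theta * (expR (theta * y) / theta + (theta - 1) / theta).
  by rewrite ler_pM2l.
rewrite (_ : theta * (_ + _) = expR (theta * y) + theta - 1); last by field.
by rewrite /levy_integrand; lra.
Qed.

(** The preceding inequality with exponent 1 / theta at the point theta y, multiplied by theta. *)
Lemma levy_integrand_le0 theta y : 0 <= theta <= 1 -> levy_integrand theta y <= 0.
Proof.
move=> /andP[]; rewrite le_eqVlt => /predU1P[<- _|th0 th1].
  by rewrite /levy_integrand !mul0r expR0; lra.
have := @levy_integrand_ge0 theta^-1 (theta * y).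
rewrite invf_ge1// => /(_ th1).
rewrite /levy_integrand mulKf ?gt_eqF// => h.
have : 0 <= theta * (expR y - 1 + theta^-1 * (1 - expR (theta * y))).
  by rewrite mulr_ge0// ltW.
rewrite (_ : theta * (_ + _) = theta * (expR y - 1) + (1 - expR (theta * y))).
  by lra.
by field; rewrite gt_eqF.
Qed.

(** The constant sign of the integrand turns a finite integral into absolute integrability. *)
Lemma levy_integrand_integrable (nu : {measure set R -> \bar R}) theta : 0 <= theta ->
  (\int[nu]_y (levy_integrand theta y)%:E)%E \is a fin_num ->
  nu.-integrable setT (EFin \o levy_integrand theta).
Proof.
move=> th0 Ifin; apply/integrableP; split.
  by apply/measurable_EFinP; exact: measurable_levy_integrand.
have [th1|th1] := leP 1 theta.
  rewrite (eq_integral (fun y => (levy_integrand theta y)%:E)).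
    by rewrite -ge0_fin_numE// integral_ge0// => y _; rewrite lee_fin levy_integrand_ge0.
  by move=> y _ /=; rewrite ger0_norm// levy_integrand_ge0.
have E : (\int[nu]_y (levy_integrand theta y)%:E =
    - \int[nu]_y `|(levy_integrand theta y)%:E|)%E.
  rewrite -integral_ge0N//; apply: eq_integral => y _ /=.
  by rewrite ler0_norm ?opprK// levy_integrand_le0// th0 ltW.
have : (- \int[nu]_y `|(levy_integrand theta y)%:E|)%E \is a fin_num by rewrite -E.
by rewrite fin_numN ge0_fin_numE// integral_ge0.
Qed.

(** The negative part of f + g is at most |f|, so an integral below +oo forces the positive part of
    f + g to be integrable; then g is at most |f| plus this positive part. *)
Lemma integral_ge0_of_sum (nu : {measure set R -> \bar R}) (f g : R -> R) :
  nu.-integrable setT (EFin \o f) -> measurable_fun setT g -> (forall y, 0 <= g y) ->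
  (\int[nu]_y (f y + g y)%:E < +oo)%E ->
  nu.-integrable setT (EFin \o g) /\
  (\int[nu]_y (f y + g y)%:E = \int[nu]_y (f y)%:E + \int[nu]_y (g y)%:E)%E.
Proof.
move=> fi mg g0 fgoo.
have mf : measurable_fun setT f by apply/measurable_EFinP; case/integrableP: fi.
have gi : nu.-integrable setT (EFin \o g).
  have mfg : measurable_fun setT (fun y => (f y + g y)%:E).
    by apply/measurable_EFinP; exact: measurable_funD.
  have nfoo : (\int[nu]_y ((fun y => (f y + g y)%:E)^\- y) < +oo)%E.
    have /integrableP[_] := fi; apply: le_lt_trans.
    apply: ge0_le_integral => //.
    - exact: measurable_funeneg.
    - by apply: measurableT_comp => //; exact/measurable_EFinP.
    - move=> y _; rewrite unlock/= ge_max !lee_fin normr_ge0 andbT.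
      by rewrite opprD; have := ler_norm (- f y); rewrite normrN; have := g0 y; lra.
  have pfoo : (\int[nu]_y ((fun y => (f y + g y)%:E)^\+ y) < +oo)%E.
    rewrite ltNge leye_eq; apply/negP => /eqP poo.
    move: fgoo; rewrite integralE poo addye//.
    by rewrite eqe_oppLR/= lt_eqF.
  apply/integrableP; split; first exact/measurable_EFinP.
  apply: (@le_lt_trans _ _ (\int[nu]_y (`|(f y)%:E| +
      (fun y => (f y + g y)%:E)^\+ y)))%E.
    apply: ge0_le_integral => //.
    - by apply: measurableT_comp => //; exact/measurable_EFinP.
    - apply: emeasurable_funD; last exact: measurable_funepos.
      by apply: measurableT_comp => //; exact/measurable_EFinP.
    - move=> y _ /=; rewrite ger0_norm//.
      apply: (@le_trans _ _ (`|f y|%:E + (f y + g y)%:E)%E).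
        by rewrite -EFinD lee_fin; have := ler_norm (- f y); rewrite normrN; lra.
      by rewrite leeD// unlock le_max lexx.
  rewrite ge0_integralD//.
  - by rewrite lte_add_pinfty//; case/integrableP: fi.
  - by apply: measurableT_comp => //; exact/measurable_EFinP.
  - exact: measurable_funepos.
split=> //; rewrite -integralD_EFin//.
Qed.

End levy_integrand.

Section killed_levy.
Context (R : realType) (d' : measure_display) (T' : measurableType d').
Context (P : probability T' R) (k b sigma2 : R) (nu : {measure set R -> \bar R}).
Context (xi : R -> T' -> R) (e : T' -> \bar R).
Hypothesis Y : killed_levy_process P k b sigma2 nu xi e.

Let mxi t : 0 <= t -> measurable_fun setT (xi t).
Proof. exact: levy_measurable (klevy_levy Y) t. Qed.

Lemma measurable_alive s : measurable [set w | (s%:E < e w)%E].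
Proof.
rewrite -[X in measurable X]setTI.
exact: emeasurable_fun_o_infty (klevy_measurable Y) _.
Qed.

Lemma integral_alive s (F : path_space R -> \bar R) : 0 <= s ->
  measurable_fun setT F -> (forall z, 0 <= F z)%E ->
  (\int[P]_w (F (xi ^~ w) * (\1_[set w | (s%:E < e w)%E] w)%:E) =
   (expR (- k * s))%:E * \int[P]_w F (xi ^~ w))%E.
Proof.
move=> s0 mF F0; rewrite -(klevy_exponential Y s0).
apply: integral_event_path_independent => //; first exact: measurable_alive.
move=> n t B t0 mB.
have E : [set w | (s%:E < e w)%E] = e @^-1` `]s%:E, +oo[.
  by apply/seteqP; split => w /=; rewrite in_itv/= andbT.
by rewrite E; apply: (klevy_independent Y) => //; exact: emeasurable_itv.
Qed.

Lemma integral_increment s h (F : R -> \bar R) : 0 <= s -> 0 <= h ->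
  measurable_fun setT F -> (forall y, 0 <= F y)%E ->
  (\int[P]_w F (xi (s + h) w - xi s w)%R = \int[P]_w F (xi h w))%E.
Proof.
move=> s0 h0 mF F0.
have mI : measurable_fun setT (fun w => xi (s + h) w - xi s w).
  by apply: measurable_funB; apply: mxi => //; exact: addr_ge0.
pose V : {mfun T' >-> R} := HB.pack (fun w => xi (s + h) w - xi s w)
  (isMeasurableFun.Build _ _ _ _ _ mI).
pose V' : {mfun T' >-> R} := HB.pack (xi h) (isMeasurableFun.Build _ _ _ _ _ (mxi h0)).
transitivity (\int[pushforward P V]_z F z)%E.
  by rewrite ge0_integral_pushforward// preimage_setT.
transitivity (\int[pushforward P V']_z F z)%E; last first.
  by rewrite ge0_integral_pushforward// preimage_setT.
apply: eq_measure_integral => A mA _.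
exact: levy_stationary_increments (klevy_levy Y) _ _ _ s0 h0 mA.
Qed.

Lemma integral_prod_increments h n (F : nat -> R -> \bar R) : 0 <= h ->
  (forall i, measurable_fun setT (F i)) -> (forall i y, 0 <= F i y)%E ->
  (\int[P]_w \prod_(i < n) F i (xi (i.+1%:R * h) w - xi (i%:R * h) w)%R =
   \prod_(i < n) \int[P]_w F i (xi h w))%E.
Proof.
move=> h0 mF F0.
pose t (i : nat) : R := i%:R * h.
have t0 i : 0 <= t i by rewrite mulr_ge0.
have tS i : t i.+1 = t i + h by rewrite /t -natr1 mulrDl mul1r.
pose V (i : nat) (w : T') := xi (t i.+1) w - xi (t i) w.
have mV i : measurable_fun setT (V i) by apply: measurable_funB; exact: mxi.
have iotaE : iota 0 n = index_iota 0 n by rewrite /index_iota subn0.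
have indep B : (forall i, measurable (B i)) ->
    P (\big[setI/setT]_(i <- iota 0 n) (V i @^-1` B i)) =
    (\prod_(i <- iota 0 n) P (V i @^-1` B i))%E.
  move=> mB; rewrite iotaE !big_mkord.
  have := @levy_independent_increments _ _ _ _ _ (klevy_levy Y) n t B (t0 0%N) _ mB.
  move=> <-; last by move=> i; rewrite tS lerDl.
  congr (P _); rewrite -(bigcap_mkord n (fun i => V i @^-1` B i)).
  by apply/seteqP; split=> w wB i; exact: wB.
transitivity (\prod_(i < n) \int[P]_w F i (V i w))%E; last first.
  by apply: eq_bigr => i _; rewrite /V tS integral_increment.
have := integral_prod_independent mV (iota_uniq 0 n) indep mF F0.
rewrite iotaE big_mkord => <-.
by apply: eq_integral => w _; rewrite big_mkord.
Qed.

(** As xi_0 = 0 almost surely, xi_(n h) is a sum of n increments, and the integrand is a product of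
    functions of n + 1 independent increments. *)
Lemma integral_exp_increment h theta n (f : R -> \bar R) : 0 <= h ->
  measurable_fun setT f -> (forall y, 0 <= f y)%E ->
  (\int[P]_w ((expR (theta * xi (n%:R * h) w))%:E *
              f (xi (n.+1%:R * h) w - xi (n%:R * h) w)%R) =
   (\prod_(i < n) \int[P]_w (expR (theta * xi h w))%:E) *
   \int[P]_w f (xi h w))%E.
Proof.
move=> h0 mf f0.
pose F i : R -> \bar R := if (i < n)%N then (fun y => (expR (theta * y))%:E) else f.
have mF i : measurable_fun setT (F i).
  rewrite /F; case: ifP => // _; apply/measurable_EFinP.
  by apply: measurableT_comp => //; exact: measurable_funM.
have F0 i y : (0 <= F i y)%E by rewrite /F; case: ifP => // _; rewrite lee_fin expR_ge0.
have FN : F n = f by rewrite /F ltnn.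
have := integral_prod_increments n.+1 h0 mF F0.
rewrite big_ord_recr/= FN => FE.
rewrite (eq_bigr (fun i : 'I_n => \int[P]_w F i (xi h w))%E); last first.
  by move=> i _; rewrite /F ltn_ord.
rewrite -FE; have mincr i : measurable_fun setT
    (fun w => xi (i.+1%:R * h) w - xi (i%:R * h) w).
  by apply: measurable_funB; apply: mxi; rewrite mulr_ge0.
apply: ge0_ae_eq_integral => //.
- apply: emeasurable_funM; last exact: measurableT_comp.
  apply/measurable_EFinP; apply: measurableT_comp => //.
  by apply: measurable_funM; [exact: measurable_cst|apply: mxi; rewrite mulr_ge0].
- by apply: emeasurable_prod => i; exact: measurableT_comp.
- by move=> w _; rewrite mule_ge0// lee_fin expR_ge0.
- by move=> w _; rewrite prode_ge0.
apply: filterS (levy_start (klevy_levy Y)) => w xi0 _.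
rewrite big_ord_recr/= FN; congr (_ * _)%E.
have : forall m, (m <= n)%N -> ((expR (theta * xi (m%:R * h) w))%:E =
    \prod_(i < m) F i (xi (i.+1%:R * h) w - xi (i%:R * h) w)%R)%E.
  elim=> [|m IH] mn; first by rewrite big_ord0 mul0r xi0 mulr0 expR0.
  rewrite big_ord_recr/= -IH; last exact: ltnW.
  by rewrite /F mn -EFinM -expRD -mulrDr addrC subrK.
exact.
Qed.

Lemma laplace_xi1 theta : 0 <= theta ->
  (\int[P]_w (expR (theta * xi 1 w))%:E * (expR (- k))%:E =
   expeR (levy_psi k b sigma2 nu theta))%E.
Proof.
move=> th0; rewrite -(klevy_laplace Y th0) muleC.
have := @integral_alive 1 (fun z => (expR (theta * z 1))%:E) ler01.
rewrite mulr1 => <-; last 2 first.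
- apply/measurable_EFinP; apply: measurableT_comp => //.
  by apply: measurable_funM; [exact: measurable_cst|exact: measurable_eval].
- by move=> z; rewrite lee_fin expR_ge0.
apply: eq_integral => w _; rewrite indicE.
have [ew|ew] := boolP (1%:E < e w)%E.
  by rewrite mem_set// mule1.
by rewrite memNset ?mule0//; exact/negP.
Qed.

(** The moment at time 1 is the power N + 1 of the moment at time 1 / (N + 1). Adding k undoes the
    killing, which psi takes into account and [xi] does not. *)
Lemma laplace_xi theta psi N : 0 <= theta -> levy_psi k b sigma2 nu theta = psi%:E ->
  (\int[P]_w (expR (theta * xi N.+1%:R^-1 w))%:E =
   (expR ((psi + k) / N.+1%:R))%:E)%E.
Proof.
move=> th0 psiE; have := laplace_xi1 th0; rewrite psiE.
have h0 : 0 <= N.+1%:R^-1 :> R by rewrite invr_ge0.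
have := @integral_exp_increment _ theta N.+1 (cst 1%E) h0.
rewrite (eq_integral (fun w => (expR (theta * xi 1 w))%:E)); last first.
  by move=> w _; rewrite mule1 mulfV.
move=> /(_ (measurable_cst _) (fun=> lee01)).
have -> : (\int[P]_w cst 1 (xi N.+1%:R^-1 w) = 1)%E.
  transitivity (\int[P]_w cst 1%E w)%E; first by [].
  by rewrite integral_cst// mul1e; exact: probability_setT.
rewrite mule1 => ->.
set c := (\int[P]_w _)%E; have c0 : (0 <= c)%E.
  by apply: integral_ge0 => w _; rewrite lee_fin expR_ge0.
have prodE (m : nat) (r : R) : (\prod_(i < m) r%:E = (r ^+ m)%:E)%E.
  elim: m => [|m IH]; first by rewrite big_ord0 expr0.
  by rewrite big_ord_recr/= IH -EFinM exprSr.
(* An infinite moment at time 1 / (N + 1) would make the moment at time 1 infinite, whereas psi is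
   finite. *)
case: c c0 => [r||//]; last first.
  move=> _; suff -> : forall m, (\prod_(i < m.+1) +oo = +oo :> \bar R)%E.
    by rewrite mulyr gtr0_sg ?expR_gt0// mul1e.
  elim=> [|m IH]; first by rewrite big_ord1.
  by rewrite big_ord_recr/= IH mulyy.
rewrite lee_fin => r0; rewrite prodE -EFinM /= => -[rE].
congr EFin; apply: (@pexpIrn _ N.+1) => //; rewrite ?nnegrE ?expR_ge0//.
rewrite -expRM_natl mulrCA divff ?mulr1//.
by rewrite expRD -rE -mulrA -expRD addNr expR0 mulr1.
Qed.

End killed_levy.

(** * Exponential moments in small time and the jump measure *)

Section expsum.
Variable R : realType.

(** Entries are pairs of a coefficient and an exponent. The expectations of such functions of [xi]
    are explicit. *)
Definition expsum (cs : seq (R * R)) (y : R) : R :=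
  \sum_(c <- cs) c.1 * expR (c.2 * y).

Lemma expsum_nil y : expsum [::] y = 0.
Proof. by rewrite /expsum big_nil. Qed.

Lemma expsum_cons c cs y : expsum (c :: cs) y = c.1 * expR (c.2 * y) + expsum cs y.
Proof. by rewrite /expsum big_cons. Qed.

Lemma measurable_expsum cs : measurable_fun setT (expsum cs).
Proof.
apply: measurable_sum => c; apply: measurable_funM; first exact: measurable_cst.
by apply: measurableT_comp => //; exact: measurable_funM.
Qed.

Lemma cvg_expR_slope (a : R) :
  n.+1%:R * (expR (a / n.+1%:R) - 1) @[n --> \oo] --> a.
Proof.
have cinv : n.+1%:R^-1 @[n --> \oo] --> (0 : R).
  apply/cvgr0Pnorm_lt => x x0; near=> n.
  rewrite ger0_norm ?invr_ge0//; near: n; exact: near_infty_natSinv_lt (PosNum x0).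
have c0 : a / n.+1%:R @[n --> \oo] --> (0 : R).
  by rewrite -[0](mulr0 a); exact: cvgMr.
have cexp : a * expR (a / n.+1%:R) @[n --> \oo] --> a.
  rewrite -[X in _ --> X]mulr1 -[X in a * X]expR0.
  by apply: cvgMr; apply: continuous_cvg => //; exact: continuous_expR.
apply: squeeze_cvgr (cvg_cst a) cexp; apply: nearW => n.
have n0 : 0 < n.+1%:R :> R by [].
apply/andP; split.
  have := expR_ge1Dx (a / n.+1%:R).
  by rewrite -lerBrDl -(ler_pM2l n0) mulrCA divff ?mulr1// gt_eqF.
have := expR_sub1_le (a / n.+1%:R).
by rewrite -(ler_pM2l n0) mulrA [X in _ <= X * _]mulrCA divff ?mulr1// gt_eqF.
Unshelve. all: by end_near. Qed.

End expsum.

Section exponent.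
Context (R : realType) (d' : measure_display) (T' : measurableType d').
Context (P : probability T' R) (k b sigma2 : R) (nu : {measure set R -> \bar R}).
Context (xi : R -> T' -> R) (e : T' -> \bar R).
Hypothesis Y : killed_levy_process P k b sigma2 nu xi e.

Let mxi t : 0 <= t -> measurable_fun setT (xi t).
Proof. exact: levy_measurable (klevy_levy Y) t. Qed.

Let mexp theta t : 0 <= t -> measurable_fun setT (fun w => expR (theta * xi t w)).
Proof.
move=> t0; apply: measurableT_comp => //; apply: measurable_funM.
  exact: measurable_cst.
exact: mxi.
Qed.

(** Otherwise the positive variable e^(theta xi_1) would have expectation 0. *)
Lemma levy_psi_gtNy theta : 0 <= theta -> (-oo < levy_psi k b sigma2 nu theta)%E.
Proof.
move=> th0; rewrite ltNge leeNy_eq; apply/negP => /eqP psiE.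
have := laplace_xi1 Y th0; rewrite psiE/= => /eqP.
rewrite mule_eq0 orbC eqe gt_eqF ?expR_gt0//= => /eqP I0.
have : (\int[P]_w `|(expR (theta * xi 1 w))%:E| = 0)%E.
  by rewrite -I0; apply: eq_integral => w _; rewrite /= ger0_norm ?expR_ge0.
move=> /ae_eq_integral_abs[//||N [mN PN0 subN]].
  by apply/measurable_EFinP; exact: mexp.
have NT : N = setT.
  apply/seteqP; split=> // w _; apply: subN => /= /(_ Logic.I) [] /eqP.
  by rewrite gt_eqF ?expR_gt0.
by have /eqP := probability_setT P; rewrite -NT PN0 eq_sym onee_eq0.
Qed.

Lemma levy_psi_integral_fin theta psi : levy_psi k b sigma2 nu theta = psi%:E ->
  (\int[nu]_y (levy_integrand theta y)%:E)%E =
    (psi - (- k + 2^-1 * sigma2 * theta ^+ 2 + b * theta))%:E.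
Proof.
rewrite /levy_psi -/(levy_integrand theta _).
case: (\int[nu]_y _)%E => // r [<-]; congr EFin.
by ring.
Qed.

(** The integral of [levy_integrand q] is not -oo because psi(q) is not; it is not +oo since the
    integrand is dominated by that of kappa if q >= 1 and nonpositive otherwise. Its integrability
    is what permits splitting the integral in kappa. *)
Lemma levy_kappa_split q : 0 < q -> (levy_kappa k b sigma2 nu q < 0)%E ->
  exists psi G : R, [/\ levy_psi k b sigma2 nu q = psi%:E,
   (\int[nu]_y (if y < 0 then (1 - expR y) `^ q else 0)%:E)%E = G%:E,
   0 <= G & psi + G < 0].
Proof.
move=> q0 kappa_lt0.
pose c := - k + 2^-1 * sigma2 * q ^+ 2 + b * q.
pose g (y : R) := if y < 0 then (1 - expR y) `^ q else 0.
have g0 y : 0 <= g y by rewrite /g; case: ifP => // _; exact: powR_ge0.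
have mg : measurable_fun setT g.
  apply: measurable_fun_ifT => //=.
    by apply: measurable_fun_ltr => //; exact: measurable_cst.
  apply: (measurableT_comp (measurable_powR _)).
  by apply: measurable_funB => //; exact: measurable_cst.
have fgoo : (\int[nu]_y (levy_integrand q y + g y)%:E < +oo)%E.
  have : (c%:E + \int[nu]_y (levy_integrand q y + g y)%:E < 0)%E by [].
  by case: (\int[nu]_y _)%E => // r _; exact: ltry.
have fgtNy : (-oo < \int[nu]_y (levy_integrand q y)%:E)%E.
  have : (-oo < c%:E + \int[nu]_y (levy_integrand q y)%:E)%E := levy_psi_gtNy (ltW q0).
  by case: (\int[nu]_y (levy_integrand q y)%:E)%E => [r _||//]; rewrite ?ltNyr.
have flty : (\int[nu]_y (levy_integrand q y)%:E < +oo)%E.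
  have [q1|q1] := leP 1 q.
    apply: le_lt_trans fgoo; apply: ge0_le_integral => //.
    - by move=> y _; rewrite lee_fin levy_integrand_ge0.
    - by apply/measurable_EFinP; exact: measurable_levy_integrand.
    - by apply/measurable_EFinP; apply: measurable_funD => //; exact: measurable_levy_integrand.
    - by move=> y _; rewrite lee_fin lerDl.
  rewrite (eq_integral (fun y => - (- levy_integrand q y)%:E)%E); last first.
    by move=> y _; rewrite EFinN oppeK.
  have Nf0 y : (0 <= (- levy_integrand q y)%:E)%E.
    by rewrite lee_fin oppr_ge0 levy_integrand_le0// !ltW.
  rewrite integral_ge0N//; apply: le_lt_trans (ltry 0).
  by rewrite oppe_le0 integral_ge0.
have ffin : (\int[nu]_y (levy_integrand q y)%:E)%E \is a fin_num.
  by rewrite fin_numE gt_eqF//= lt_eqF.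
have fi := levy_integrand_integrable (ltW q0) ffin.
have [gi fgE] := integral_ge0_of_sum fi mg g0 fgoo.
have gfin : (\int[nu]_y (g y)%:E)%E \is a fin_num by exact: integrable_fin_num gi.
exists (c + fine (\int[nu]_y (levy_integrand q y)%:E)), (fine (\int[nu]_y (g y)%:E)).
split.
- by rewrite EFinD fineK.
- by rewrite fineK.
- by apply: fine_ge0; apply: integral_ge0 => y _; rewrite lee_fin.
- rewrite -lte_fin !EFinD !fineK// -addeA -fgE.
  exact: kappa_lt0.
Qed.

Variables (q psiq : R).
Hypotheses (q0 : 0 < q) (psiqE : levy_psi k b sigma2 nu q = psiq%:E).

Let psi theta := fine (levy_psi k b sigma2 nu theta).

(** Finiteness is inherited from q, since e^(theta x) <= 1 + e^(q x). *)
Lemma levy_psi_fineK theta : 0 <= theta <= q ->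
  levy_psi k b sigma2 nu theta = (psi theta)%:E.
Proof.
move=> /andP[th0 thq]; rewrite fineK// fin_numE gt_eqF ?levy_psi_gtNy//=.
apply/eqP => psiE; have := laplace_xi1 Y th0; rewrite psiE/=.
suff : (\int[P]_w (expR (theta * xi 1 w))%:E < +oo)%E.
  have : (0 <= \int[P]_w (expR (theta * xi 1 w))%:E)%E.
    by apply: integral_ge0 => w _; rewrite lee_fin expR_ge0.
  by case: (\int[P]_w _)%E.
have qfin : (\int[P]_w (expR (q * xi 1 w))%:E < +oo)%E.
  have := laplace_xi1 Y (ltW q0); rewrite psiqE.
  case: (\int[P]_w _)%E => [r|//|//]; first by rewrite ltry.
  by rewrite mulyr gtr0_sg ?expR_gt0// mul1e.
apply: (@le_lt_trans _ _ (\int[P]_w (1 + (expR (q * xi 1 w))%:E))%E).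
  apply: ge0_le_integral => //.
  - by apply/measurable_EFinP; exact: mexp.
  - by apply: emeasurable_funD => //; apply/measurable_EFinP; exact: mexp.
  - move=> w _; rewrite -EFinD lee_fin.
    have [x0|x0] := leP 0 (xi 1 w).
      apply: (@le_trans _ _ (expR (q * xi 1 w))); last by rewrite lerDr.
      by rewrite ler_expR ler_wpM2r.
    apply: (@le_trans _ _ 1); last by rewrite lerDl expR_ge0.
    by rewrite -[leRHS]expR0 ler_expR mulr_ge0_le0// ltW.
rewrite ge0_integralD//; last by apply/measurable_EFinP; exact: mexp.
- rewrite lte_add_pinfty// (_ : (\int[P]_w 1 = \int[P]_w cst 1 w)%E)//.
  rewrite integral_cst// mul1e; apply: (@le_lt_trans _ _ 1%E); last exact: ltry.
  by rewrite probability_le1.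
Qed.

Lemma expsum_xi (cs : seq (R * R)) N : (forall c, c \in cs -> 0 <= c.2 <= q) ->
  P.-integrable setT (fun w => (expsum cs (xi N.+1%:R^-1 w))%:E) /\
  (\int[P]_w (expsum cs (xi N.+1%:R^-1 w)) =
   \sum_(c <- cs) c.1 * expR ((psi c.2 + k) / N.+1%:R))%R.
Proof.
have N0 : 0 <= N.+1%:R^-1 :> R by rewrite invr_ge0.
elim: cs => [_|c cs IH csq].
  under [X in P.-integrable _ X]eq_fun do rewrite expsum_nil.
  rewrite big_nil; split; first exact: integrable0.
  by under eq_Rintegral do rewrite expsum_nil; rewrite Rintegral_cst// mul0r.
have [csi csE] : P.-integrable setT (fun w => (expsum cs (xi N.+1%:R^-1 w))%:E) /\
  (\int[P]_w (expsum cs (xi N.+1%:R^-1 w)) =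
   \sum_(c <- cs) c.1 * expR ((psi c.2 + k) / N.+1%:R))%R.
  by apply: IH => c' c'cs; apply: csq; rewrite inE c'cs orbT.
have cq : 0 <= c.2 <= q by apply: csq; rewrite inE eqxx.
have cE := laplace_xi Y N (proj1 (andP cq)) (levy_psi_fineK cq).
have expi : P.-integrable setT (fun w => (expR (c.2 * xi N.+1%:R^-1 w))%:E).
  apply/integrableP; split; first by apply/measurable_EFinP; exact: mexp.
  rewrite (eq_integral (fun w => (expR (c.2 * xi N.+1%:R^-1 w))%:E)); last first.
    by move=> w _; rewrite /= ger0_norm ?expR_ge0.
  by rewrite cE ltry.
have ci : P.-integrable setT (fun w => (c.1 * expR (c.2 * xi N.+1%:R^-1 w))%:E).
  by under eq_fun do rewrite EFinM; exact: integrableZl.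
split.
  under eq_fun do rewrite expsum_cons EFinD.
  exact: integrableD.
under eq_Rintegral do rewrite expsum_cons.
rewrite RintegralD// csE RintegralZl// big_cons; congr (_ * _ + _).
by rewrite /Rintegral cE.
Qed.

(** The two vanishing sums cancel the terms -1 and theta (1 - e^y), so the exponential sum is a
    combination of Lévy integrands. They cancel the drift as well, and only the Gaussian part is
    left over. *)
Lemma expsum_nu (cs : seq (R * R)) : (forall c, c \in cs -> 0 <= c.2 <= q) ->
  \sum_(c <- cs) c.1 = 0 -> \sum_(c <- cs) c.1 * c.2 = 0 ->
  nu.-integrable setT (fun y => (expsum cs y)%:E) /\
  (\int[nu]_y (expsum cs y) =
   \sum_(c <- cs) c.1 * (psi c.2 + k) - 2^-1 * sigma2 * \sum_(c <- cs) c.1 * c.2 ^+ 2)%R.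
Proof.
move=> csq s0 s1.
have expsumE y : expsum cs y = \sum_(c <- cs) c.1 * levy_integrand c.2 y.
  have -> : \sum_(c <- cs) c.1 * levy_integrand c.2 y =
      expsum cs y - \sum_(c <- cs) c.1 + (\sum_(c <- cs) c.1 * c.2) * (1 - expR y).
    elim: (cs) => [|c cs' IH]; first by rewrite !big_nil expsum_nil subr0 mul0r addr0.
    by rewrite !big_cons expsum_cons IH /levy_integrand; ring.
  by rewrite s0 s1 subr0 mul0r addr0.
suff [I1 I2] : nu.-integrable setT
    (fun y => (\sum_(c <- cs) c.1 * levy_integrand c.2 y)%:E) /\
  (\int[nu]_y (\sum_(c <- cs) c.1 * levy_integrand c.2 y) =
   \sum_(c <- cs) c.1 * (psi c.2 + k) - 2^-1 * sigma2 * (\sum_(c <- cs) c.1 * c.2 ^+ 2)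
   - b * \sum_(c <- cs) c.1 * c.2)%R.
  split; first by under eq_fun do rewrite expsumE.
  by under eq_Rintegral do rewrite expsumE; rewrite I2 s1 mulr0 subr0.
elim: (cs) csq => [_|c cs' IH csq].
  under [X in nu.-integrable _ X]eq_fun do rewrite big_nil.
  rewrite !big_nil !mulr0 !subr0; split; first exact: integrable0.
  under eq_Rintegral do rewrite big_nil.
  by rewrite /Rintegral integral0.
have {IH}[csi csE] := IH (fun c' c'cs => csq c' (mem_behead (s := c :: cs') c'cs)).
have cq : 0 <= c.2 <= q by apply: csq; rewrite inE eqxx.
have cE := levy_psi_integral_fin (levy_psi_fineK cq).
have cI : nu.-integrable setT (EFin \o levy_integrand c.2).
  by apply: levy_integrand_integrable; [case/andP: cq|rewrite cE].
have ci : nu.-integrable setT (fun y => (c.1 * levy_integrand c.2 y)%:E).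
  by under eq_fun do rewrite EFinM; exact: integrableZl.
split.
  under eq_fun do rewrite big_cons EFinD.
  exact: integrableD.
under eq_Rintegral do rewrite big_cons.
rewrite RintegralD// csE RintegralZl// !big_cons /Rintegral cE /=.
ring.
Qed.

(** Coefficients of sum 0 allow 1 to be subtracted from every e^(a / N), and N (e^(a / N) - 1) tends
    to a. *)
Lemma expsum_cvg (cs : seq (R * R)) : (forall c, c \in cs -> 0 <= c.2 <= q) ->
  \sum_(c <- cs) c.1 = 0 -> \sum_(c <- cs) c.1 * c.2 = 0 ->
  n.+1%:R * (\int[P]_w (expsum cs (xi n.+1%:R^-1 w)))%R @[n --> \oo] -->
  (2^-1 * sigma2 * \sum_(c <- cs) c.1 * c.2 ^+ 2 + \int[nu]_y (expsum cs y))%R.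
Proof.
move=> csq s0 s1; have [_ ->] := expsum_nu csq s0 s1.
rewrite addrC subrK.
rewrite (_ : (fun n : nat => _) = (fun n : nat => \sum_(c <- cs)
    c.1 * (n.+1%:R * (expR ((psi c.2 + k) / n.+1%:R) - 1)))); last first.
  apply/funext => n; have [_ ->] := expsum_xi n csq.
  transitivity (n.+1%:R * (\sum_(c <- cs) c.1 * expR ((psi c.2 + k) / n.+1%:R)) -
      n.+1%:R * \sum_(c <- cs) c.1); first by rewrite s0 mulr0 subr0.
  by rewrite !mulr_sumr -sumrB; apply: eq_bigr => c _; ring.
elim: (cs) => [|c cs' IH].
  by rewrite big_nil; under eq_fun do rewrite big_nil; exact: cvg_cst.
rewrite big_cons; under eq_fun do rewrite big_cons.
by apply: cvgD => //; apply: cvgMr; exact: cvg_expR_slope.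
Qed.

(** The weight below has exponents eta, 2 eta and 3 eta. Shifted by theta with |theta| <= eta, they
    stay in [0, 4 eta] = [0, q], where psi is finite. *)
Let eta := q / 4.
Let eta0 : 0 < eta. Proof. by rewrite divr_gt0. Qed.
Let eta4 : 4 * eta = q. Proof. by rewrite /eta mulrC divfK. Qed.

(* This weight cancels the drift and reduces the Brownian part to a mass at 0. *)
Let wt (y : R) := expR (eta * y) * (expR (eta * y) - 1) ^+ 2.

Let wt_ge0 y : 0 <= wt y.
Proof. by rewrite mulr_ge0 ?expR_ge0 ?sqr_ge0. Qed.

Let wtE theta y : expR (theta * y) * wt y =
  expsum [:: (1, eta + theta); (-2, 2 * eta + theta); (1, 3 * eta + theta)] y.
Proof.
rewrite !expsum_cons expsum_nil /wt /=.
have -> : (eta + theta) * y = eta * y + theta * y by ring.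
have -> : (2 * eta + theta) * y = eta * y + eta * y + theta * y by ring.
have -> : (3 * eta + theta) * y = eta * y + eta * y + eta * y + theta * y by ring.
by rewrite !expRD; ring.
Qed.

Let mwt : measurable_fun setT wt.
Proof.
have -> : wt = expsum [:: (1, eta + 0); (-2, 2 * eta + 0); (1, 3 * eta + 0)].
  by apply/funext => y; rewrite -wtE mul0r expR0 mul1r.
exact: measurable_expsum.
Qed.

(** The expansion of (e^(eta y) + e^(- eta y)) [wt y], which dominates e^(eta |y|) [wt y]. *)
Let Ucs : seq (R * R) := [:: (1, 0); (-2, eta); (2, 2 * eta); (-2, 3 * eta); (1, 4 * eta)].

Let wt_le y : expR (eta * `|y|) * wt y <= expsum Ucs y.
Proof.
have -> : expsum Ucs y = (expR (eta * y) + expR (- (eta * y))) * wt y.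
  rewrite mulrDl -mulNr !wtE !expsum_cons !expsum_nil /=.
  have -> : eta + eta = 2 * eta by ring.
  have -> : 2 * eta + eta = 3 * eta by ring.
  have -> : 3 * eta + eta = 4 * eta by ring.
  have -> : eta - eta = 0 by ring.
  have -> : 2 * eta - eta = eta by ring.
  have -> : 3 * eta - eta = 2 * eta by ring.
  by ring.
rewrite ler_wpM2r//; have [y0|y0] := leP 0 y.
  by rewrite ger0_norm// lerDl expR_ge0.
by rewrite ltr0_norm// mulrN lerDr expR_ge0.
Qed.

Let Ucs_q c : c \in Ucs -> 0 <= c.2 <= q.
Proof.
by rewrite -eta4 !inE => /or4P[/eqP->|/eqP->|/eqP->|/orP[/eqP->|/eqP->]] /=;
  have := eta0; lra.
Qed.

Let weighted_integrable d (T : measurableType d) (mu : {measure set T -> \bar R})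
    (X : T -> R) (f : R -> R) : measurable_fun setT X ->
  mu.-integrable setT (fun t => (expsum Ucs (X t))%:E) -> exp_growth eta f ->
  mu.-integrable setT (fun t => (f (X t) * wt (X t))%:E).
Proof.
move=> mX Ui [mf [C fC]].
have mfw : measurable_fun setT (fun t => (f (X t) * wt (X t))%:E).
  by apply/measurable_EFinP; apply: measurable_funM; exact: measurableT_comp.
apply: (le_integrable measurableT mfw _ (integrableZl measurableT C Ui)) => t _ /=.
rewrite lee_fin normrM (ger0_norm (wt_ge0 _)).
have C0 : 0 <= C.
  have := le_trans (normr_ge0 _) (fC (X t)).
  by rewrite pmulr_lge0 ?expR_gt0.
have U0 : 0 <= expsum Ucs (X t).
  by apply: le_trans (wt_le _); rewrite mulr_ge0 ?expR_ge0.
rewrite (ger0_norm (mulr_ge0 C0 U0)).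
apply: (@le_trans _ _ (C * expR (eta * `|X t|) * wt (X t))).
  by rewrite ler_wpM2r.
by rewrite -mulrA ler_wpM2l.
Qed.

Let weighted_bounded d (T : measurableType d) (mu : {measure set T -> \bar R})
    (X : T -> R) (f : R -> R) C : measurable_fun setT X ->
  mu.-integrable setT (fun t => (expsum Ucs (X t))%:E) ->
  measurable_fun setT f -> (forall y, `|f y| <= C * expR (eta * `|y|)) ->
  `|(\int[mu]_t (f (X t) * wt (X t)))%R| <= C * (\int[mu]_t (expsum Ucs (X t)))%R.
Proof.
move=> mX Ui mf fC.
have fi : mu.-integrable setT (fun t => (f (X t) * wt (X t))%:E).
  by apply: weighted_integrable => //; split=> //; exists C.
rewrite -RintegralZl//; apply: le_trans (le_normr_Rintegral _ fi) _ => //.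
apply: le_Rintegral => //.
- exact: integrable_norm.
- exact: (integrableZl measurableT C Ui).
- move=> t _; rewrite normrM (ger0_norm (wt_ge0 _)).
  apply: (@le_trans _ _ (C * expR (eta * `|X t|) * wt (X t))).
    by rewrite ler_wpM2r.
  have C0 : 0 <= C.
    have := le_trans (normr_ge0 _) (fC (X t)).
    by rewrite pmulr_lge0 ?expR_gt0.
  by rewrite -mulrA ler_wpM2l.
Qed.

(** In the limit the Gaussian part charges only the point 0, where [wt y] is equivalent to eta^2
    y^2: hence the mass eta^2 sigma2. *)
Let L (n : nat) (f : R -> R) : R :=
  n.+1%:R * (\int[P]_w (f (xi n.+1%:R^-1 w) * wt (xi n.+1%:R^-1 w)))%R -
  (eta ^+ 2 * sigma2 * f 0 + (\int[nu]_y (f y * wt y))%R).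

Let mxiN n : measurable_fun setT (xi n.+1%:R^-1).
Proof. by apply: mxi; rewrite invr_ge0. Qed.

Let Uxi n : P.-integrable setT (fun w => (expsum Ucs (xi n.+1%:R^-1 w))%:E).
Proof. by have [] := expsum_xi n Ucs_q. Qed.

Let Ucs0 : \sum_(c <- Ucs) c.1 = 0.
Proof. by rewrite /Ucs !big_cons big_nil /=; ring. Qed.

Let Ucs1 : \sum_(c <- Ucs) c.1 * c.2 = 0.
Proof. by rewrite /Ucs !big_cons big_nil /=; ring. Qed.

Let Unu : nu.-integrable setT (fun y => (expsum Ucs y)%:E).
Proof. by have [] := expsum_nu Ucs_q Ucs0 Ucs1. Qed.

Let L_linear n a f g : exp_growth eta f -> exp_growth eta g ->
  L n (fun y => a * f y + g y) = a * L n f + L n g.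
Proof.
move=> ef eg; rewrite /L.
have H d (T : measurableType d) (mu : {measure set T -> \bar R}) (X : T -> R) :
    measurable_fun setT X -> mu.-integrable setT (fun t => (expsum Ucs (X t))%:E) ->
    (\int[mu]_t ((a * f (X t) + g (X t)) * wt (X t)))%R =
    (a * (\int[mu]_t (f (X t) * wt (X t))) + \int[mu]_t (g (X t) * wt (X t)))%R.
  move=> mX Ui; have fi := weighted_integrable mX Ui ef.
  have gi := weighted_integrable mX Ui eg.
  rewrite -RintegralZl// -RintegralD//; last exact: (integrableZl measurableT a fi).
  by apply: eq_Rintegral => t _; ring.
rewrite H// (H _ _ nu id)//; ring.
Qed.

Let L_bounded : exists2 B, 0 <= B & forall n (f : R -> R) C, measurable_fun setT f ->
  (forall y, `|f y| <= C * expR (eta * `|y|)) -> `|L n f| <= C * B.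
Proof.
have [M MP] : exists M, forall n,
    n.+1%:R * (\int[P]_w (expsum Ucs (xi n.+1%:R^-1 w)))%R <= M.
  have /cvg_ex/cvg_seq_bounded[M [_ /(_ (M + 1))]] : exists l : R,
      n.+1%:R * (\int[P]_w (expsum Ucs (xi n.+1%:R^-1 w)))%R @[n --> \oo] --> l.
    by eexists; exact: expsum_cvg Ucs_q Ucs0 Ucs1.
  rewrite ltrDl => /(_ ltr01) h; exists (M + 1) => n.
  by apply: le_trans (ler_norm _) _; exact: h.
have U0 y : 0 <= expsum Ucs y.
  by apply: le_trans (wt_le _); rewrite mulr_ge0 ?expR_ge0.
have M0 : 0 <= M.
  by apply: le_trans (MP 0%N); rewrite mulr_ge0// Rintegral_ge0.
have I0 : 0 <= (\int[nu]_y (expsum Ucs y))%R by rewrite Rintegral_ge0.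
exists (M + (eta ^+ 2 * `|sigma2| + (\int[nu]_y (expsum Ucs y))%R)).
  by rewrite !addr_ge0// mulr_ge0// sqr_ge0.
move=> n f C mf fC.
have fC0 : `|f 0| <= C by have := fC 0; rewrite normr0 mulr0 expR0 mulr1.
have C0 : 0 <= C := le_trans (normr_ge0 _) fC0.
rewrite mulrDr (le_trans (ler_normB _ _))// lerD//.
  rewrite normrM normr_nat.
  apply: (@le_trans _ _ (n.+1%:R * (C * (\int[P]_w (expsum Ucs (xi n.+1%:R^-1 w)))%R))).
    by rewrite ler_wpM2l//; exact: weighted_bounded.
  by rewrite mulrCA ler_wpM2l.
rewrite mulrDr (le_trans (ler_normD _ _))// lerD//.
  rewrite 2!normrM (ger0_norm (sqr_ge0 _)) mulrC ler_wpM2r//.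
  by rewrite mulr_ge0// sqr_ge0.
exact: (weighted_bounded (X := id)).
Qed.

Let L_exp theta : `|theta| <= eta -> L n (fun y => expR (theta * y)) @[n --> \oo] --> 0.
Proof.
rewrite ler_norml => /andP[th1 th2].
pose cs : seq (R * R) := [:: (1, eta + theta); (-2, 2 * eta + theta); (1, 3 * eta + theta)].
have csq c : c \in cs -> 0 <= c.2 <= q.
  by rewrite -eta4 !inE => /or3P[/eqP->|/eqP->|/eqP->] /=; have := eta0; lra.
have s0 : \sum_(c <- cs) c.1 = 0 by rewrite /cs !big_cons big_nil /=; ring.
have s1 : \sum_(c <- cs) c.1 * c.2 = 0 by rewrite /cs !big_cons big_nil /=; ring.
have s2 : 2^-1 * sigma2 * \sum_(c <- cs) c.1 * c.2 ^+ 2 = eta ^+ 2 * sigma2.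
  by rewrite /cs !big_cons big_nil /=; field.
have := expsum_cvg csq s0 s1; rewrite s2 => h.
have -> : L^~ (fun y => expR (theta * y)) = (fun n : nat =>
    n.+1%:R * (\int[P]_w (expsum cs (xi n.+1%:R^-1 w)))%R -
    (eta ^+ 2 * sigma2 + (\int[nu]_y (expsum cs y))%R)).
  apply/funext => n; rewrite /L mulr0 expR0 mulr1.
  by congr (_ * _ - (_ + _)); apply: eq_Rintegral => t _; rewrite wtE.
rewrite -[X in _ --> X](subrr (eta ^+ 2 * sigma2 + (\int[nu]_y (expsum cs y))%R)).
by apply: cvgB => //; exact: cvg_cst.
Qed.

(** The function f is divided by [wt]. The quotient is continuous because f vanishes near 0, the
    only zero of [wt], and the Gaussian mass at 0 does not see it. *)
Lemma jump_measure_cvg (f : R -> R) (a A : R) : 0 < a -> continuous f ->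
  (forall y, `|y| <= a -> f y = 0) -> (forall y, A < `|y| -> f y = 0) ->
  n.+1%:R * (\int[P]_w (f (xi n.+1%:R^-1 w)))%R @[n --> \oo] --> (\int[nu]_y (f y))%R.
Proof.
move=> a0 cf fa fA.
pose g y := f y / wt y.
have wt_neq0 y : y != 0 -> wt y != 0.
  move=> y0; apply: mulf_neq0; first by rewrite gt_eqF ?expR_gt0.
  rewrite expf_eq0/= subr_eq0 -expR0 (inj_eq (@expR_inj R)) mulf_neq0//.
  by rewrite gt_eqF.
have gwt y : g y * wt y = f y.
  have [->|y0] := eqVneq y 0; last by rewrite /g divfK// wt_neq0.
  by rewrite /g fa ?mul0r// normr0 ltW.
have cwt : continuous wt.
  move=> y; have ce : {for y, continuous (fun y => expR (eta * y))}.
    apply: (continuous_comp (f := fun y => eta * y) (g := expR)).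
      exact: mulrl_continuous.
    exact: continuous_expR.
  apply: cvgM; first exact: ce.
  apply: (continuous_comp (f := fun y => expR (eta * y) - 1) (g := fun y => y ^+ 2)).
    by apply: cvgB; [exact: ce|exact: cvg_cst].
  exact: exprn_continuous.
have cg : continuous g.
  move=> y; have [->|y0] := eqVneq y 0.
    rewrite /continuous_at {2}/g fa ?mul0r ?normr0 ?ltW//; apply: cvg_near_cst.
    have : \forall z \near (0 : R), `|z| < a.
      by apply/nbhs_ballP; exists a => // z; rewrite /ball/= sub0r normrN.
    by apply: filterS => z za; rewrite /g fa ?mul0r// ltW.
  by apply: cvgM; [exact: cf|apply: cvgV; [exact: wt_neq0|exact: cwt]].
have [B B0 LB] := L_bounded.
have gA y : A < `|y| -> g y = 0 by move=> yA; rewrite /g fA// mul0r.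
have := L_compact_support eta0 B0 L_linear LB L_exp cg gA.
have g00 : g 0 = 0 by rewrite /g fa ?mul0r// normr0 ltW.
have -> : L^~ g = (fun n : nat =>
    n.+1%:R * (\int[P]_w (f (xi n.+1%:R^-1 w)))%R - (\int[nu]_y (f y))%R).
  apply/funext => n; rewrite /L g00 mulr0 add0r.
  by congr (_ * _ - _); apply: eq_Rintegral => t _; rewrite gwt.
by move=> /subr_cvg0.
Qed.

End exponent.

(** * Expected loss on dyadic grids *)

Section limn_einf_bounds.
Variable R : realType.
Implicit Types (u v : (\bar R)^nat) (l c : \bar R).

Lemma le_limn_einf u v : (\forall n \near \oo, u n <= v n)%E ->
  (limn_einf u <= limn_einf v)%E.
Proof.
move=> [N _ uv]; rewrite !limn_einf_lim.
apply: lee_lim; [exact: is_cvg_einfs|exact: is_cvg_einfs|].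
exists N => // n /= Nn; apply: le_ereal_inf_tmp => _ [i /= ni <-].
by apply: le_trans (uv i (leq_trans Nn ni)); apply: ereal_inf_lbound; exists i.
Qed.

Lemma limn_einf_le_cvg u v l : (\forall n \near \oo, u n <= v n)%E ->
  v @ \oo --> l -> (limn_einf u <= l)%E.
Proof. by move=> /le_limn_einf + vl; rewrite (cvg_limn_einf_sup vl).1. Qed.

Lemma limn_einf_le u c : (forall n, u n <= c)%E -> (limn_einf u <= c)%E.
Proof.
move=> uc; apply: (@limn_einf_le_cvg _ (cst c)); last exact: cvg_cst.
exact: nearW.
Qed.

Lemma cvg_le_limn_einf u v l : (\forall n \near \oo, u n <= v n)%E ->
  u @ \oo --> l -> (l <= limn_einf v)%E.
Proof. by move=> /le_limn_einf + ul; rewrite (cvg_limn_einf_sup ul).1. Qed.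

Lemma measurable_limn_einf d (T : measurableType d) (f : (T -> \bar R)^nat) :
  (forall n, measurable_fun setT (f n)) ->
  measurable_fun setT (fun t => limn_einf (f ^~ t)).
Proof.
move=> mf; apply: emeasurable_fun_cvg (measurable_fun_einfs mf) _ => t _.
by rewrite limn_einf_lim; exact: is_cvg_einfs.
Qed.

End limn_einf_bounds.

Section truncated_loss.
Variable R : realType.
Implicit Types (q y : R) (m : nat).

(** A trapezoid in - y: 0 up to 1 / (m + 1), 1 from 2 / (m + 1) to m + 1, and 0 from 2 (m + 1) on.
    It makes [loss] a test function for [jump_measure_cvg]. *)
Definition cutoff m y : R :=
  Num.min 1 (Num.max 0 (m.+1%:R * - y - 1)) * Num.min 1 (Num.max 0 (2 - - y / m.+1%:R)).

Definition loss q y : R := if y < 0 then (1 - expR y) `^ q else 0.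

Definition truncated_loss q m y : R := loss q y * cutoff m y.

Lemma cutoff_itv m y : 0 <= cutoff m y <= 1.
Proof.
rewrite /cutoff; set a := Num.max _ _; set c := Num.max 0 (2 - _).
have a0 : 0 <= a by rewrite le_max lexx.
have c0 : 0 <= c by rewrite le_max lexx.
rewrite mulr_ge0 ?le_min ?ler01//= mulr_ile1// ?le_min ?ler01// ge_min lexx//.
Qed.

Lemma loss_ge0 q y : 0 <= loss q y.
Proof. by rewrite /loss; case: ifP => // _; exact: powR_ge0. Qed.

Lemma truncated_loss_ge0 q m y : 0 <= truncated_loss q m y.
Proof. by rewrite mulr_ge0 ?loss_ge0//; case/andP: (cutoff_itv m y). Qed.

Lemma truncated_loss_le q m y : truncated_loss q m y <= loss q y.
Proof. by rewrite ler_piMr ?loss_ge0//; case/andP: (cutoff_itv m y). Qed.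

Lemma cutoff_near0 m y : - y <= m.+1%:R^-1 -> cutoff m y = 0.
Proof.
move=> ym; rewrite /cutoff (@max_l _ _ 0) ?(min_r ler01) ?mul0r//.
by rewrite subr_le0 mulrC -ler_pdivlMr// mul1r.
Qed.

Lemma truncated_loss_near0 q m y : `|y| <= m.+1%:R^-1 -> truncated_loss q m y = 0.
Proof.
move=> ym; rewrite /truncated_loss cutoff_near0 ?mulr0//.
by rewrite (le_trans _ ym)// -normrN ler_norm.
Qed.

Lemma truncated_loss_large q m y : 2 * m.+1%:R < `|y| -> truncated_loss q m y = 0.
Proof.
move=> ym; rewrite /truncated_loss /loss; case: ltP => [y0|_]; last by rewrite mul0r.
rewrite /cutoff (@max_l _ _ 0 (2 - _)) ?(min_r ler01) ?mulr0//.
by rewrite subr_le0 ler_pdivlMr//; rewrite ltr0_norm// in ym; exact: ltW.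
Qed.

Lemma truncated_loss_eventually q y : \forall m \near \oo, truncated_loss q m y = loss q y.
Proof.
have [y0|y0] := ltP y 0; last first.
  by apply: nearW => m; rewrite /truncated_loss /loss ltNge y0 mul0r.
near=> m; rewrite /truncated_loss (_ : cutoff m y = 1) ?mulr1//.
have y0' : 0 < - y by rewrite oppr_gt0.
have m1 : - y <= m.+1%:R.
  by rewrite (@le_trans _ _ m%:R) ?ler_nat//; near: m; exact: nbhs_infty_ger.
have m2 : 2 / - y <= m.+1%:R.
  by rewrite (@le_trans _ _ m%:R) ?ler_nat//; near: m; exact: nbhs_infty_ger.
rewrite ler_pdivrMr// in m2.
rewrite /cutoff !min_l ?mulr1// le_max.
  apply/orP; right; rewrite lerBrDr.
  rewrite (_ : 2 = 1 + 1 :> R)// lerD2l.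
  by rewrite ler_pdivrMr// mul1r.
by apply/orP; right; rewrite lerBrDr.
Unshelve. all: by end_near.
Qed.

Lemma continuous_truncated_loss q m : continuous (truncated_loss q m).
Proof.
pose a : R := m.+1%:R^-1; have a0 : 0 < a by rewrite invr_gt0.
(* Replacing 1 - e^y by its maximum with c changes nothing where the cutoff is nonzero, and keeps
   the argument of the power in the region where it is differentiable. *)
pose c : R := 1 - expR (- a).
have c0 : 0 < c by rewrite subr_gt0 -[ltRHS]expR0 ltr_expR oppr_lt0.
pose h y := Num.max c (1 - expR y).
have -> : truncated_loss q m = (fun y => h y `^ q * cutoff m y).
  apply/funext => y; rewrite /truncated_loss.
  have [ya|ya] := leP (- y) a; first by rewrite cutoff_near0 ?mulr0.
  have y0 : y < 0 by rewrite -oppr_gt0 (lt_trans a0).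
  rewrite /loss y0 /h max_r// /c lerD2l lerN2 ler_expR lerNr; exact: ltW.
move=> y; apply: cvgM.
  apply: (continuous_comp (f := h) (g := fun x => x `^ q)).
    apply: continuous_max; first exact: cst_continuous.
    by apply: cvgB; [exact: cvg_cst|exact: continuous_expR].
  apply: differentiable_continuous; apply/derivable1_diffP.
  by apply: derivable_powR; rewrite in_itv/= andbT /h lt_max c0.
have cclip (u : R -> R) : {for y, continuous u} ->
    {for y, continuous (fun z => Num.min 1 (Num.max 0 (u z)))}.
  move=> cu; apply: (@continuous_min _ _ (cst 1) (fun z => Num.max 0 (u z))).
    exact: cst_continuous.
  by apply: (@continuous_max _ _ (cst 0) u) => //; exact: cst_continuous.
apply: cvgM; apply: cclip.
  by apply: cvgB; [apply: cvgM; [exact: cvg_cst|exact: cvgN]|exact: cvg_cst].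
by apply: cvgB; [exact: cvg_cst|apply: cvgM; [exact: cvgN|exact: cvg_cst]].
Qed.

Lemma measurable_truncated_loss q m : measurable_fun setT (truncated_loss q m).
Proof. apply: continuous_measurable_fun; exact: continuous_truncated_loss. Qed.

End truncated_loss.

Section total_loss.
Variable R : realType.
Implicit Types (q t : R) (x : R -> R) (e : \bar R).

(** Up to the cutoff, this is the q-th power of the decrease of e^x over a cell, as (e^a - e^b)^q =
    e^(q a) (1 - e^(b - a))^q. Survival is tested at the right end. *)
Definition grid_loss_term q x e m n i : R :=
  if ((i.+1%:R / 2 ^+ n)%:E < e)%E then
    expR (q * x (i%:R / 2 ^+ n)) *
    truncated_loss q m (x (i.+1%:R / 2 ^+ n) - x (i%:R / 2 ^+ n))
  else 0.

(** With 4^n cells of length 2^-n, the mesh tends to 0 while the horizon 2^n tends to infinity. *)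
Definition grid_loss q x e m n : R := \sum_(i < 4 ^ n) grid_loss_term q x e m n i.

(** The mesh tends to 0 first, at a fixed level m of truncation, because the convergence to nu is
    available only for truncated functions. *)
Definition total_loss q x e : \bar R :=
  limn_einf (fun m => limn_einf (fun n => (grid_loss q x e m n)%:E)).

Lemma grid_loss_term_ge0 q x e m n i : 0 <= grid_loss_term q x e m n i.
Proof.
rewrite /grid_loss_term; case: ifP => // _.
by rewrite mulr_ge0 ?expR_ge0 ?truncated_loss_ge0.
Qed.

Lemma cvg_exp2V : (2 ^+ n)^-1 @[n --> \oo] --> (0 : R).
Proof.
have := @cvg_expr R 2^-1; rewrite gtr0_norm ?invr_gt0// invf_lt1// ltr1n => /(_ isT).
by rewrite (_ : GRing.exp 2^-1 = fun n => (2 ^+ n)^-1)//; apply/funext => n; rewrite exprVn.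
Qed.

Lemma grid_index t n : exists i : nat,
  0 < t -> i%:R / 2 ^+ n < t <= i.+1%:R / 2 ^+ n.
Proof.
have [t0|t0] := ltP 0 t; last by exists 0%N.
have p0 : 0 < 2 ^+ n :> R by rewrite exprn_gt0.
have ex : exists j : nat, t * 2 ^+ n <= j%:R.
  by exists (Num.truncn (t * 2 ^+ n)).+1; rewrite ltW// truncnS_gt.
case: (ex_minnP ex) => -[|i] ti mini.
  by move: ti; rewrite leNgt mulr_gt0.
exists i => _; rewrite ltr_pdivrMr// ler_pdivlMr// ti andbT ltNge.
by apply/negP => /mini; rewrite ltnn.
Qed.

Lemma cvg_right_seq x t (u : R^nat) : x @ t^'+ --> x t ->
  (forall n, t <= u n) -> u @ \oo --> t -> x (u n) @[n --> \oo] --> x t.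
Proof.
move=> xt tu ut; apply/cvgrPdist_lt => eps eps0.
have /cvgrPdist_lt/(_ _ eps0) := xt.
rewrite near_withinE => /nbhs_ballP[del /= del0 h].
have /cvgrPdist_lt/(_ _ del0) := ut; apply: filterS => n un.
have := tu n; rewrite le_eqVlt => /predU1P[<-|tun]; first by rewrite subrr normr0.
exact: h.
Qed.

Lemma ler_sum_uniq_nat (s : seq nat) (F : nat -> R) N : uniq s ->
  (forall i, 0 <= F i) -> (forall i, i \in s -> (i < N)%N) ->
  \sum_(i <- s) F i <= \sum_(i < N) F i.
Proof.
move=> us F0 sN; rewrite -(big_mkord xpredT F).
rewrite [leRHS](bigID (mem s))/= -[leLHS]addr0 lerD ?sumr_ge0//.
rewrite -[leRHS]big_filter le_eqVlt; apply/orP; left; apply/eqP/perm_big.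
apply: uniq_perm => //; first by rewrite filter_uniq// iota_uniq.
move=> i; rewrite mem_filter/= mem_index_iota/=.
by case si: (i \in s) => //=; rewrite sN.
Qed.

(** Cells are open on the left and closed on the right: left ends tend to t strictly from below and
    yield the left limit, right ends tend to t from above and yield the value. *)
Lemma grid_cells (s : seq R) : uniq s -> (forall t, t \in s -> 0 < t) ->
  exists idx : R -> nat -> nat,
    [/\ forall t n, t \in s -> (idx t n)%:R / 2 ^+ n < t <= (idx t n).+1%:R / 2 ^+ n,
        forall t, t \in s -> (idx t n)%:R / 2 ^+ n @[n --> \oo] --> t,
        forall t, t \in s -> (idx t n).+1%:R / 2 ^+ n @[n --> \oo] --> t,
        \forall n \near \oo, uniq [seq idx t n | t <- s] &
        \forall n \near \oo, forall t, t \in s -> (idx t n < 4 ^ n)%N].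
Proof.
move=> us s0.
have /choice[idx' idxP] : forall p : R * nat, exists i : nat, 0 < p.1 ->
    i%:R / 2 ^+ p.2 < p.1 <= i.+1%:R / 2 ^+ p.2.
  by move=> [t n]; exact: grid_index.
pose idx t n := idx' (t, n).
pose lo t n : R := (idx t n)%:R / 2 ^+ n.
pose hi t n : R := (idx t n).+1%:R / 2 ^+ n.
have loP t n : 0 < t -> lo t n < t by move=> t0; case/andP: (idxP (t, n) t0).
have hiP t n : 0 < t -> t <= hi t n by move=> t0; case/andP: (idxP (t, n) t0).
have hilo t n : hi t n = lo t n + (2 ^+ n)^-1.
  by rewrite /hi /lo -natr1 mulrDl mul1r.
have locvg t : 0 < t -> lo t n @[n --> \oo] --> t.
  move=> t0; apply: (@squeeze_cvgr _ _ _ _ (fun n => t - (2 ^+ n)^-1) (cst t)).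
  - apply: nearW => n; apply/andP; split; last exact/ltW/loP.
    by rewrite lerBlDr -hilo; exact: hiP.
  - by rewrite -[X in _ --> X]subr0; apply: cvgB; [exact: cvg_cst|exact: cvg_exp2V].
  - exact: cvg_cst.
have hicvg t : 0 < t -> hi t n @[n --> \oo] --> t.
  move=> t0; rewrite (_ : hi t = fun n => lo t n + (2 ^+ n)^-1); last exact/funext.
  by rewrite -[X in _ --> X]addr0; apply: cvgD; [exact: locvg|exact: cvg_exp2V].
exists idx; split.
- by move=> t n /s0 t0; exact: (idxP (t, n)).
- by move=> t /s0; exact: locvg.
- by move=> t /s0; exact: hicvg.
- suff : \forall n \near \oo, forall t, t \in s -> forall t', t' \in s -> t != t' ->
      (2 ^+ n)^-1 <= `|t - t'|.
    apply: filterS => n h; rewrite map_inj_in_uniq// => t t' ts t's /eqP.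
    apply: contraTeq => tt'; apply/eqP => ii; have := h t ts t' t's tt'.
    have t0 := s0 _ ts; have t'0 := s0 _ t's.
    have := loP t n t0; have := hiP t n t0; have := loP t' n t'0; have := hiP t' n t'0.
    rewrite !hilo /lo ii => h1 h2 h3 h4.
    have : `|t - t'| < (2 ^+ n)^-1 by rewrite ltr_norml; lra.
    lra.
  have aux (Q : R -> nat -> Prop) (r : seq R) :
      (forall t, t \in r -> \forall n \near \oo, Q t n) ->
      \forall n \near \oo, forall t, t \in r -> Q t n.
    elim: r => [|t r IH] h; first exact: nearW.
    near=> n => t'; rewrite inE => /predU1P[->|t'r].
      by near: n; apply: h; rewrite mem_head.
    by move: t' t'r; near: n; apply: IH => t' t'r; apply: h; rewrite inE t'r orbT.
  apply: (aux (fun t n => forall t', t' \in s -> t != t' -> (2 ^+ n)^-1 <= `|t - t'|)) => t ts.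
  apply: (aux (fun t' n => t != t' -> (2 ^+ n)^-1 <= `|t - t'|)) => t' t's.
  have [->|tt'] := eqVneq t t'; first exact: nearW.
  have := cvgr_le _ cvg_exp2V `|t - t'|; rewrite normr_gt0 subr_eq0 => /(_ _ tt').
  by apply: filterS => n h _.
- near=> n => t ts; have t0 := s0 _ ts.
  have tn : t <= n%:R.
    have : \sum_(t <- s) `|t| <= n%:R by near: n; exact: nbhs_infty_ger.
    apply: le_trans; rewrite (big_rem t)//= -[leLHS]addr0 lerD ?ler_norm//.
    exact: sumr_ge0.
  have p0 : 0 < 2 ^+ n :> R by rewrite exprn_gt0.
  have := loP t n t0; rewrite /lo ltr_pdivrMr// => h.
  rewrite -(ltr_nat R) (lt_le_trans h)// (_ : 4 = 2 * 2)%N// expnMn natrM natrX.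
  rewrite ler_pM2r// (le_trans tn)// -natrX ler_nat ltnW// ltn_expl//.
Unshelve. all: by end_near.
Qed.

Lemma cvg_left_seq x t (u : R^nat) : cvg (x @ t^'-) ->
  (forall n, u n < t) -> u @ \oo --> t -> x (u n) @[n --> \oo] --> lim (x @ t^'-).
Proof.
move=> xt ut uct; have xlt : x s @[s --> t^'-] --> lim (x @ t^'-) by exact: xt.
exact: ((cvg_at_leftP x t (lim (x @ t^'-))).1 xlt).
Qed.

Lemma cvg_lt_ereal (u : R^nat) t e : u @ \oo --> t -> (t%:E < e)%E ->
  \forall n \near \oo, ((u n)%:E < e)%E.
Proof.
case: e => [e||//] ut te; last by apply: nearW => n; exact: ltry.
rewrite lte_fin in te; have /cvgr_lt/(_ _ te) := ut.
by apply: filterS => n; rewrite lte_fin.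
Qed.

(** Each jump eventually has a cell of its own, whose term tends to the truncated q-th power of the
    jump of e^x; the remaining terms are nonnegative. *)
Lemma jumps_le_total_loss q x e (s : seq R) : 0 < q -> cadlag x -> uniq s ->
  (forall t, t \in s -> [/\ 0 < t, (t%:E < e)%E & x t < lim (x @ t^'-)]) ->
  ((\sum_(t <- s) (expR (lim (x @ t^'-)) - expR (x t)) `^ q)%:E <= total_loss q x e)%E.
Proof.
move=> q0 [xr xl] us sP.
pose l t := lim (x @ t^'-).
pose A m := \sum_(t <- s) expR (q * l t) * truncated_loss q m (x t - l t).
apply: (@cvg_le_limn_einf _ (fun m => (A m)%:E)); last first.
  apply: cvg_near_cst.
  suff : \forall m \near \oo, forall t, t \in s ->
      truncated_loss q m (x t - l t) = loss q (x t - l t).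
    apply: filterS => m h; congr EFin; apply: eq_big_seq => t ts.
    have [_ _ xt] := sP t ts; rewrite h// /loss subr_lt0 xt.
    have e1 : 0 <= 1 - expR (x t - l t).
      by rewrite subr_ge0 -[leRHS]expR0 ler_expR subr_le0 ltW.
    rewrite -/(l t) [q * _]mulrC expRM -powRM ?expR_ge0//.
    by rewrite mulrBr mulr1 -expRD [l t + _]addrC subrK.
  elim: (s) => [|t s' IH]; first exact: nearW.
  near=> m => t'; rewrite inE => /predU1P[->|t's].
    by near: m; exact: truncated_loss_eventually.
  by move: t' t's; near: m.
apply: nearW => m.
have s0 t : t \in s -> 0 < t by move=> /sP[].
have [idx [cell locvg hicvg inj small]] := grid_cells us s0.
apply: (@cvg_le_limn_einf _ (fun n => (\sum_(t <- s)
   grid_loss_term q x e m n (idx t n))%:E)); last first.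
  apply: cvg_EFin; first exact: nearW.
  rewrite (_ : fine \o _ = fun n => \sum_(t <- s) grid_loss_term q x e m n (idx t n))//.
  rewrite /A.
  have : {subset s <= s} by [].
  elim: {1 3 4}(s) => [|t s' IH] ss.
    by rewrite big_nil; under eq_fun do rewrite big_nil; exact: cvg_cst.
  rewrite big_cons; under eq_fun do rewrite big_cons.
  apply: cvgD; last by apply: IH => t' t's; apply: ss; rewrite inE t's orbT.
  have ts : t \in s by apply: ss; exact: mem_head.
  have [t0 te _] := sP t ts.
  pose lo n : R := (idx t n)%:R / 2 ^+ n; pose hi n : R := (idx t n).+1%:R / 2 ^+ n.
  have xlo : x (lo n) @[n --> \oo] --> l t.
    by apply: cvg_left_seq => [|n|]; [exact: xl|case/andP: (cell t n ts)|exact: locvg].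
  have xhi : x (hi n) @[n --> \oo] --> x t.
    by apply: cvg_right_seq => [|n|]; [apply: xr; exact: ltW|case/andP: (cell t n ts)|exact: hicvg].
  have H : expR (q * x (lo n)) * truncated_loss q m (x (hi n) - x (lo n))
     @[n --> \oo] --> expR (q * l t) * truncated_loss q m (x t - l t).
    apply: cvgM.
      apply: (cvg_comp (fun n => q * x (lo n)) expR); last exact: continuous_expR.
      by apply: cvgM => //; exact: cvg_cst.
    apply: (cvg_comp (fun n => x (hi n) - x (lo n)) (truncated_loss q m)).
      exact: (cvgB xhi xlo).
    exact: continuous_truncated_loss.
  apply: cvg_trans H; apply: near_eq_cvg.
  have := cvg_lt_ereal (hicvg t ts) te.
  by apply: filterS => n hn; rewrite /grid_loss_term hn.
near=> n.
rewrite lee_fin -(big_map (idx ^~ n) xpredT (grid_loss_term q x e m n)).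
apply: ler_sum_uniq_nat.
- by near: n.
- exact: grid_loss_term_ge0.
- move=> i /mapP[t ts ->]; move: t ts; near: n; exact: small.
Unshelve. all: by end_near.
Qed.

End total_loss.

Section expected_loss.
Context (R : realType) (d' : measure_display) (T' : measurableType d').
Context (P : probability T' R) (k b sigma2 : R) (nu : {measure set R -> \bar R}).
Context (xi : R -> T' -> R) (e : T' -> \bar R).
Hypotheses (k0 : 0 <= k) (Y : killed_levy_process P k b sigma2 nu xi e).
Variables (q psi G : R).
Hypotheses (q0 : 0 < q) (psiE : levy_psi k b sigma2 nu q = psi%:E) (psi0 : psi < 0).
Hypothesis GE : (\int[nu]_y (loss q y)%:E = G%:E)%E.

Let mxi t : 0 <= t -> measurable_fun setT (xi t).
Proof. exact: levy_measurable (klevy_levy Y) t. Qed.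

Let h n : R := (2 ^+ n)^-1.
Let hN n : h n = (2 ^ n).-1.+1%:R^-1.
Proof. by rewrite prednK ?expn_gt0// natrX. Qed.
Let h0 n : 0 <= h n.
Proof. by rewrite invr_ge0 exprn_ge0. Qed.

Lemma measurable_grid_loss_term m n i :
  measurable_fun setT (fun w => grid_loss_term q (xi ^~ w) (e w) m n i).
Proof.
rewrite /grid_loss_term; apply: measurable_fun_ifT => //.
  apply: (measurable_fun_bool true).
  by rewrite setTI; exact: (measurable_alive Y (i.+1%:R / 2 ^+ n)).
apply: measurable_funM.
  apply: measurableT_comp; first exact: measurable_expR.
  by apply: measurable_funM => //; apply: mxi; rewrite mulr_ge0.
apply: measurableT_comp; first exact: measurable_truncated_loss.
by apply: measurable_funB; apply: mxi; rewrite mulr_ge0.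
Qed.

(** Survival to the end of the cell has probability e^(- k (i + 1) h) and the moment of e^(q xi) at
    its start is e^(i h (psi + k)); as k >= 0, their product is at most e^(i h psi). *)
Lemma integral_grid_loss_term m n i :
  (\int[P]_w (grid_loss_term q (xi ^~ w) (e w) m n i)%:E <=
   (expR (psi * h n) ^+ i)%:E * \int[P]_w (truncated_loss q m (xi (h n) w))%:E)%E.
Proof.
pose F (z : path_space R) : \bar R := (expR (q * z (i%:R * h n)) *
  truncated_loss q m (z (i.+1%:R * h n) - z (i%:R * h n)))%:E.
have F0 z : (0 <= F z)%E by rewrite lee_fin mulr_ge0 ?expR_ge0 ?truncated_loss_ge0.
have mF : measurable_fun setT F.
  apply/measurable_EFinP; apply: measurable_funM.
    apply: measurableT_comp; first exact: measurable_expR.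
    by apply: measurable_funM => //; apply: measurable_eval; rewrite mulr_ge0.
  apply: measurableT_comp; first exact: measurable_truncated_loss.
  by apply: measurable_funB; apply: measurable_eval; rewrite mulr_ge0.
have ih0 : 0 <= i.+1%:R * h n by rewrite mulr_ge0.
have := integral_alive Y ih0 mF F0.
rewrite (_ : (\int[P]_w (F (xi ^~ w) * _) = \int[P]_w (grid_loss_term q (xi ^~ w) (e w) m n i)%:E)%E); last first.
  apply: eq_integral => w _; rewrite /grid_loss_term indicE /F.
  case: ifPn => H; first by rewrite mem_set ?mule1.
  by rewrite memNset ?mule0//; exact/negP.
move=> ->.
have := integral_exp_increment Y q i (h0 n) (f := fun y => (truncated_loss q m y)%:E).
move=> -> //; last 2 first.
- by apply/measurable_EFinP; exact: measurable_truncated_loss.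
- by move=> y; rewrite lee_fin truncated_loss_ge0.
rewrite muleA; apply: lee_wpmul2r.
  by apply: integral_ge0 => w _; rewrite lee_fin truncated_loss_ge0.
have := laplace_xi Y (2 ^ n).-1 (ltW q0) psiE; rewrite -hN => lap.
under eq_bigr do rewrite lap.
rewrite prodEFin prodr_const card_ord -EFinM lee_fin -!expRM_natr -expRD ler_expR.
have := mulr_ge0 k0 (h0 n); rewrite -natr1 mulrDl mul1r mulrDr; lra.
Qed.

Lemma integral_truncated_loss_fin m t : 0 <= t ->
  (\int[P]_w (truncated_loss q m (xi t w))%:E =
   (\int[P]_w (truncated_loss q m (xi t w)))%R%:E)%E.
Proof.
move=> t0; rewrite /Rintegral fineK// ge0_fin_numE; last first.
  by apply: integral_ge0 => w _; rewrite lee_fin truncated_loss_ge0.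
apply: (@le_lt_trans _ _ 1%E); last exact: ltry.
have <- : (\int[P]_w (cst 1%E) w = 1)%E.
  by rewrite integral_cst// mul1e; exact: probability_setT.
apply: ge0_le_integral => //.
- by move=> w _; rewrite lee_fin truncated_loss_ge0.
- apply/measurable_EFinP; apply: measurableT_comp; last exact: mxi.
  exact: measurable_truncated_loss.
- move=> w _; rewrite lee_fin (le_trans (truncated_loss_le _ _ _))// /loss.
  case: ltP => // x0; have /(congr1 (fun f => f q)) := @powR1 R.
  move=> pE; rewrite -[leRHS]pE ge0_ler_powR ?nnegrE ?ler01// ?(ltW q0)//.
  by rewrite subr_ge0 -[leRHS]expR0 ler_expR ltW.
Qed.

Lemma integral_grid_loss m n :
  (\int[P]_w (grid_loss q (xi ^~ w) (e w) m n)%:E <=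
   ((\int[P]_w (truncated_loss q m (xi (h n) w)))%R / (1 - expR (psi * h n)))%:E)%E.
Proof.
rewrite /grid_loss; under eq_integral do rewrite -sumEFin.
rewrite ge0_integral_sum//; last 2 first.
- by move=> i; apply/measurable_EFinP; exact: measurable_grid_loss_term.
- by move=> i w _; rewrite lee_fin grid_loss_term_ge0.
set E := (\int[P]_w _)%R; set r := expR _.
have r0 : 0 <= r by exact: expR_ge0.
have r1 : r < 1 by rewrite -[ltRHS]expR0 ltr_expR nmulr_rlt0// invr_gt0 exprn_gt0.
have E0 : 0 <= E.
  rewrite -lee_fin -integral_truncated_loss_fin//.
  by apply: integral_ge0 => w _; rewrite lee_fin truncated_loss_ge0.
apply: (@le_trans _ _ (\sum_(i < 4 ^ n) (r ^+ i * E)%:E)%E).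
  apply: lee_sum => i _; apply: le_trans (integral_grid_loss_term m n i) _.
  by rewrite integral_truncated_loss_fin.
rewrite sumEFin lee_fin -mulr_suml mulrC ler_wpM2l//.
have r1' : 0 < 1 - r by rewrite subr_gt0.
rewrite -[leRHS]mul1r ler_pdivlMr//.
by have := subrX1 r (4 ^ n); have := exprn_ge0 (4 ^ n) r0; lra.
Qed.

Lemma integral_total_loss :
  (\int[P]_w total_loss q (xi ^~ w) (e w) <= (G / - psi)%:E)%E.
Proof.
have mg m n : measurable_fun setT (fun w => (grid_loss q (xi ^~ w) (e w) m n)%:E).
  by apply/measurable_EFinP; apply: measurable_sum => i; exact: measurable_grid_loss_term.
have g0 m n w : (0 <= (grid_loss q (xi ^~ w) (e w) m n)%:E)%E.
  by rewrite lee_fin sumr_ge0// => i _; exact: grid_loss_term_ge0.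
apply: le_trans (fatou _ _ _ _) _ => //.
- by move=> m; exact: measurable_limn_einf.
- move=> m w _; apply: (@cvg_le_limn_einf _ (cst 0%E)); last exact: cvg_cst.
  exact: nearW.
apply: limn_einf_le => m.
apply: le_trans (fatou _ _ _ _) _ => //.
have tl0 y : (0 <= (truncated_loss q m y)%:E)%E by rewrite lee_fin truncated_loss_ge0.
apply: (@le_trans _ _ ((\int[nu]_y (truncated_loss q m y))%R / - psi)%:E); last first.
  have tG : (\int[nu]_y (truncated_loss q m y)%:E <= G%:E)%E.
    rewrite -GE; apply: le_integral_nonmeasurable => // y.
    by rewrite lee_fin truncated_loss_le.
  rewrite lee_fin ler_pM2r ?invr_gt0 ?oppr_gt0// -lee_fin /Rintegral fineK//.
  rewrite ge0_fin_numE; first by rewrite (le_lt_trans tG)// ltry.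
  by apply: integral_ge0.
apply: (@limn_einf_le_cvg _ _ (fun n => ((\int[P]_w (truncated_loss q m (xi (h n) w)))%R / (1 - expR (psi * h n)))%:E)).
  by apply: nearW => n; exact: integral_grid_loss.
apply: cvg_EFin; first exact: nearW.
(* With N + 1 = 2^n, numerator and denominator are both multiplied by N + 1; the former then tends
   to the integral against nu and the latter to - psi. *)
pose a N : R := N.+1%:R * (\int[P]_w (truncated_loss q m (xi N.+1%:R^-1 w)))%R.
pose c N : R := - (N.+1%:R * (expR (psi / N.+1%:R) - 1)).
rewrite (_ : fine \o _ = (fun N => a N / c N) \o (fun n => (2 ^ n).-1)); last first.
  apply/funext => n /=; rewrite /a /c -hN -mulrN invfM mulrACA mulfV// mul1r.
  by rewrite opprB.
apply: (@cvg_comp _ _ _ (fun n => (2 ^ n).-1) (fun N => a N / c N) \oo \oo).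
  move=> A [N _ NA]; exists N => // n /= Nn; apply: NA => /=.
  by rewrite -ltnS prednK ?expn_gt0// (leq_ltn_trans Nn)// ltn_expl.
apply: cvgM.
  apply: (jump_measure_cvg Y q0 psiE (a := m.+1%:R^-1) (A := 2 * m.+1%:R)).
  - by rewrite invr_gt0.
  - exact: continuous_truncated_loss.
  - exact: truncated_loss_near0.
  - exact: truncated_loss_large.
apply: cvgV; first by rewrite oppr_eq0 lt_eqF.
by apply: cvgN; exact: cvg_expR_slope.
Qed.

End expected_loss.

(** * The Lamperti transform *)

Section right_continuous_process.
Context (R : realType) (d : measure_display) (T : measurableType d).

(** The value at time |s| is the limit of the values at the next dyadic times, which take countably
    many values on each grid. The absolute value lets time range over the whole line. *)
Lemma measurable_right_continuous (X : R -> T -> R) :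
  (forall t, 0 <= t -> measurable_fun setT (X t)) ->
  (forall w t, 0 <= t -> X ^~ w @ t^'+ --> X t w) ->
  measurable_fun setT (fun p : R * T => X `|p.1| p.2).
Proof.
move=> mX rX.
pose idx n (s : R) : nat := Num.truncn (`|s| * 2 ^+ n).
have pow0 n : 0 < 2 ^+ n :> R by rewrite exprn_gt0.
have y0 n (s : R) : 0 <= `|s| * 2 ^+ n by rewrite mulr_ge0 ?normr_ge0 ?ltW.
pose f n (p : R * T) : R := X ((idx n p.1).+1%:R / 2 ^+ n) p.2.
apply: (@measurable_fun_cvg _ _ _ setT f) => [n|[s w] _] /=; last first.
  rewrite /f/=; apply: (@cvg_right_seq _ (X ^~ w) `|s|); first exact: rX.
    move=> n; rewrite ler_pdivlMr// ltW//.
    by have /andP[] := truncn_itv (y0 n s).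
  apply: (@squeeze_cvgr _ _ _ _ (cst `|s|) (fun n => `|s| + (2 ^+ n)^-1)).
  - apply: nearW => n; have /andP[h1 h2] := truncn_itv (y0 n s).
    rewrite ler_pdivlMr// ltW//= -natr1 mulrDl mul1r lerD2r ler_pdivrMr//.
  - exact: cvg_cst.
  - by rewrite -[X in _ --> X]addr0; apply: cvgD; [exact: cvg_cst|exact: cvg_exp2V].
move=> _ B mB; rewrite setTI.
have -> : f n @^-1` B = \bigcup_i
    ([set s : R | idx n s = i] `*` (X (i.+1%:R / 2 ^+ n) @^-1` B)).
  apply/seteqP; split=> [[s w] /= h|[s w] [i _ [/= <- h]]//].
  by exists (idx n s).
apply: bigcupT_measurable => i; apply: measurableX; last first.
  by rewrite -[X in measurable X]setTI; apply: mX => //; rewrite divr_ge0 ?ltW.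
have -> : [set s : R | idx n s = i] = (fun s => `|s| * 2 ^+ n) @^-1` `[i%:R, i.+1%:R[.
  apply/seteqP; split=> s /=; rewrite in_itv/=.
    by move=> <-; exact: truncn_itv.
  move=> /andP[h1 h2]; apply/eqP; rewrite eqn_leq.
  by rewrite truncn_ge_nat// h1 andbT -ltnS truncn_lt_nat.
by rewrite -[X in measurable X]setTI; apply: measurable_funM.
Qed.

End right_continuous_process.

Section clock.
Variable R : realType.
Implicit Types (beta s t u v : R) (x : R -> R) (e : \bar R).

Definition clock_density beta x e s : R :=
  if (s%:E < e)%E then expR (beta * x s) else 0.

Lemma clock_density_ge0 beta x e s : 0 <= clock_density beta x e s.
Proof. by rewrite /clock_density; case: ifP => // _; exact: expR_ge0. Qed.

Lemma lamperti_clockE beta x e A : 0 < beta ->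
  lamperti_clock beta (killed_path x e) A =
  (\int[lebesgue_measure]_(s in A) (clock_density beta x e s)%:E)%E.
Proof.
move=> beta0; apply: eq_integral => s _; rewrite /killed_path /clock_density.
by case: ifP => _ //; rewrite gt0_muleNy.
Qed.

End clock.

Section measurable_clock.
Context (R : realType) (d : measure_display) (T : measurableType d).
Context (xi : R -> T -> R) (e : T -> \bar R) (beta : R).
Hypotheses (mxi : forall t, 0 <= t -> measurable_fun setT (xi t))
  (me : measurable_fun setT e)
  (rxi : forall w t, 0 <= t -> xi ^~ w @ t^'+ --> xi t w).

Lemma measurable_clock_density : measurable_fun setT
  (fun p : R * T => clock_density beta (xi ^~ p.2) (e p.2) `|p.1|).
Proof.
rewrite /clock_density; apply: measurable_fun_ifT => //; last first.
  apply: measurableT_comp; first exact: measurable_expR.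
  by apply: measurable_funM => //; exact: measurable_right_continuous.
apply: measurable_fun_lte.
  apply/measurable_EFinP; apply: measurableT_comp; first exact: normr_measurable.
  exact: measurable_fst.
exact: measurableT_comp me measurable_snd.
Qed.

Lemma measurable_clock_density_time w :
  measurable_fun setT (fun s : R => clock_density beta (xi ^~ w) (e w) `|s|).
Proof.
exact: (@measurable_fun_pair1 _ _ _ _ _ _ _ w measurable_clock_density).
Qed.

Lemma measurable_lamperti_clock (A : set R) : 0 < beta ->
  measurable A -> A `<=` `[0, +oo[ ->
  measurable_fun setT (fun w => lamperti_clock beta (killed_path (xi ^~ w) (e w)) A).
Proof.
move=> beta0 mA A0.
pose f (p : R * T) : \bar R :=
  ((clock_density beta (xi ^~ p.2) (e p.2) `|p.1|)%:E * (\1_A p.1)%:E)%E.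
rewrite (_ : (fun w => _) = (fun w => \int[lebesgue_measure]_s f (s, w))%E); last first.
  apply/funext => w; rewrite lamperti_clockE// integral_mkcond.
  apply: eq_integral => s _; rewrite /f/= patchE indicE.
  case: ifPn => [|_]; last by rewrite mule0.
  by rewrite inE => /A0; rewrite /= in_itv/= andbT => s0; rewrite mule1 ger0_norm.
apply: measurable_fun_fubini_tonelli_G => //.
- apply: emeasurable_funM; apply/measurable_EFinP; first exact: measurable_clock_density.
  by apply: measurableT_comp; [exact: measurable_indic|exact: measurable_fst].
- by move=> p; rewrite mule_ge0// lee_fin ?clock_density_ge0.
Qed.

End measurable_clock.

Section clock_inverse.
Context (R : realType) (x : R -> R) (e : \bar R) (beta : R).
Hypotheses (beta0 : 0 < beta) (rx : forall t, 0 <= t -> x @ t^'+ --> x t).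

Local Notation y := (killed_path x e).
Local Notation C r := (lamperti_clock beta y `[0, r]).
Local Notation I := (lamperti_clock beta y `[0, +oo[).
Local Notation tau := (lamperti_tau beta y).

Lemma measurable_clock_path :
  measurable_fun (`[0, +oo[ : set R) (fun s => (clock_density beta x e s)%:E).
Proof.
apply/measurable_EFinP.
(* A deterministic path is a process over the one-point space. *)
have := @measurable_clock_density_time R _ unit (fun t _ => x t) (fun=> e) beta.
move=> /(_ (fun t _ => measurable_cst _) (measurable_cst _) (fun=> rx) tt) m.
apply: eq_measurable_fun (measurable_funTS m) => s; rewrite inE /= in_itv/= andbT => s0.
by rewrite ger0_norm.
Qed.

Lemma lamperti_clock_le A B : A `<=` B ->
  (lamperti_clock beta y A <= lamperti_clock beta y B)%E.
Proof.
move=> AB; rewrite !lamperti_clockE// !(integral_mkcond _ (fun s => (_ s)%:E)).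
apply: le_integral_nonmeasurable => s; rewrite !patchE.
  by case: ifP => // _; rewrite lee_fin clock_density_ge0.
case: ifPn => [|_]; first by rewrite inE => /AB h; rewrite mem_set.
by case: ifP => // _; rewrite lee_fin clock_density_ge0.
Qed.

Lemma lamperti_clock_lt t : (t%:E < I)%E -> exists n : nat, (t%:E < C n%:R)%E.
Proof.
move=> tI; have m := measurable_clock_path.
have := @ge0_nondecreasing_set_cvg_integral _ (measurableTypeR R) R
  (fun n : nat => [set` `[0, n%:R : R]])
  (fun s => (clock_density beta x e s)%:E) lebesgue_measure.
have -> : \bigcup_n [set` `[0, n%:R : R]] = `[0, +oo[%classic :> set R.
  apply/seteqP; split=> [s [n _]|s] /=; rewrite !in_itv/= ?andbT; first by case/andP.
  move=> s0; exists (Num.truncn s).+1 => //=.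
  by rewrite in_itv/= s0 ltW// truncnS_gt.
rewrite -lamperti_clockE// => cv.
have : \forall n \near \oo, (t%:E <
    \int[lebesgue_measure]_(s in [set` `[0%R, (n%:R : R)%R]]) (clock_density beta x e s)%:E)%E.
  apply: (cvge_near_gt tI (cv _ _ _ _)) => //.
  - move=> i j ij; apply/subsetPset => s /=; rewrite !in_itv/= => /andP[-> h]/=.
    by rewrite (le_trans h)// ler_nat.
  - move=> i; apply: measurable_funS m => //.
    by move=> s /=; rewrite !in_itv/= andbT => /andP[].
  - by move=> i s _; rewrite lee_fin clock_density_ge0.
by move=> [N _ /(_ N (leqnn N))]; rewrite -lamperti_clockE//; exists N.
Qed.

Let S t := [set r | 0 <= r /\ (t%:E <= C r)%E].

Let lbS t : lbound (S t) 0.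
Proof. by move=> r []. Qed.

Let S_nonempty t : (t%:E < I)%E -> S t !=set0.
Proof. by move=> /lamperti_clock_lt[n /ltW tn]; exists n%:R. Qed.

Lemma lamperti_tau_ge0 t : 0 <= tau t.
Proof.
rewrite /lamperti_tau -/(S t).
have [->|S0] := eqVneq (S t) set0; first by rewrite inf0.
by apply: lb_le_inf; [exact/set0P|exact: lbS].
Qed.

(** Together with the next lemma, this stands in for the identity [C (tau t)] = t without going
    through the continuity of the clock. *)
Lemma lamperti_tau_gt t r : 0 <= r -> r < tau t -> (C r < t%:E)%E.
Proof.
move=> r0; rewrite ltNge => /negP h; rewrite ltNge; apply/negP => tC; apply: h.
by apply: ge_inf; [exists 0; exact: lbS|split].
Qed.

Lemma lamperti_tau_lt t r : (t%:E < I)%E -> tau t < r -> (t%:E <= C r)%E.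
Proof.
move=> /S_nonempty S0 /inf_lt -/(_ S0)[s [s0 ts] sr].
apply: le_trans ts _; apply: lamperti_clock_le => u /=; rewrite !in_itv/= => /andP[-> us]/=.
by rewrite (le_trans us)// ltW.
Qed.

Lemma lamperti_tau_le s t : (t%:E < I)%E -> s <= t -> tau s <= tau t.
Proof.
move=> tI st; rewrite leNgt; apply/negP => ts.
have [r1 r2] := midf_lt ts.
have r0 : 0 <= 2^-1 * (tau t + tau s).
  by rewrite mulr_ge0// addr_ge0// lamperti_tau_ge0.
have := lamperti_tau_gt r0; rewrite mulrC => /(_ s r2).
have := lamperti_tau_lt tI r1; move=> /le_lt_trans h /h.
by rewrite lte_fin ltNge st.
Qed.

End clock_inverse.

(** * Jumps recovered from drops on dyadic grids *)

Section jump_from_intervals.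
Variable R : realType.

(* The endpoints accumulate at some [t], from the left and from the right
   because [g] has one-sided limits at [t]. *)
Lemma shrinking_intervals_jump (g : R -> R) (a b : R^nat) (B r : R) : 0 < r ->
  (forall t, 0 <= t -> g @ t^'+ --> g t) -> (forall t, 0 < t -> cvg (g @ t^'-)) ->
  (forall n, 0 <= a n <= B) -> (forall n, a n <= b n) ->
  (forall n, r < g (a n) - g (b n)) ->
  (forall u v, u < v -> \forall n \near \oo, ~ (a n < u /\ v < b n)) ->
  exists n t, [/\ 0 < t, a n < t <= b n & r <= lim (g @ t^'-) - g t].
Proof.
move=> r0 rg lg aB ab rab uv.
have [|phi iphi /cvg_ex[t at_t]] := @bolzano_weierstrass R a.
  exists B; split; [exact: num_real|move=> M BM n _ /=].
  by have /andP[an0 anB] := aB n; rewrite ger0_norm// (le_trans anB)// ltW.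
have phin n : (n <= phi n)%N by exact: leq_increasing_seq.
have t0 : 0 <= t.
  by apply: cvgr_to_ge at_t _; apply: nearW => n /=; case/andP: (aB (phi n)).
have ball_a eps : 0 < eps -> \forall n \near \oo, `|t - a (phi n)| < eps.
  by move=> eps0; move/cvgrPdist_lt : at_t => /(_ _ eps0).
have b_lt eps : 0 < eps -> \forall n \near \oo, b (phi n) <= t + eps.
  move=> eps0; have e3 : 0 < eps / 2 by rewrite divr_gt0.
  have [N _ Nuv] := uv (t + eps / 2) (t + eps) ltac:(lra).
  near=> n; rewrite leNgt; apply/negP => h.
  apply: (Nuv (phi n)) => /=.
    by apply: leq_trans (phin n); near: n; exact: nbhs_infty_ge.
  split=> //; have : `|t - a (phi n)| < eps / 2 by near: n; exact: ball_a.
  by rewrite ltr_norml; lra.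
have right_osc eps : 0 < eps -> exists2 del, 0 < del &
    forall s, t <= s < t + del -> `|g t - g s| < eps.
  move=> eps0; have /cvgrPdist_lt/(_ _ eps0) := rg t t0.
  rewrite near_withinE => /nbhs_ballP[del /= del0 h]; exists del => // s /andP[].
  rewrite le_eqVlt => /predU1P[<-|ts] sd; first by rewrite subrr normr0.
  by apply: h => //=; rewrite /ball/= ltr_norml; lra.
have left_osc eps : 0 < eps -> 0 < t -> exists2 del, 0 < del &
    forall s, t - del < s < t -> `|lim (g @ t^'-) - g s| < eps.
  move=> eps0 t1; have /cvgrPdist_lt/(_ _ eps0) := lg t t1.
  rewrite near_withinE => /nbhs_ballP[del /= del0 h]; exists del => // s /andP[sd st].
  by apply: h => //=; rewrite /ball/= ltr_norml; lra.
(* Close to t, g varies by less than 2 eps <= r on each side. An interval over which it drops by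
   more than r must therefore straddle t. *)
have key eps : 0 < eps -> 2 * eps <= r -> \forall n \near \oo,
    [/\ 0 < t, a (phi n) < t <= b (phi n) & r <= lim (g @ t^'-) - g t + 2 * eps].
  move=> eps0 epsr; have [d1 d10 h1] := right_osc _ eps0.
  have [d2 d20 h2] : exists2 del, 0 < del & (0 < t -> forall s, t - del < s < t -> `|lim (g @ t^'-) - g s| < eps).
    have [t1|t1] := ltP 0 t; last by exists 1.
    by have [del del0 h] := left_osc _ eps0 t1; exists del.
  near=> n.
  have A1 : `|t - a (phi n)| < d1 by near: n; exact: ball_a.
  have A2 : `|t - a (phi n)| < d2 by near: n; exact: ball_a.
  have A3 : b (phi n) <= t + d1 / 2 by near: n; apply: b_lt; rewrite divr_gt0.
  have A4 := ab (phi n); have A5 := rab (phi n); have /andP[A6 _] := aB (phi n).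
  move: A1 A2; rewrite !ltr_norml => /andP[A11 A12] /andP[A21 A22].
  have [ta|ta] := leP t (a (phi n)).
    have := h1 (a (phi n)) ltac:(lra); have := h1 (b (phi n)) ltac:(lra).
    by rewrite !ltr_norml; lra.
  have t1 : 0 < t by lra.
  have := h2 t1 (a (phi n)) ltac:(lra); rewrite ltr_norml => H2.
  have [tb|tb] := ltP (b (phi n)) t.
    by have := h2 t1 (b (phi n)) ltac:(lra); rewrite ltr_norml; lra.
  have := h1 (b (phi n)) ltac:(lra); rewrite ltr_norml => H1.
  by split=> //; lra.
have r2 : 0 < r / 2 by rewrite divr_gt0.
have [N _ /(_ N (leqnn N))[t1 tN _]] := key (r / 2) r2 ltac:(lra).
exists (phi N), t; split=> //.
apply/ler_addgt0Pl => eps eps0.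
pose eps' := Num.min (r / 2) (eps / 2).
have eps'0 : 0 < eps' by rewrite lt_min r2 divr_gt0.
have e1 : eps' <= r / 2 by rewrite ge_min lexx.
have e2 : eps' <= eps / 2 by rewrite ge_min lexx orbT.
clearbody eps'.
by have [M _ /(_ M (leqnn M))[_ _]] := key eps' eps'0 ltac:(lra); lra.
Unshelve. all: by end_near.
Qed.

End jump_from_intervals.

Section drops.
Variable R : realType.
Implicit Types (z : R -> R) (r : R).

(** The last condition discards the passage to 0 at the end of life, which is not a birth:
    [neg_jump_times] stops strictly before the lifetime. *)
Definition drop_indices z r n : {set 'I_(4 ^ n)} :=
  [set i : 'I_(4 ^ n) | (r < z (i%:R / 2 ^+ n) - z (i.+1%:R / 2 ^+ n)) &&
                        (z (i.+1%:R / 2 ^+ n) != 0)].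

Definition eventual_drops z r j : Prop :=
  exists N, forall n, (N <= n)%N -> (j < #|drop_indices z r n|)%N.

Definition rational_drop z j (p : rat) : \bar R :=
  if `[< 0 < ratr p :> R /\ eventual_drops z (ratr p) j >] then (ratr p)%:E else 0%E.

(* For a càdlàg path, this dominates the size of its negative jump of rank j; it is
   measurable because it only looks at the values at dyadic times. *)
Definition big_drop z j : \bar R := ereal_sup (range (rational_drop z j)).

Lemma rational_drop_ge0 z j p : (0 <= rational_drop z j p)%E.
Proof. by rewrite /rational_drop; case: asboolP => // -[/ltW]; rewrite lee_fin. Qed.

Lemma big_drop_ge0 z j : (0 <= big_drop z j)%E.
Proof.
by apply: le_trans (rational_drop_ge0 z j 0) _; apply: ereal_sup_ubound; exists 0.
Qed.

Lemma big_drop_gt z j r : 0 <= r -> (r%:E < big_drop z j)%E ->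
  exists2 s : R, r < s & eventual_drops z s j.
Proof.
move=> r0 /ereal_sup_gt[_ [p _ <-]]; rewrite /rational_drop.
case: asboolP => [[_ h]|_]; last by rewrite lte_fin ltNge r0.
by rewrite lte_fin => rp; exists (ratr p).
Qed.

Lemma big_drop_ge z j r : 0 < r ->
  (forall s, 0 < s < r -> eventual_drops z s j) -> (r%:E <= big_drop z j)%E.
Proof.
move=> r0 h; apply/lee_subgt0Pr => eps eps0.
have [p] := @rat_in_itvoo R (Num.max 0 (r - eps)) r ltac:(by rewrite gt_max r0 ltrBlDr ltrDl).
rewrite in_itv/= gt_max => /andP[/andP[p0 ep] pr].
rewrite -EFinB; apply: (@le_trans _ _ (ratr p : R)%:E); first by rewrite lee_fin ltW.
apply: ereal_sup_ubound; exists p => //; rewrite /rational_drop asboolT//.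
by split=> //; apply: h; rewrite p0.
Qed.

Lemma measurable_ereal_sup_rat d (T : measurableType d) (f : rat -> T -> \bar R) :
  (forall p, measurable_fun setT (f p)) ->
  measurable_fun setT (fun t => ereal_sup (range (f ^~ t))).
Proof.
move=> mf; pose g n : T -> \bar R := if unpickle n is Some p then f p else f 0.
have mg n : measurable_fun setT (g n) by rewrite /g; case: unpickle.
rewrite (_ : (fun t => _) = fun t => esups (g ^~ t) 0); first exact: measurable_fun_esups.
apply/funext => t; rewrite /esups; congr ereal_sup.
apply/seteqP; split=> [_ [p _ <-]|_ [n _ <-]] /=.
  by exists (pickle p) => //; rewrite /g pickleK.
by rewrite /g; case: unpickle => [p|]; eexists.
Qed.

Lemma measurable_eventual_drops r j :
  measurable ([set z | eventual_drops z r j] : set (path_space R)).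
Proof.
rewrite (_ : [set z | _] = \bigcup_N \bigcap_(n in [set n | (N <= n)%N])
    [set z | (j < #|drop_indices z r n|)%N]); last first.
  by apply/seteqP; split=> z [N h]; exists N => // [n /= Nn|n Nn]; exact: h.
apply: bigcupT_measurable => N; apply: bigcap_measurableType => n _.
pose f i (z : path_space R) : R :=
  if (r < z (i%:R / 2 ^+ n) - z (i.+1%:R / 2 ^+ n)) && (z (i.+1%:R / 2 ^+ n) != 0)
  then 1 else 0.
have mev i : measurable_fun setT (fun z : path_space R => z (i%:R / 2 ^+ n)).
  by apply: measurable_eval; rewrite divr_ge0// exprn_ge0.
have mf i : measurable_fun setT (f i).
  apply: measurable_fun_ifT => //; apply: measurable_and.
    by apply: measurable_fun_ltr => //; exact: measurable_funB.
  apply: measurable_neg; exact: measurable_fun_eqr.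
rewrite (_ : [set z | _] = (fun z => \sum_(i < 4 ^ n) f i z) @^-1` `]j%:R, +oo[).
  rewrite -[X in measurable X]setTI.
  by apply: measurable_sum.
apply/seteqP; split=> z /=; rewrite in_itv/= andbT /f -big_mkcond/= sumr_const cardsE.
  by rewrite ltr_nat.
by rewrite ltr_nat.
Qed.

Lemma measurable_big_drop j : measurable_fun setT ((big_drop ^~ j) : path_space R -> \bar R).
Proof.
apply: (@measurable_ereal_sup_rat _ (path_space R) (fun p z => rational_drop z j p)) => p.
apply: measurable_fun_ifT => //; apply: (measurable_fun_bool true).
rewrite setTI; have [p0|p0] := ltP 0 (ratr p : R).
  rewrite (_ : _ @^-1` _ = [set z | eventual_drops z (ratr p) j]).
    exact: measurable_eventual_drops.
  by apply/seteqP; split=> z /= => [/asboolP[]//|h]; apply/asboolP.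
rewrite (_ : _ @^-1` _ = set0)//.
by apply/seteqP; split=> z //= /asboolP[].
Qed.

End drops.

Section sum_of_suprema.
Variable R : realType.
Local Open Scope ereal_scope.

(** Each term is approached from below by a_j - 1 / (k + 1), or by k if it is infinite. The
    alternative value 0 is used as long as the difference is negative. *)
Lemma sume_le_of_lt J (a : nat -> \bar R) (W : \bar R) : (forall j, 0 <= a j) ->
  (forall b : nat -> R, (forall j, b j = 0%R \/ (0 <= b j)%R /\ (b j)%:E < a j) ->
    (\sum_(j < J) b j)%R%:E <= W) ->
  \sum_(j < J) a j <= W.
Proof.
move=> a0 H.
pose b k j : R := if a j == +oo then k%:R     else if (k.+1%:R^-1 <= fine (a j))%R then (fine (a j) - k.+1%:R^-1)%R else 0%R.
have b0 k j : (0 <= b k j)%R.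
  by rewrite /b; case: ifP => // _; case: ifP => // h; rewrite subr_ge0.
have bW k : \sum_(j < J) (b k j)%:E <= W.
  rewrite sumEFin; apply: H => j; rewrite /b.
  have [->|afin] := eqVneq (a j) +oo; first by right; rewrite ltry.
  have /fineK aE : a j \is a fin_num by rewrite ge0_fin_numE// lt_neqAle afin leey.
  case: ifP => h; [right|by left]; rewrite subr_ge0; split=> //.
  by rewrite -[X in _ < X]aE lte_fin ltrBlDr ltrDl invr_gt0.
have cb j : (b k j)%:E @[k --> \oo] --> a j.
  rewrite /b; have [->|afin] := eqVneq (a j) +oo.
    apply/cvgeyPge => A; near=> k; rewrite lee_fin; near: k; exact: nbhs_infty_ger.
  have /fineK aE : a j \is a fin_num by rewrite ge0_fin_numE// lt_neqAle afin leey.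
  rewrite -[X in _ --> X]aE; apply: cvg_EFin; first exact: nearW.
  have aj0 : (0 <= fine (a j))%R by exact: fine_ge0.
  apply: (@squeeze_cvgr _ _ _ _ (fun k => fine (a j) - k.+1%:R^-1)%R (cst (fine (a j)))).
  - apply: nearW => k /=; case: ifPn => [_|].
      by rewrite gerBl invr_ge0 ler0n lexx.
    by rewrite -ltNge subr_le0 => /ltW ->.
  - rewrite -[X in _ --> X]subr0; apply: cvgB; first exact: cvg_cst.
    exact: cvg_harmonic.
  - exact: cvg_cst.
suff cs : \sum_(j < J) (b k j)%:E @[k --> \oo] --> \sum_(j < J) a j.
  by apply: cvge_to_le cs _; exact: nearW.
elim: (J) => [|n IH].
  rewrite big_ord0 (_ : (fun k => _) = cst 0); first exact: cvg_cst.
  by apply/funext => k; rewrite big_ord0.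
rewrite big_ord_recr/=.
rewrite (_ : (fun k => _) = (fun k => \sum_(j < n) (b k j)%:E + (b k n)%:E)); last first.
  by apply/funext => k; rewrite big_ord_recr.
apply: cvgeD => //; apply: ge0_adde_def; rewrite inE ?a0// sume_ge0//.
Unshelve. all: by end_near.
Qed.

End sum_of_suprema.

Section lamperti_path.
Context (R : realType) (x : R -> R) (e : \bar R) (beta : R).
Hypotheses (beta0 : 0 < beta) (cx : cadlag x).

Local Notation y := (killed_path x e).
Local Notation C r := (lamperti_clock beta y `[0, r]).
Local Notation I := (lamperti_clock beta y `[0, +oo[).
Local Notation tau := (lamperti_tau beta y).
Local Notation X := (lamperti beta y).

Let rx : forall t, 0 <= t -> x @ t^'+ --> x t := cx.1.

Lemma lamperti_ge0 t : 0 <= X t.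
Proof. by rewrite /lamperti; case: ifP => // _; exact/fine_ge0/expeR_ge0. Qed.

Lemma lamperti_neq0 t : X t != 0 ->
  [/\ (t%:E < I)%E, ((tau t)%:E < e)%E & X t = expR (x (tau t))].
Proof.
rewrite /lamperti; case: ifP => [tI|]; last by rewrite eqxx.
by rewrite /killed_path; case: ifP => //= _; rewrite eqxx.
Qed.

(** By right continuity the density of the clock is bounded below just after u. Consequently a short
    interval of the new time cannot cover a fixed interval of the old one. *)
Lemma lamperti_clock_increment u v : 0 <= u -> u < v -> (v%:E < e)%E ->
  exists2 kap : R, 0 < kap &
    forall s t : R, (s%:E <= C u)%E -> (C v < t%:E)%E -> kap <= t - s.
Proof.
move=> u0 uv ve.
have m := measurable_clock_path e beta rx.
have : exists2 u', u < u' <= v & forall s, u < s <= u' ->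
    expR (beta * (x u - 1)) <= clock_density beta x e s.
  have /cvgrPdist_lt/(_ _ ltr01) := rx u0.
  rewrite near_withinE => /nbhs_ballP[del /= del0 h].
  exists (Num.min v (u + del / 2)); first by rewrite ge_min lexx/= lt_min uv ltrDl divr_gt0.
  move=> s /andP[us]; rewrite le_min => /andP[sv sd].
  rewrite /clock_density (le_lt_trans _ ve) ?lee_fin// ler_expR ler_pM2l//.
  have := h s; rewrite /ball/= !ltr_norml => /(_ _ us).
  have hd : - del < u - s < del by apply/andP; split; lra.
  by move=> /(_ hd); lra.
move=> [u' /andP[uu' u'v] hc]; set c := expR _ in hc.
exists (c * (u' - u)); first by rewrite mulr_gt0 ?expR_gt0// subr_gt0.
move=> s t sC Ct.
have hC : (C u + (c * (u' - u))%:E <= C v)%E.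
  have -> : C v = (C u + \int[lebesgue_measure]_(s in `]u, v]) (clock_density beta x e s)%:E)%E.
    rewrite !lamperti_clockE// (_ : `[0, v]%classic = `[0, u] `|` `]u, v])%classic; last first.
      apply/seteqP; split=> w /=; rewrite !in_itv/=.
        by move=> /andP[-> ->]; rewrite /= andbT; case: (leP w u); [left|right].
      case=> /andP[h1 h2]; first by rewrite h1 (le_trans h2)// ltW.
      by rewrite h2 (le_trans u0)// ltW.
    rewrite ge0_integral_setU//=.
    - apply: measurable_funS m => //.
      by move=> w /= []; rewrite !in_itv/= andbT => /andP[//]; move=> /ltW h _; exact: le_trans h.
    - by move=> w _; rewrite lee_fin clock_density_ge0.
    - apply/disj_setPS => w /= [] /=; rewrite !in_itv/= => /andP[_ h] /andP[+ _].
      by rewrite ltNge h.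
  apply: leeD2l; rewrite EFinM.
  have -> : ((u' - u)%:E = lebesgue_measure (`]u, u'] : set R))%E.
    by rewrite lebesgue_measure_itv/= lte_fin uu' EFinB.
  rewrite -integral_cst// [leLHS]integral_mkcond [leRHS]integral_mkcond.
  apply: le_integral_nonmeasurable => w; rewrite !patchE.
    by case: ifP => // _; rewrite lee_fin expR_ge0.
  case: ifPn => [|_].
    rewrite inE/= in_itv/= => wu'; rewrite mem_set/= ?lee_fin ?hc//.
    by move: wu'; rewrite in_itv/= => /andP[-> h]; rewrite (le_trans h).
  by case: ifP => // _; rewrite lee_fin clock_density_ge0.
have : (s%:E + (c * (u' - u))%:E < t%:E)%E.
  by apply: le_lt_trans Ct; apply: le_trans hC; exact: leeD2r.
by rewrite -EFinD lte_fin; lra.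
Qed.

(** [s] holds the jump times already attributed to other drops. More than [size s] cells have a drop
    and their images by [tau] are disjoint, so one image avoids [s]. Such images shrink with the
    mesh and surround a jump of e^x. *)
Lemma lamperti_drop_jump r j (s : seq R) : 0 < r ->
  (e < +oo)%E \/ x t @[t --> +oo] --> -oo ->
  eventual_drops X r j -> (size s <= j)%N ->
  exists t, [/\ t \notin s, 0 < t, (t%:E < e)%E &
    r <= expR (lim (x @ t^'-)) - expR (x t)].
Proof.
move=> r0 edrift [N Nj] sj.
pose a n i := tau (i%:R / 2 ^+ n).
have pow0 n : 0 < 2 ^+ n :> R by rewrite exprn_gt0.
have step n : (N <= n)%N -> exists i, [/\ r < X (i%:R / 2 ^+ n) - X (i.+1%:R / 2 ^+ n),
    X (i.+1%:R / 2 ^+ n) != 0 & forall t, t \in s -> ~~ (a n i < t <= a n i.+1)].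
  move=> Nn; apply: contrapT => no.
  have hit (i : 'I_(4 ^ n)) : exists t, i \in drop_indices X r n ->
      t \in s /\ a n i < t <= a n i.+1.
    case: (boolP (i \in _)) => [|_]; last by exists 0.
    rewrite inE => /andP[h1 h2]; apply: contrapT => nt; apply: no; exists i; split=> // t ts.
    by apply/negP => ht; apply: nt; exists t.
  have [f fP] := choice hit.
  have : (size (map f (enum (drop_indices X r n))) <= size s)%N.
    apply: uniq_leq_size; last first.
      by move=> t /mapP[i]; rewrite mem_enum => /fP[fs _] ->.
    rewrite map_inj_in_uniq ?enum_uniq// => i i'; rewrite !mem_enum => iD i'D fE.
    have [_ /andP[i1 i2]] := fP _ iD; have [_ /andP[i'1 i'2]] := fP _ i'D.
    have aux (k l : 'I_(4 ^ n)) : l \in drop_indices X r n -> (k < l)%N -> a n k.+1 <= a n l.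
      rewrite inE => /andP[h1 _] kl; apply: lamperti_tau_le => //; last first.
        by rewrite ler_pM2r ?invr_gt0// ler_nat.
      have : X (l%:R / 2 ^+ n) != 0.
        by rewrite gt_eqF//; have := lamperti_ge0 (l.+1%:R / 2 ^+ n); lra.
      by move=> /lamperti_neq0[].
    apply/val_inj; case: (ltngtP i i') => // /aux h.
      by have := le_lt_trans (le_trans i2 (h i'D)) i'1; rewrite fE ltxx.
    by have := le_lt_trans (le_trans i'2 (h iD)) i1; rewrite fE ltxx.
  by rewrite size_map -cardE leqNgt (leq_ltn_trans sj)// Nj.
have /choice[idx idxP] n : exists i, [/\ r < X (i%:R / 2 ^+ (N + n)) - X (i.+1%:R / 2 ^+ (N + n)),
    X (i.+1%:R / 2 ^+ (N + n)) != 0 & forall t, t \in s -> ~~ (a (N + n)%N i < t <= a (N + n)%N i.+1)].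
  exact/step/leq_addr.
pose al n := a (N + n)%N (idx n); pose be n := a (N + n)%N (idx n).+1.
pose ti n : R := (idx n)%:R / 2 ^+ (N + n); pose ti' n : R := (idx n).+1%:R / 2 ^+ (N + n).
have ti'E n : ti' n = ti n + (2 ^+ (N + n))^-1.
  by rewrite /ti' /ti -natr1 mulrDl mul1r.
have hal n : [/\ ((ti n)%:E < I)%E, ((al n)%:E < e)%E & X (ti n) = expR (x (al n))].
  apply: lamperti_neq0; have [h _ _] := idxP n.
  by rewrite gt_eqF//; have := lamperti_ge0 (ti' n); rewrite /ti' /ti; lra.
have hbe n : [/\ ((ti' n)%:E < I)%E, ((be n)%:E < e)%E & X (ti' n) = expR (x (be n))].
  by apply: lamperti_neq0; have [_ h _] := idxP n.
have drop n : r < expR (x (al n)) - expR (x (be n)).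
  have [_ _ <-] := hal n; have [_ _ <-] := hbe n; by have [] := idxP n.
(* The images stay bounded: they begin before the killing time or, in the case of drift, before e^x
   falls below r for good. *)
have [B alB] : exists B, forall n, 0 <= al n <= B.
  have al0 n : 0 <= al n by exact: lamperti_tau_ge0.
  case: edrift => [efin|drift].
    have /fineK eE : e \is a fin_num.
      rewrite fin_numElt efin andbT; have [_ + _] := hal 0%N.
      by apply: lt_trans; exact: ltNyr.
    exists (fine e) => n; rewrite al0/= -lee_fin eE ltW//; by have [] := hal n.
  have /cvgrNyPlt/(_ (ln r)) := drift; move=> [B [_ hB]].
  exists B => n; rewrite al0/= leNgt; apply/negP => /hB.
  by rewrite -ltr_expR lnK ?posrE//; have := drop n; have := expR_gt0 (x (be n)); lra.
have albe n : al n <= be n.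
  apply: lamperti_tau_le => //; first by have [] := hbe n.
  by rewrite -/(ti n) -/(ti' n) ti'E lerDl invr_ge0 ltW.
have := @shrinking_intervals_jump R (expR \o x) al be B r r0 _ _ alB albe drop.
case=> [t t0|t t0|u v uv|n [t [t0 nt jump]]].
- by apply: cvg_comp; [exact: rx|exact: continuous_expR].
- apply/cvg_ex; exists (expR (lim (x @ t^'-))).
  by apply: cvg_comp; [exact: cx.2|exact: continuous_expR].
- have [u0|u0] := leP u 0.
    by apply: nearW => n [+ _]; have /andP[] := alB n; lra.
  have [ve|ev] := ltP (v%:E) e; last first.
    apply: nearW => n [_ vb]; have [_ be_e _] := hbe n.
    have := lt_trans (lt_le_trans be_e ev) _.
    by rewrite -lte_fin in vb => /(_ _ vb); rewrite ltxx.
  have [kap kap0 hk] := lamperti_clock_increment (ltW u0) uv ve.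
  have /cvgr_lt/(_ _ kap0) := @cvg_exp2V R; move=> [M _ hM].
  exists M => // n /= Mn [au vb].
  have [tI _ _] := hal n; have [t'I _ _] := hbe n.
  have := hk (ti n) (ti' n) (lamperti_tau_lt beta0 rx tI au).
  have -> : (C v < (ti' n)%:E)%E by apply: lamperti_tau_gt => //; lra.
  move=> /(_ isT); rewrite ti'E addrC addKr => k2.
  by have := hM (N + n)%N (leq_trans Mn (leq_addl _ _)); lra.
- have [_ be_e _] := hbe n; have /andP[n1 n2] := nt.
  exists t; split=> //.
  + by apply/negP => ts; have [_ _ /(_ t ts)] := idxP n; rewrite nt.
  + by rewrite (le_lt_trans _ be_e)// lee_fin.
  + have lE : lim ((expR \o x) @ t^'-) = expR (lim (x @ t^'-)).
      by apply: cvg_lim => //; apply: cvg_comp; [exact: cx.2|exact: continuous_expR].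
    by rewrite -lE.
Qed.

(** Jumps are chosen greedily: once the ranks below j have their jumps, [lamperti_drop_jump]
    supplies another one at least as large as a level close to the drop of rank j. *)
Lemma lamperti_big_drops_le q J : 0 < q ->
  (e < +oo)%E \/ x t @[t --> +oo] --> -oo ->
  (\sum_(j < J) poweR (big_drop X j) q <= total_loss q x e)%E.
Proof.
move=> q0 drift; apply: (@sume_le_of_lt _ _ (fun j => poweR (big_drop X j) q)) => [j|b bP].
  exact: poweR_ge0.
have bs j : b j = 0 \/ exists s, [/\ 0 < s, eventual_drops X s j & b j <= s `^ q].
  case: (bP j) => [|[b0 ba]]; [by left|right].
  have [s bs sX] : exists2 s : R, (b j) `^ q^-1 < s & eventual_drops X s j.
    apply: big_drop_gt; first exact: powR_ge0.
    rewrite ltNge; apply/negP => h.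
    have := @gt0_ler_poweR _ q (ltW q0) (big_drop X j) ((b j) `^ q^-1)%:E.
    rewrite !in_itv/= !leey big_drop_ge0 lee_fin powR_ge0 => /(_ isT isT h).
    by rewrite -powRrM mulVf ?gt_eqF// powRr1// leNgt ba.
  have s0 : 0 < s by rewrite (le_lt_trans _ bs)// powR_ge0.
  exists s; split=> //; rewrite -[leLHS]powRr1// -(@mulVf _ q) ?gt_eqF// powRrM.
  by rewrite ge0_ler_powR ?nnegrE ?powR_ge0 ?(ltW q0) ?(ltW s0)// ltW.
suff [s [sJ us sP sb]] : exists s : seq R, [/\ (size s <= J)%N, uniq s,
    (forall t, t \in s -> [/\ 0 < t, (t%:E < e)%E & x t < lim (x @ t^'-)]) &
    \sum_(j < J) b j <= \sum_(t <- s) (expR (lim (x @ t^'-)) - expR (x t)) `^ q].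
  by apply: le_trans (jumps_le_total_loss q0 cx us sP); rewrite lee_fin.
elim: (J) => [|j [s [sj us sP sb]]].
  by exists [::]; split=> //; rewrite big_ord0 big_nil.
rewrite big_ord_recr/=; case: (bs j) => [->|[r [r0 rX br]]].
  by exists s; rewrite addr0; split=> //; exact: leqW.
have [t [ts t0 te rt]] := lamperti_drop_jump r0 drift rX sj.
exists (t :: s); split=> //=; first by rewrite ts.
- move=> u; rewrite inE => /predU1P[->|/sP//]; split=> //.
  by rewrite -ltr_expR; lra.
- rewrite big_cons addrC lerD// (le_trans br)//.
  by rewrite ge0_ler_powR ?nnegrE ?(ltW q0) ?(ltW r0)// (le_trans _ rt)// ltW.
Qed.

End lamperti_path.

Section measurable_lamperti.
Context (R : realType) (d : measure_display) (T : measurableType d).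
Context (xi : R -> T -> R) (e : T -> \bar R) (beta : R).
Hypotheses (mxi : forall t, 0 <= t -> measurable_fun setT (xi t))
  (me : measurable_fun setT e)
  (rxi : forall w t, 0 <= t -> xi ^~ w @ t^'+ --> xi t w) (beta0 : 0 < beta).

Local Notation y w := (killed_path (xi ^~ w) (e w)).

Lemma measurable_lamperti t : 0 <= t ->
  measurable_fun setT (fun w => lamperti beta (y w) t).
Proof.
move=> t0; pose I w := lamperti_clock beta (y w) `[0, +oo[.
have mI : measurable_fun setT I by exact: measurable_lamperti_clock.
have mC r : measurable_fun setT (fun w => lamperti_clock beta (y w) `[0, r]).
  apply: measurable_lamperti_clock => // s /=.
  by rewrite !in_itv/= andbT => /andP[].
have mtI : measurable_fun setT (fun w => (t%:E < I w)%E) by exact: measurable_fun_lte.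
pose tau w := if (t%:E < I w)%E then lamperti_tau beta (y w) t else 0.
have tau0 w : 0 <= tau w by rewrite /tau; case: ifP => // _; exact: lamperti_tau_ge0.
have mtau : measurable_fun setT tau.
  apply: (measurability _ (RGenInftyO.measurableE R)) => // _ [_ [r ->] <-].
  rewrite setTI; have [r0|r0] := leP r 0.
    rewrite (_ : _ @^-1` _ = set0)//; apply/seteqP; split=> w //=.
    by rewrite in_itv/= ltNge (le_trans r0).
  (* Before the clock is exhausted, [tau w] is below r exactly when the clock has reached t at some
     rational time below r. *)
  have -> : tau @^-1` `]-oo, r[ = [set w | ~~ (t%:E < I w)%E] `|` \bigcup_(p : rat)
      [set w | (0 <= (ratr p : R) < r) && (t%:E <= lamperti_clock beta (y w) `[0%R, (ratr p : R)])%E].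
    apply/seteqP; split=> w /=; rewrite in_itv/= /tau.
    case: ifP => tI taur; [right|by left].
    have [p] := rat_in_itvoo taur; rewrite in_itv/= => /andP[p1 p2].
    exists p => //=; rewrite p2 (le_trans _ (ltW p1)) ?lamperti_tau_ge0//=.
    by apply: lamperti_tau_lt => //; exact: rxi.
    case=> [/negPf ->//|[p _ /andP[/andP[p0 pr] tC]]].
    case: ifP => // _; apply: le_lt_trans pr; rewrite leNgt; apply/negP.
    by move=> /(lamperti_tau_gt p0); rewrite ltNge tC.
  apply: measurableU.
    rewrite -[X in measurable X]setTI.
    by apply: (measurable_neg mtI measurableT (Y := [set true])).
  apply: bigcupT_measurable_rat => p; case: (0 <= (ratr p : R) < r) => /=; last first.
    by rewrite (_ : [set _ | _] = set0); [exact: measurable0|apply/seteqP; split].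
  rewrite -[X in measurable X]setTI.
  by apply: emeasurable_fun_c_infty.
rewrite (_ : (fun w => _) = fun w => if (t%:E < I w)%E then
    (if ((tau w)%:E < e w)%E then expR (xi `|tau w| w) else 0) else 0).
  apply: measurable_fun_ifT => //; apply: measurable_fun_ifT => //.
    by apply: measurable_fun_lte => //; exact/measurable_EFinP.
  apply: measurableT_comp; first exact: measurable_expR.
  have := measurable_right_continuous mxi rxi.
  move=> /(measurableT_comp (g := fun w => (tau w, w))); apply.
  exact: measurable_fun_pair.
apply/funext => w; rewrite /lamperti /tau /killed_path -/(I w).
by case: ifP => // _; rewrite ger0_norm ?lamperti_tau_ge0//; case: ifP.
Qed.

End measurable_lamperti.

(** * Absorption time and moments of the clock *)

Section absorption.
Variable R : realType.
Implicit Types z : R -> R.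

(* The infimum of the rational times at which the path vanishes: a measurable upper
   bound of the lifetime. *)
Definition absorption z : \bar R :=
  ereal_inf (range (fun p : rat =>
    if (0 <= ratr p :> R) && (z (ratr p) == 0) then (ratr p)%:E else +oo%E)).

Lemma absorption_ge0 z : (0 <= absorption z)%E.
Proof.
apply: le_ereal_inf_tmp => _ [p _ <-]; case: ifP => // /andP[p0 _].
by rewrite lee_fin.
Qed.

Lemma lifetime_le_absorption z : (lifetime z <= absorption z)%E.
Proof.
apply: le_ereal_inf_tmp => _ [p _ <-]; case: ifP => [/andP[p0 /eqP zp]|_]; last exact: leey.
by apply: ereal_inf_lbound; exists (ratr p).
Qed.

Lemma absorption_le z (a : \bar R) : (0 <= a)%E ->
  (forall t : R, 0 <= t -> (a < t%:E)%E -> z t = 0) -> (absorption z <= a)%E.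
Proof.
case: a => [a a0 za|_ _|//]; last exact: leey.
apply/lee_addgt0Pr => eps eps0.
have [p] := @rat_in_itvoo R a (a + eps) ltac:(by rewrite ltrDl).
rewrite in_itv/= => /andP[ap pe].
apply: (@le_trans _ _ (ratr p : R)%:E); last by rewrite -EFinD lee_fin ltW.
apply: ereal_inf_lbound; exists p => //.
have p0 : 0 <= ratr p :> R by rewrite (le_trans _ (ltW ap)).
by rewrite p0 za ?eqxx// lte_fin.
Qed.

Lemma measurable_absorption : measurable_fun setT (absorption : path_space R -> \bar R).
Proof.
pose f (p : rat) (z : path_space R) : \bar R :=
  (- (if (0 <= ratr p :> R)%R && (z (ratr p) == 0)%R then (ratr p)%:E else +oo))%E.
rewrite (_ : (absorption : path_space R -> _) = (fun z => - ereal_sup (range (f ^~ z)))%E).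
  apply: measurableT_comp; first exact: oppe_measurable.
  apply: (@measurable_ereal_sup_rat _ _ (path_space R)) => p.
  apply: measurableT_comp; first exact: oppe_measurable.
  case: (leP 0 (ratr p)) => /= [p0|_]; last exact: measurable_cst.
  apply: measurable_fun_ifT => //.
  by apply: measurable_fun_eqr => //; exact: measurable_eval.
apply/funext => z; rewrite /absorption /ereal_inf; congr (- ereal_sup _)%E.
apply/seteqP; split=> [_ /= [_ [p _ <-] <-]|_ [p _ <-]]; first by exists p.
by eexists; [exists p|].
Qed.

End absorption.

Section clock_moment.
Context (R : realType) (d' : measure_display) (T' : measurableType d').
Context (P : probability T' R) (k b sigma2 : R) (nu : {measure set R -> \bar R}).
Context (xi : R -> T' -> R) (e : T' -> \bar R).
Hypothesis Y : killed_levy_process P k b sigma2 nu xi e.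
Variables (q psi : R).
Hypotheses (q0 : 0 < q) (psiE : levy_psi k b sigma2 nu q = psi%:E) (psi0 : psi < 0).

Let mxi t : 0 <= t -> measurable_fun setT (xi t).
Proof. exact: levy_measurable (klevy_levy Y) t. Qed.

Let rxi w t : 0 <= t -> xi ^~ w @ t^'+ --> xi t w.
Proof. exact: (levy_cadlag (klevy_levy Y) w).1. Qed.

Let me := klevy_measurable Y.

Local Notation dens s w := (clock_density q (xi ^~ w) (e w) s).

Lemma integral_density_dyadic n m :
  (\int[P]_w (dens (m%:R / 2 ^+ n) w)%:E = (expR (psi * (m%:R / 2 ^+ n)))%:E)%E.
Proof.
pose h : R := (2 ^+ n)^-1.
have hN : h = (2 ^ n).-1.+1%:R^-1 by rewrite prednK ?expn_gt0// natrX.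
have h0 : 0 <= h by rewrite invr_ge0 exprn_ge0.
pose F (z : path_space R) : \bar R := (expR (q * z (m%:R * h)))%:E.
have mF : measurable_fun setT F.
  apply/measurable_EFinP; apply: measurableT_comp; first exact: measurable_expR.
  by apply: measurable_funM => //; apply: measurable_eval; rewrite mulr_ge0.
have := @integral_alive _ _ _ _ _ _ _ _ _ _ Y (m%:R * h) F (mulr_ge0 (ler0n _ _) h0) mF.
rewrite (_ : (\int[P]_w (F (xi ^~ w) * _) = \int[P]_w (dens (m%:R / 2 ^+ n) w)%:E)%E); last first.
  apply: eq_integral => w _; rewrite /clock_density indicE /F.
  case: ifPn => H; first by rewrite mem_set ?mule1.
  by rewrite memNset ?mule0//; exact/negP.
move=> ->; last by move=> z; rewrite lee_fin expR_ge0.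
have := @integral_exp_increment _ _ _ _ _ _ _ _ _ _ Y h q m (cst 1%E) h0.
rewrite (eq_integral (fun w => F (xi ^~ w))); last by move=> w _; rewrite mule1.
move=> /(_ (measurable_cst _) (fun=> lee01)) ->.
have := laplace_xi Y (2 ^ n).-1 (ltW q0) psiE; rewrite -hN => lap.
under eq_bigr do rewrite lap.
have -> : (\int[P]_w cst 1 (xi h w) = 1)%E.
  transitivity (\int[P]_w cst 1%E w)%E; first by [].
  by rewrite integral_cst// mul1e; exact: probability_setT.
rewrite mule1 prodEFin prodr_const card_ord -EFinM -expRM_natr -expRD; congr (expR _)%:E.
by rewrite -/h; ring.
Qed.

(** Dyadic times tend to s from above; right continuity and Fatou's lemma turn the equality at
    dyadic times into an inequality. *)
Lemma integral_density_le s : 0 <= s ->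
  (\int[P]_w (dens s w)%:E <= (expR (psi * s))%:E)%E.
Proof.
move=> s0; pose idx n := (Num.truncn (s * 2 ^+ n)).+1.
pose t n : R := (idx n)%:R / 2 ^+ n.
have pow0 n : 0 < 2 ^+ n :> R by rewrite exprn_gt0.
have y0 n : 0 <= s * 2 ^+ n by rewrite mulr_ge0// exprn_ge0.
have st n : s <= t n.
  by rewrite ler_pdivlMr// ltW//; have /andP[] := truncn_itv (y0 n).
have ts : t n @[n --> \oo] --> s.
  apply: (@squeeze_cvgr _ _ _ _ (cst s) (fun n => s + (2 ^+ n)^-1)).
  - apply: nearW => n; have /andP[h1 h2] := truncn_itv (y0 n).
    rewrite st /t /idx -natr1 mulrDl mul1r lerD2r ler_pdivrMr//.
  - exact: cvg_cst.
  - by rewrite -[X in _ --> X]addr0; apply: cvgD; [exact: cvg_cst|exact: cvg_exp2V].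
have mdens u : 0 <= u -> measurable_fun setT (fun w => (dens u w)%:E).
  move=> u0; apply/measurable_EFinP; have := measurable_clock_density q mxi me rxi.
  by move=> /(measurable_fun_pair2 u); rewrite /= ger0_norm.
apply: (@le_trans _ _ (\int[P]_w limn_einf (fun n => (dens (t n) w)%:E))%E).
  apply: ge0_le_integral => //.
  - by move=> w _; rewrite lee_fin clock_density_ge0.
  - exact: mdens.
  - apply: measurable_limn_einf => n; apply: mdens; exact: le_trans (st n).
  - move=> w _; rewrite /clock_density; case: ifPn => [se|_]; last first.
      apply: (@cvg_le_limn_einf _ (cst 0%E)); last exact: cvg_cst.
      by apply: nearW => n; rewrite lee_fin; case: ifP => // _; exact: expR_ge0.
    have xt : xi (t n) w @[n --> \oo] --> xi s w.
      by apply: (@cvg_right_seq _ (xi ^~ w)); [exact: rxi|exact: st|exact: ts].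
    apply: (@cvg_le_limn_einf _ (fun n => (expR (q * xi (t n) w))%:E)); last first.
      apply: cvg_EFin; first exact: nearW.
      apply: (cvg_comp (fun n => q * xi (t n) w) expR); last exact: continuous_expR.
      by apply: cvgM => //; exact: cvg_cst.
    have := cvg_lt_ereal ts se.
    by apply: filterS => n ->.
apply: le_trans (fatou _ _ _ _) _ => //.
- by move=> n; apply: mdens; exact: le_trans (st n).
- by move=> n w _; rewrite lee_fin clock_density_ge0.
apply: (@limn_einf_le_cvg _ _ (fun n => (expR (psi * t n))%:E)).
  by apply: nearW => n; rewrite /t integral_density_dyadic.
apply: cvg_EFin; first exact: nearW.
apply: (cvg_comp (fun n => psi * t n) expR); last exact: continuous_expR.
by apply: cvgM => //; exact: cvg_cst.
Qed.

Lemma integral_expR_half_line (a : R) : 0 < a ->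
  (\int[lebesgue_measure]_(s in `[0%R, +oo[) (expR (- (a * s)))%:E = (a^-1)%:E)%E.
Proof.
move=> a0; have a1 : 0 <= a := ltW a0.
have h : (a%:E * \int[lebesgue_measure]_(s in `[0%R, +oo[) (expR (- (a * s)))%:E = 1)%E.
  rewrite -ge0_integralZl//=; last first.
    apply/measurable_EFinP; apply: measurable_funTS; apply: measurableT_comp.
      exact: measurable_expR.
    by apply: measurableT_comp => //; exact: measurable_funM.
  rewrite -(integral_exponential_pdf a0) integral_mkcond; apply: eq_integral => s _.
  by rewrite /exponential_pdf !patchE; case: ifP => // _; rewrite -EFinM mulNr.
have := congr1 (fun v => (a^-1)%:E * v)%E h.
by rewrite muleA -EFinM mulVf ?gt_eqF// mul1e mule1.
Qed.

Variables beta p : R.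
Hypotheses (beta0 : 0 < beta) (p_ge1 : 1 <= p) (betap : beta * p = q).

(** With this rate c (p - 1) + psi is negative, which makes the expectation of the tilted integral
    [J] finite. *)
Let c := - psi / (2 * p).

Let p_gt0 : 0 < p.
Proof. exact: lt_le_trans p_ge1. Qed.

Let c_gt0 : 0 < c.
Proof. by rewrite divr_gt0// ?oppr_gt0// mulr_gt0. Qed.

Local Notation I w := (lamperti_clock beta (killed_path (xi ^~ w) (e w)) `[0, +oo[).

Let J w := (\int[lebesgue_measure]_(s in `[0%R, +oo[)
  (expR (c * (p - 1) * s) * dens s w)%:E)%E.

Let f (z : R * T') : \bar R :=
  (\1_(`[0, +oo[ : set R) z.1 * (expR (c * (p - 1) * z.1) * dens `|z.1| z.2))%:E.

Let f_ge0 z : (0 <= f z)%E.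
Proof. by rewrite lee_fin mulr_ge0// mulr_ge0 ?expR_ge0 ?clock_density_ge0. Qed.

Let mf : measurable_fun setT f.
Proof.
apply/measurable_EFinP; apply: measurable_funM.
  by apply: measurableT_comp; [exact: measurable_indic|exact: measurable_fst].
apply: measurable_funM; last exact: measurable_clock_density.
apply: measurableT_comp; first exact: measurable_expR.
by apply: measurable_funM => //; exact: measurable_fst.
Qed.

Let JE w : J w = (\int[lebesgue_measure]_s f (s, w))%E.
Proof.
rewrite /J integral_mkcond; apply: eq_integral => s _.
rewrite patchE /f/= indicE; case: ifPn => [|_]; last by rewrite mul0r.
by rewrite inE/= in_itv/= andbT => s0; rewrite mul1r ger0_norm.
Qed.

Let integral_J : (\int[P]_w J w < +oo)%E.
Proof.
under eq_integral do rewrite JE.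
rewrite -(@fubini_tonelli _ _ _ _ _ lebesgue_measure P f mf f_ge0).
pose a := - (c * (p - 1) + psi).
have a0 : 0 < a.
  have aE (u v : R) : 0 < v -> - u / (2 * v) * (v - 1) + u = u * ((v + 1) / (2 * v)).
    by move=> v0; field; rewrite gt_eqF.
  rewrite /a /c oppr_gt0 aE// nmulr_rlt0// divr_gt0 ?mulr_gt0//.
  by rewrite addr_gt0.
apply: (@le_lt_trans _ _ (a^-1)%:E); last exact: ltry.
rewrite -integral_expR_half_line// [leRHS]integral_mkcond.
apply: le_integral_nonmeasurable => s; first exact: integral_ge0.
rewrite patchE /f/= indicE; case: ifPn => [|_]; last first.
  by rewrite integral0_eq// => w _; rewrite mul0r.
rewrite inE/= in_itv/= andbT => s0.
under eq_integral do rewrite mul1r ger0_norm// EFinM.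
rewrite ge0_integralZl ?lee_fin ?expR_ge0//; last 2 first.
- apply/measurable_EFinP; have := measurable_clock_density q mxi me rxi.
  by move=> /(measurable_fun_pair2 s); rewrite /= ger0_norm.
- by move=> w _; rewrite lee_fin clock_density_ge0.
apply: (@le_trans _ _ ((expR (c * (p - 1) * s))%:E * (expR (psi * s))%:E)%E).
  by apply: lee_wpmul2l; [rewrite lee_fin expR_ge0|exact: integral_density_le].
by rewrite -EFinM lee_fin -expRD ler_expR /a mulNr opprK -mulrDl.
Qed.

(** A linear form of Hölder's inequality. With u = e^(beta xi_s + c s) / mu, one has u <= u^p + 1;
    this is multiplied by mu e^(- c s) and integrated. *)
Let clock_le (mu : R) w : 0 < mu ->
  (I w <= (mu `^ (1 - p))%:E * J w + (mu / c)%:E)%E.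
Proof.
move=> mu0; rewrite lamperti_clockE//.
have mt g := measurable_clock_density_time g mxi me rxi w.
have mD g : measurable_fun setT (fun s : R => clock_density g (xi ^~ w) (e w) `|s|) ->
    measurable_fun (`[0, +oo[ : set R) (fun s => clock_density g (xi ^~ w) (e w) s).
  move=> mg; apply: eq_measurable_fun (measurable_funTS mg) => s.
  by rewrite inE /= in_itv/= andbT => s0; rewrite ger0_norm.
have mexp (u : R) : measurable_fun (`[0, +oo[ : set R) (fun s => expR (u * s)).
  apply: measurable_funTS; apply: measurableT_comp; first exact: measurable_expR.
  exact: measurable_funM.
have mJ : measurable_fun (`[0, +oo[ : set R) (fun s => (expR (c * (p - 1) * s) * dens s w)%:E).
  by apply/measurable_EFinP; apply: measurable_funM => //; apply: mD; exact: mt.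
have J0 s : (0 <= (expR (c * (p - 1) * s) * dens s w)%:E)%E.
  by rewrite lee_fin mulr_ge0 ?expR_ge0 ?clock_density_ge0.
have mexp' : measurable_fun (`[0, +oo[ : set R) (fun s => (expR (- (c * s)))%:E).
  apply/measurable_EFinP; apply: eq_measurable_fun (mexp (- c)) => s _.
  by rewrite mulNr.
rewrite EFinM -integral_expR_half_line// -!ge0_integralZl ?lee_fin ?powR_ge0 ?(ltW mu0)//.
rewrite -ge0_integralD//; last first.
- exact: emeasurable_funM.
- by move=> s _; rewrite -EFinM lee_fin mulr_ge0 ?expR_ge0// ltW.
- exact: emeasurable_funM.
- by move=> s _; rewrite mule_ge0// lee_fin powR_ge0.
apply: ge0_le_integral => //.
- by move=> s _; rewrite lee_fin clock_density_ge0.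
- by apply/measurable_EFinP; apply: mD; exact: mt.
- apply: emeasurable_funD; first exact: emeasurable_funM.
  exact: emeasurable_funM.
move=> s _; rewrite -!EFinM -EFinD lee_fin /clock_density.
case: ifP => _; last by rewrite !mulr0 add0r mulr_ge0 ?expR_ge0// ltW.
have [m -> {mu mu0}] : exists m, mu = expR m by exists (ln mu); rewrite lnK.
pose u := expR (beta * xi s w + c * s - m).
have up : u <= u `^ p + 1.
  have [u1|u1] := leP u 1; first by rewrite (le_trans u1)// lerDr powR_ge0.
  by rewrite (@le_trans _ _ (u `^ p)) ?lerDl// le1r_powR// ltW.
have : expR m * expR (- (c * s)) * u <= expR m * expR (- (c * s)) * (u `^ p + 1).
  by rewrite ler_pM2l// mulr_gt0 ?expR_gt0.
rewrite mulrDr mulr1 -!expRM -!expRD -betap.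
rewrite (_ : m - c * s + (_ - m) = beta * xi s w); last by ring.
move=> /le_trans; apply; rewrite lerD2r.
by rewrite (_ : _ + _ * p = m * (1 - p) + (c * (p - 1) * s + beta * p * xi s w))//; ring.
Qed.

Lemma integral_clock_power : (\int[P]_w poweR (I w) p < +oo)%E.
Proof.
pose K := (1 + c^-1) `^ p.
have mJ : measurable_fun setT J.
  rewrite (_ : J = fun w => (\int[lebesgue_measure]_s f (s, w))%E); last exact/funext.
  exact: measurable_fun_fubini_tonelli_G.
apply: (@le_lt_trans _ _ (\int[P]_w (K%:E * (J w + 1)))%E).
  apply: le_integral_nonmeasurable => w; first exact: poweR_ge0.
  have : (0 <= J w)%E.
    apply: integral_ge0 => s _.
    by rewrite lee_fin mulr_ge0 ?expR_ge0 ?clock_density_ge0.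
  case E : (J w) => [j||//]; last by rewrite addye// gt0_muley ?leey// lte_fin powR_gt0// addr_gt0// invr_gt0.
  rewrite lee_fin => j0.
  (* With mu^p = J + 1, the first term of [clock_le] is at most mu, so the clock is at most mu (1 +
     1 / c). Adding 1 keeps mu positive when J vanishes. *)
  pose mu := (j + 1) `^ p^-1.
  have j1 : 0 < j + 1 by lra.
  have mu0 : 0 < mu by exact: powR_gt0.
  have mup : mu `^ p = j + 1 by rewrite -powRrM mulVf ?(gt_eqF p_gt0)// powRr1// ltW.
  have Ile : (I w <= (mu * (1 + c^-1))%:E)%E.
    apply: le_trans (clock_le w mu0) _; rewrite E -EFinM -EFinD lee_fin.
    rewrite mulrDr mulr1 lerD2r powRB ?(gt_eqF mu0) ?implybT// powRr1 ?(ltW mu0)//.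
    by rewrite mup -mulrA ger_pMr// mulrC ler_pdivrMr// mul1r lerDl.
  have := @gt0_ler_poweR _ p (ltW p_gt0) (I w) (mu * (1 + c^-1))%:E.
  rewrite !in_itv/= !leey !andbT lee_fin mulr_ge0 ?addr_ge0 ?invr_ge0 ?(ltW mu0) ?(ltW c_gt0)//.
  have I0 : (0 <= I w)%E by apply: integral_ge0 => s _; exact: expeR_ge0.
  move=> /(_ I0 isT Ile) /le_trans; apply.
  by rewrite powRM ?(ltW mu0) ?addr_ge0 ?invr_ge0 ?(ltW c_gt0)// mup -EFinD -EFinM lee_fin mulrC.
rewrite ge0_integralZl ?lee_fin ?powR_ge0//; last 2 first.
- by apply: emeasurable_funD.
- by move=> w _; rewrite adde_ge0// JE integral_ge0.
rewrite ge0_integralD//; last by move=> w _; rewrite JE integral_ge0.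
rewrite integral_cst// mul1e lte_mul_pinfty ?lee_fin ?powR_ge0// lte_add_pinfty ?integral_J//.
by rewrite (le_lt_trans (probability_le1 _ _))// ltry.
Qed.

End clock_moment.

Section lamperti_moments.
Context (R : realType) (d' : measure_display) (T' : measurableType d').
Context (P : probability T' R) (k b sigma2 : R) (nu : {measure set R -> \bar R}).
Context (xi : R -> T' -> R) (e : T' -> \bar R).
Hypotheses (k0 : 0 <= k) (Y : killed_levy_process P k b sigma2 nu xi e).
Hypothesis drift : 0 < k \/ {ae P, forall w, xi t w @[t --> +oo] --> -oo}.
Variables (q psi beta : R).
Hypotheses (q0 : 0 < q) (psiE : levy_psi k b sigma2 nu q = psi%:E) (psi0 : psi < 0).
Hypothesis beta0 : 0 < beta.

Local Notation X w := (lamperti beta (killed_path (xi ^~ w) (e w))).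

Lemma killed_or_drifts :
  {ae P, forall w, (e w < +oo)%E \/ xi t w @[t --> +oo] --> -oo}.
Proof.
case: drift => [kgt0|]; last by apply: filterS => w; right.
suff : {ae P, forall w, (e w < +oo)%E} by apply: filterS => w; left.
exists [set w | e w = +oo%E]; split.
- rewrite (_ : [set w | _] = e @^-1` [set +oo%E])//.
  rewrite -(setTI (e @^-1` _)); apply: (klevy_measurable Y) => //.
- apply/eqP; rewrite eq_le measure_ge0 andbT.
  have cv : (expR (- k * n%:R))%:E @[n --> \oo] --> (0%E : \bar R).
    apply: cvg_EFin; first exact: nearW.
    rewrite (_ : _ \o _ = GRing.exp (expR (- k))); last first.
      by apply/funext => n /=; rewrite expRM_natr.
    apply: cvg_expr; rewrite ger0_norm ?expR_ge0//.
    by rewrite -[ltRHS]expR0 ltr_expR oppr_lt0.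
  apply: cvge_to_ge cv _; apply: nearW => n.
  rewrite -(klevy_exponential Y (ler0n _ n)); apply: le_measure.
  + rewrite inE -(setTI [set w | _]).
    exact: (klevy_measurable Y measurableT (Y := [set +oo%E])).
  + by rewrite inE; exact: (measurable_alive Y).
  + by move=> w /= ->; exact: ltry.
- by move=> w /=; rewrite ltey => /negP; rewrite negbK => /eqP.
Qed.

Lemma integral_big_drops_lamperti J (G : R) :
  (\int[nu]_y (loss q y)%:E = G%:E)%E ->
  (\int[P]_w (\sum_(j < J) poweR (big_drop (X w) j) q) <= (G / - psi)%:E)%E.
Proof.
move=> GE; apply: le_trans (integral_total_loss k0 Y q0 psiE psi0 GE).
apply: ae_le_integral_nonmeasurable.
- by move=> w; apply: sume_ge0 => j _; exact: poweR_ge0.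
- move=> w; apply: (@cvg_le_limn_einf _ (cst 0%E)); last exact: cvg_cst.
  apply: nearW => m; apply: (@cvg_le_limn_einf _ (cst 0%E)); last exact: cvg_cst.
  apply: nearW => n; rewrite lee_fin sumr_ge0// => i _; exact: grid_loss_term_ge0.
- apply: measurable_limn_einf => m; apply: measurable_limn_einf => n.
  apply/measurable_EFinP; apply: measurable_sum => i.
  exact: (measurable_grid_loss_term Y).
- apply: filterS killed_or_drifts => w hw.
  apply: lamperti_big_drops_le => //; exact: levy_cadlag (klevy_levy Y) w.
Qed.

Lemma integral_absorption_lamperti (p : R) : 1 <= p -> beta * p = q ->
  (\int[P]_w poweR (absorption (X w)) p < +oo)%E.
Proof.
move=> p1 betap.
apply: le_lt_trans (integral_clock_power Y q0 psiE psi0 beta0 p1 betap).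
apply: le_integral_nonmeasurable => w; first exact: poweR_ge0.
have I0 : (0 <= lamperti_clock beta (killed_path (xi ^~ w) (e w)) `[0%R, +oo[)%E.
  by apply: integral_ge0 => s _; exact: expeR_ge0.
apply: gt0_ler_poweR; rewrite ?in_itv/= ?leey ?andbT ?absorption_ge0//.
  by rewrite (le_trans ler01).
by apply: absorption_le => // t _; rewrite /lamperti => /ltW; rewrite leNgt => /negPf ->.
Qed.

End lamperti_moments.

(** * Cells and genealogical trees *)

Section jumps_and_drops.
Variable R : realType.
Implicit Types (z : R -> R) (p t : R).

Lemma lifetime_neq0 z t : 0 <= t -> (t%:E < lifetime z)%E -> z t != 0.
Proof.
move=> t0; apply: contraTneq => zt; rewrite -leNgt.
by apply: ereal_inf_lbound; exists t.
Qed.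

(** The converse direction to [lamperti_drop_jump], for an arbitrary càdlàg path. The value at the
    right end of the cell is nonzero because this end is eventually before the lifetime. *)
Lemma neg_jumps_eventual_drops z r (s : seq R) j : cadlag z -> uniq s -> (j < size s)%N ->
  (forall t, t \in s -> [/\ 0 < t, (t%:E < lifetime z)%E & r < neg_jump_size z t]) ->
  eventual_drops z r j.
Proof.
move=> [zr zl] us js sP.
have s0 t : t \in s -> 0 < t by move=> /sP[].
have [idx [cell locvg hicvg inj small]] := grid_cells us s0.
suff : \forall n \near \oo, forall t, t \in s ->
    r < z ((idx t n)%:R / 2 ^+ n) - z ((idx t n).+1%:R / 2 ^+ n) /\
    z ((idx t n).+1%:R / 2 ^+ n) != 0.
  move=> H; have : \forall n \near \oo, (j < #|drop_indices z r n|)%N.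
    near=> n; apply: (leq_trans js).
    have -> : #|drop_indices z r n| = size (map val (enum (drop_indices z r n))).
      by rewrite size_map -cardE.
    rewrite -(size_map (idx ^~ n)); apply: uniq_leq_size; first by near: n.
    move=> i /mapP[t ts ->].
    have tn : (idx t n < 4 ^ n)%N by move: t ts; near: n; exact: small.
    apply/mapP; exists (Ordinal tn) => //; rewrite mem_enum inE/=.
    have [-> ->//] : r < z ((idx t n)%:R / 2 ^+ n) - z ((idx t n).+1%:R / 2 ^+ n) /\
      z ((idx t n).+1%:R / 2 ^+ n) != 0 by move: t ts {tn}; near: n.
  by move=> [N _ h]; exists N.
suff H (s' : seq R) : {subset s' <= s} -> \forall n \near \oo, forall t, t \in s' ->
    r < z ((idx t n)%:R / 2 ^+ n) - z ((idx t n).+1%:R / 2 ^+ n) /\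
    z ((idx t n).+1%:R / 2 ^+ n) != 0 by exact: H.
elim: s' => [|t s' IH] ss; first exact: nearW.
have ts : t \in s by apply: ss; exact: mem_head.
have [t0 tl rt] := sP t ts.
have zlo : z ((idx t n)%:R / 2 ^+ n) @[n --> \oo] --> lim (z @ t^'-).
  by apply: cvg_left_seq => [|n|]; [exact: zl|case/andP: (cell t n ts)|exact: locvg].
have zhi : z ((idx t n).+1%:R / 2 ^+ n) @[n --> \oo] --> z t.
  by apply: cvg_right_seq => [|n|]; [apply: zr; exact: ltW|case/andP: (cell t n ts)|exact: hicvg].
have zd := cvgB zlo zhi.
near=> n => t'; rewrite inE => /predU1P[->|t's'].
  split; first by near: n; exact: (cvgr_gt _ (zd _) _ rt).
  apply: lifetime_neq0; first by rewrite divr_ge0// exprn_ge0.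
  by near: n; exact: cvg_lt_ereal (hicvg t ts) tl.
move: t' t's'; near: n; apply: IH => t' t's'; apply: ss.
by rewrite inE t's' orbT.
Unshelve. all: by end_near.
Qed.

Lemma jump_rank_times z j t : is_jump_rank z j t -> exists s : seq R,
  [/\ uniq s, size s = j.+1 & forall u, u \in s -> neg_jump_times z u /\
      neg_jump_size z t <= neg_jump_size z u].
Proof.
move=> [zt card_lt].
move: card_lt; rewrite card_eq_sym => /card_set_bijP[f [fS finj _]].
exists (t :: map f (iota 0 j)); split.
- rewrite /= map_inj_in_uniq ?iota_uniq ?andbT.
    apply/mapP => -[i]; rewrite mem_iota/= => ij tE.
    by have [_] := fS i ij; rewrite -tE => -[|[_]]; rewrite ltxx.
  by move=> i i'; rewrite !mem_iota/= => ij i'j; apply: finj; rewrite inE.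
- by rewrite /= size_map size_iota.
- move=> u; rewrite inE => /predU1P[->|/mapP[i]]; first by split.
  rewrite mem_iota/= => ij ->; have [zi ub] := fS i ij.
  by split=> //; case: ub => [/ltW//|[-> _]].
Qed.

Lemma rescaled1 beta z : rescaled beta 1 z = z.
Proof. by apply/funext => t; rewrite /rescaled powR1 !mul1r. Qed.

Lemma lifetime_ge0 z : (0 <= lifetime z)%E.
Proof. by apply: le_ereal_inf_tmp => _ [t [t0 _] <-]; rewrite lee_fin. Qed.

Lemma lifetime_rescaled_le beta p z : 0 < p ->
  (lifetime (rescaled beta p z) <= (p `^ beta)%:E * lifetime z)%E.
Proof.
move=> p0; rewrite -lee_pdivrMl ?powR_gt0//.
apply: le_ereal_inf_tmp => _ [t [t0 zt] <-]; rewrite lee_pdivrMl ?powR_gt0//.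
apply: ereal_inf_lbound; exists (p `^ beta * t) => //; split.
  by rewrite mulr_ge0// powR_ge0.
rewrite /rescaled mulrA -powRD ?addNr ?eqxx ?gt_eqF ?implybT//.
by rewrite powRr0 mul1r zt mulr0.
Qed.

Lemma lim_rescaled beta p z t : 0 < p -> 0 < t -> cadlag z ->
  lim (rescaled beta p z @ t^'-) = p * lim (z @ (p `^ (- beta) * t)^'-).
Proof.
move=> p0 t0 [_ zl]; have c0 : 0 < p `^ (- beta) by exact: powR_gt0.
apply: cvg_lim => //; apply: cvgM; first exact: cvg_cst.
apply/cvg_at_leftP => u [ut uct].
apply: cvg_left_seq; first by apply: zl; exact: mulr_gt0.
- by move=> n; rewrite ltr_pM2l.
- by apply: cvgM => //; exact: cvg_cst.
Qed.

(** A jump of rank j comes with j others at least as large, hence with j + 1 drops above every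
    smaller level. Rescaling moves their times by a common factor, and [big_drop] counts drops
    wherever they occur. *)
Lemma jump_size_rescaled_le beta p z j : 0 <= p -> cadlag z ->
  ((jump_size (rescaled beta p z) j)%:E <= p%:E * big_drop z j)%E.
Proof.
(* For p = 0 the rescaled path is identically 0: its lifetime is 0 and it has no jump. *)
rewrite le_eqVlt => /predU1P[<- _|p0 cz].
  rewrite mul0e /jump_size; case: asboolP => // -[t [[t0 tl _] _]].
  move: tl; rewrite (_ : lifetime _ = 0%E) ?lte_fin ?ltNge ?(ltW t0)//.
  apply/eqP; rewrite eq_le lifetime_ge0 andbT; apply: ereal_inf_lbound.
  by exists 0 => //; split=> //; rewrite /rescaled mul0r.
rewrite /jump_size; case: asboolP => [ex|_]; last first.
  by rewrite mule_ge0 ?lee_fin ?(ltW p0)// big_drop_ge0.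
have rk : is_jump_rank (rescaled beta p z) j (jump_time (rescaled beta p z) j).
  by rewrite /jump_time; case: ex => t ht; exact: (xgetI 0 ht).
set t := jump_time _ _ in rk *.
pose c := p `^ (- beta); have c0 : 0 < c by exact: powR_gt0.
have sizeE u : 0 < u -> neg_jump_size (rescaled beta p z) u = p * neg_jump_size z (c * u).
  by move=> u0; rewrite /neg_jump_size lim_rescaled// /rescaled mulrBr.
have [[t0 _ tpos] _] := rk.
have [s [us ss sP]] := jump_rank_times rk.
rewrite sizeE// EFinM; apply: lee_wpmul2l; first by rewrite lee_fin ltW.
apply: big_drop_ge; first by move: tpos; rewrite sizeE// pmulr_rgt0.
move=> r /andP[r0 rt].
apply: (@neg_jumps_eventual_drops _ _ (map (fun u => c * u) s)) => //.
- by rewrite map_inj_uniq// => u v; apply: mulfI; rewrite gt_eqF.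
- by rewrite size_map ss.
move=> _ /mapP[u /sP[[u0 ul upos] tu] ->]; split.
- exact: mulr_gt0.
- have := lt_le_trans ul (lifetime_rescaled_le beta z p0).
  rewrite -lte_pdivrMl ?powR_gt0// -EFinM.
  by rewrite /c powRN.
- by move: tu; rewrite !sizeE// ler_pM2l//; exact: lt_le_trans.
Qed.

Lemma jump_time_bounds z j : 0 <= jump_time z j /\ ((jump_time z j)%:E <= lifetime z)%E.
Proof.
rewrite /jump_time; case: xgetP => [t _ [[t0 tl _] _]|_]; first by split; exact: ltW.
by split; [exact: lexx|exact: lifetime_ge0].
Qed.

End jumps_and_drops.

Section cell_bounds.
Context (R : realType) (beta : R) (Z : seq nat -> R -> R).
Implicit Types u v : seq nat.

(** In the word i :: u', [belast i u'] is the parent and [last i u'] the rank of the jump at which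
    the individual is born. *)
Definition cell_size u : R :=
  if u is i :: u' then jump_size (cell beta Z (belast i u')) (last i u') else 1.

(** Unlike the size of the cell, this bound is a product of functionals of the unscaled, independent
    paths of the ancestors. *)
Definition drop_product u : \bar R :=
  (\prod_(i < size u) big_drop (Z (take i u)) (nth 0%N u i))%E.

Lemma cell_size_rcons u j : cell_size (rcons u j) = jump_size (cell beta Z u) j.
Proof. by case: u => [|i u] //=; rewrite belast_rcons last_rcons. Qed.

Lemma cell_rescaled u : cell beta Z u = rescaled beta (cell_size u) (Z u).
Proof.
case: (lastP u) => [|v j]; first by rewrite rescaled1.
by rewrite cell_rcons cell_size_rcons.
Qed.

Lemma drop_product_ge0 u : (0 <= drop_product u)%E.
Proof. by apply: prode_ge0 => i _; exact: big_drop_ge0. Qed.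

Lemma drop_product_rcons u j :
  drop_product (rcons u j) = (drop_product u * big_drop (Z u) j)%E.
Proof.
rewrite /drop_product size_rcons big_ord_recr/= nth_rcons ltnn eqxx.
rewrite -cats1 take_size_cat//; congr (_ * _)%E; apply: eq_bigr => i _.
by rewrite takel_cat ?(ltnW (ltn_ord i))// nth_cat ltn_ord.
Qed.

Lemma jump_size_ge0 (z : R -> R) j : 0 <= jump_size z j.
Proof.
rewrite /jump_size; case: asboolP => // -[t ht].
have [[_ _ h] _] : is_jump_rank z j (jump_time z j) by exact: (xgetI 0 ht).
exact: ltW.
Qed.

Lemma cell_size_ge0 u : 0 <= cell_size u.
Proof. by case: u => // i u; exact: jump_size_ge0. Qed.

Hypothesis cZ : forall u, cadlag (Z u).

Lemma cell_size_le u : ((cell_size u)%:E <= drop_product u)%E.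
Proof.
elim/last_ind: u => [|u j IH]; first by rewrite /drop_product big_ord0.
rewrite cell_size_rcons cell_rescaled drop_product_rcons.
apply: le_trans (jump_size_rescaled_le beta j (cell_size_ge0 u) (cZ u)) _.
by apply: lee_wpmul2r => //; exact: big_drop_ge0.
Qed.

(** The relation beta p = q makes the power p of the time scale s^beta equal to s^q, the power in
    which the jumps are summed. *)
Lemma lifetime_cell_power (p q : R) u : 0 < p -> beta * p = q -> 0 < q ->
  (poweR (lifetime (cell beta Z u)) p <=
   poweR (drop_product u) q * poweR (absorption (Z u)) p)%E.
Proof.
move=> p0 betap q0; rewrite cell_rescaled.
have := cell_size_ge0 u; rewrite le_eqVlt => /predU1P[s0|s0].
  rewrite -s0 (_ : lifetime _ = 0%E) ?poweR0r ?gt_eqF ?mule_ge0 ?poweR_ge0//.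
  apply/eqP; rewrite eq_le lifetime_ge0 andbT; apply: ereal_inf_lbound.
  by exists 0 => //; split=> //; rewrite /rescaled mul0r.
have lA : (lifetime (rescaled beta (cell_size u) (Z u)) <=
    ((cell_size u) `^ beta)%:E * absorption (Z u))%E.
  apply: le_trans (lifetime_rescaled_le beta (Z u) s0) _.
  by apply: lee_wpmul2l; [rewrite lee_fin powR_ge0|exact: lifetime_le_absorption].
apply: (@le_trans _ _ (poweR (((cell_size u) `^ beta)%:E * absorption (Z u)) p)).
  apply: gt0_ler_poweR lA; rewrite ?(ltW p0)// in_itv/= leey andbT ?lifetime_ge0//.
  by rewrite mule_ge0 ?lee_fin ?powR_ge0 ?absorption_ge0.
rewrite poweRM ?lee_fin ?powR_ge0 ?absorption_ge0//.
apply: lee_wpmul2r; first exact: poweR_ge0.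
rewrite poweR_EFin -powRrM betap -poweR_EFin.
apply: gt0_ler_poweR (cell_size_le u); rewrite ?(ltW q0)// in_itv/= leey andbT.
  by rewrite lee_fin ltW.
exact: drop_product_ge0.
Qed.

End cell_bounds.

Section tree_height_bounds.
Context (R : realType) (beta : R) (Z : seq nat -> R -> R).
Implicit Types u v : seq nat.

Definition line_lifetime u : \bar R :=
  (\sum_(i < (size u).+1) lifetime (cell beta Z (take i u)))%E.

(** The path from the root enters the last interval at its attachment point, whose position is at
    most the lifetime of the parent, so the induction applies there. *)
Lemma genealogical_dist_root_le n u (x : R) : (size u <= n)%N -> 0 <= x ->
  (x%:E <= lifetime (cell beta Z u))%E ->
  ((genealogical_dist beta Z n ([::], 0) (u, x))%:E <= line_lifetime u)%E.
Proof.
elim: n u x => [|n IH] u x un x0 xl.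
  move: un xl; rewrite leqn0 => /nilP -> xl /=.
  by rewrite sub0r normrN ger0_norm// /line_lifetime big_ord1.
rewrite /= eq_sym; case: eqP => [un1|/eqP un1] /=; last first.
  rewrite addr0 add0r; apply: IH => //.
  by rewrite -ltnS ltn_neqAle un andbT eq_sym.
rewrite add0r EFinD /attachment_point -un1/=.
have [jt0 jtl] := jump_time_bounds (cell beta Z (take n u)) (last 0%N u).
have tn : size (take n u) = n by rewrite size_takel// -un1.
apply: (@le_trans _ _ (line_lifetime (take n u) + lifetime (cell beta Z u))%E).
  by apply: leeD => //; apply: IH => //; rewrite tn.
rewrite /line_lifetime tn -un1 [leRHS]big_ord_recr/= un1 take_size.
rewrite leeD2r// le_eqVlt; apply/orP; left; apply/eqP/eq_bigr => i _.
by rewrite take_takel// -ltnS un1.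
Qed.

Lemma genealogical_height_le n H : (forall u, line_lifetime u <= H)%E ->
  (tree_height (genealogical_tree beta Z n) <= H)%E.
Proof.
move=> uH; apply: ge_ereal_sup => _ [[[u x] [/= un x0 xl]] _ <-].
exact: le_trans (genealogical_dist_root_le un x0 xl) (uH u).
Qed.

(** In a common space, one eps accounts for the distance of the roots and one for the distance from
    a point of Y to some point of X. *)
Lemma tree_height_gromov_hausdorff (X Y : rooted_space R) (H : \bar R) (eps : R) :
  (tree_height X <= H)%E -> (gromov_hausdorff_dist X Y < eps%:E)%E ->
  (tree_height Y <= H + (2 * eps)%:E)%E.
Proof.
move=> XH /ereal_inf_lt[_ [S [f [g [pf pg ->]]]]].
rewrite gt_max lte_fin => /andP[hfg rfg].
apply: ge_ereal_sup => _ [y _ <-].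
have : (ereal_inf [set (mdist a (g y))%:E | a in range f] < eps%:E)%E.
  apply: le_lt_trans hfg; rewrite le_max; apply/orP; right.
  by apply: ereal_sup_ubound; exists (g y) => //; exists y.
move=> /ereal_inf_lt[_ [_ [x _ <-] <-]]; rewrite lte_fin => fxy.
have hx : ((rdist (rroot X) x)%:E <= H)%E.
  by apply: le_trans XH; apply: ereal_sup_ubound; exists x.
have tri := metric_triangle (g (rroot Y)) (f (rroot X)) (g y).
have tri2 := metric_triangle (f (rroot X)) (f x) (g y).
rewrite metric_sym in rfg.
apply: (@le_trans _ _ ((rdist (rroot X) x)%:E + (2 * eps)%:E)%E); last exact: leeD2r.
by rewrite -EFinD lee_fin -pg -pf; lra.
Qed.

Lemma limit_height_le (X : nat -> rooted_space R) (Y : rooted_space R) (H : \bar R) :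
  (forall n, tree_height (X n) <= H)%E ->
  gromov_hausdorff_dist (X n) Y @[n --> \oo] --> 0%E -> (tree_height Y <= H)%E.
Proof.
move=> XH XY; apply/lee_addgt0Pr => eps eps0.
have e2 : 0 < eps / 2 by rewrite divr_gt0.
have : \forall n \near \oo, (gromov_hausdorff_dist (X n) Y < (eps / 2)%:E)%E.
  apply: (XY (fun r => r < (eps / 2)%:E)%E).
  by apply: open_ereal_lt'; rewrite lte_fin.
move=> [N _ /(_ N (leqnn N))] /(tree_height_gromov_hausdorff (XH N)).
by rewrite mulrC divfK.
Qed.

(** Taking p-th roots, the lifetime in generation m is at most lam^m V^(1/p), and the geometric
    series sums to (1 - lam)^-1. *)
Lemma line_lifetime_le (lam p : R) (V : \bar R) u : 0 < lam < 1 -> 0 < p -> (0 <= V)%E ->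
  (forall v, poweR (lifetime (cell beta Z v)) p <= ((lam `^ p) ^+ size v)%:E * V)%E ->
  (line_lifetime u <= ((1 - lam)^-1)%:E * poweR V p^-1)%E.
Proof.
move=> /andP[lam0 lam1] p0 V0 h.
have pV : 0 <= p^-1 by rewrite invr_ge0 ltW.
have hl v : (lifetime (cell beta Z v) <= (lam ^+ size v)%:E * poweR V p^-1)%E.
  have l0 := lifetime_ge0 (cell beta Z v).
  rewrite -[leLHS]poweRe1// -(@mulfV _ p) ?gt_eqF// poweRrM.
  have -> : lam ^+ size v = ((lam `^ p) ^+ size v) `^ p^-1.
    rewrite -(powR_mulrn (size v) (powR_ge0 lam p)) -!powRrM.
    by rewrite -(powR_mulrn (size v) (ltW lam0)) mulrCA mulfV ?gt_eqF// mulr1.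
  rewrite -poweR_EFin -poweRM ?lee_fin ?exprn_ge0 ?powR_ge0//.
  apply: gt0_ler_poweR (h v); rewrite // in_itv/= leey andbT ?poweR_ge0//.
  by rewrite mule_ge0// lee_fin exprn_ge0// powR_ge0.
apply: (@le_trans _ _ (\sum_(i < (size u).+1) (lam ^+ i)%:E * poweR V p^-1)%E).
  apply: lee_sum => i _; have := hl (take i u).
  by rewrite size_takel// -ltnS.
rewrite -ge0_sume_distrl; last by move=> i _; rewrite lee_fin exprn_ge0// ltW.
apply: lee_wpmul2r; first exact: poweR_ge0.
rewrite sumEFin lee_fin -[leRHS]mul1r ler_pdivlMr ?subr_gt0//.
have := subrX1 lam (size u).+1; have := exprn_ge0 (size u).+1 (ltW lam0).
lra.
Qed.

End tree_height_bounds.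

(** * Expected weight of the generations *)

Section expected_generations.
Context (R : realType) (d : measure_display) (T : measurableType d).
Context (P : probability T R) (Z : seq nat -> R -> T -> R) (p q : R).
Hypotheses (mZ : forall u t, 0 <= t -> measurable_fun setT (Z u t))
  (indep : independent_processes P Z).
Implicit Types u v : seq nat.

Local Notation Zw w := (fun u t => Z u t w).

Definition weight u w : \bar R :=
  (poweR (drop_product (Zw w) u) q * poweR (absorption (Zw w u)) p)%E.

Lemma poweR_prod (I : Type) (s : seq I) (F : I -> \bar R) : (forall i, 0 <= F i)%E ->
  (poweR (\prod_(i <- s) F i) q = \prod_(i <- s) poweR (F i) q)%E.
Proof.
move=> F0; elim: s => [|i s IH]; first by rewrite !big_nil poweR1r.
by rewrite !big_cons poweRM ?IH// prode_ge0.
Qed.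

(** The factor that a prefix v of u contributes: a proper prefix brings the drop for the next letter
    of u, and u itself its absorption time. Distinct prefixes carry independent paths, so the
    expectation factorises. *)
Let F u v (z : path_space R) : \bar R :=
  if (size v < size u)%N then poweR (big_drop z (nth 0%N u (size v))) q
  else poweR (absorption z) p.

Let mF u v : measurable_fun setT (F u v).
Proof.
rewrite /F; case: (size v < size u)%N.
  by apply: (measurableT_comp (@measurable_poweR R q)); exact: measurable_big_drop.
by apply: (measurableT_comp (@measurable_poweR R p)); exact: measurable_absorption.
Qed.

Let prefixes u := [seq take i u | i <- iota 0 (size u).+1].

Let prod_prefixes (G : seq nat -> (seq nat -> \bar R)) u :
  (\prod_(v <- prefixes u) G u v = (\prod_(i < size u) G u (take i u)) * G u u)%E.
Proof.
rewrite /prefixes big_map -[X in iota _ X]subn0 -/(index_iota _ _) big_mkord big_ord_recr/=.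
by rewrite take_size.
Qed.

Lemma weight_prod u w : weight u w = (\prod_(v <- prefixes u) F u v (Z v ^~ w))%E.
Proof.
rewrite (prod_prefixes (fun u v => F u v (Z v ^~ w))) /weight /F ltnn; congr (_ * _)%E.
rewrite /drop_product poweR_prod; last by move=> i; exact: big_drop_ge0.
by apply: eq_bigr => i _; rewrite size_takel ?ltn_ord// ltnW.
Qed.

Lemma measurable_weight u : measurable_fun setT (weight u).
Proof.
rewrite (_ : weight u = fun w => \prod_(v <- prefixes u) F u v (Z v ^~ w))%E; last first.
  by apply/funext => w; exact: weight_prod.
apply: emeasurable_prod => v.
exact: (measurableT_comp (mF u v) (measurable_path (mZ v))).
Qed.

Lemma integral_weight u :
  (\int[P]_w weight u w =
   (\prod_(i < size u) \int[P]_w poweR (big_drop (Z (take i u) ^~ w) (nth 0%N u i)) q) *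
   \int[P]_w poweR (absorption (Z u ^~ w)) p)%E.
Proof.
under eq_integral do rewrite weight_prod.
rewrite independent_path_integral//; last 2 first.
- rewrite /prefixes map_inj_in_uniq ?iota_uniq// => i j.
  rewrite !mem_iota/= !add0n !ltnS => iu ju /(congr1 size).
  by rewrite !size_takel.
- by move=> v z; rewrite /F; case: ifP => _; exact: poweR_ge0.
rewrite (prod_prefixes (fun u v => \int[P]_w F u v (Z v ^~ w)))%E /F ltnn.
by congr (_ * _)%E; apply: eq_bigr => i _; rewrite size_takel ?ltn_ord// ltnW.
Qed.

Section identical_laws.
Variables (g : nat -> R) (a M kap : R).
Hypotheses (g0 : forall j, 0 <= g j) (a0 : 0 <= a) (kap0 : 0 <= kap)
  (gE : forall u j, (\int[P]_w poweR (big_drop (Z u ^~ w) j) q)%E = (g j)%:E)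
  (aE : forall u, (\int[P]_w poweR (absorption (Z u ^~ w)) p)%E = a%:E)
  (gM : forall J, \sum_(j < J) g j <= M) (kapM : kap * M < 1).

(** Finite functions index the words so that distributivity of products over sums applies. *)
Definition word m J (f : {ffun 'I_m -> 'I_J}) : seq nat := [seq (f i : nat) | i <- enum 'I_m].

(** Lengths and letters are cut at J to keep the sums finite; an individual is counted as soon as J
    exceeds its length and all its letters. *)
Definition total_weight J w : \bar R :=
  (\sum_(m < J) (kap ^+ m)%:E * \sum_(f : {ffun 'I_m -> 'I_J}) weight (word f) w)%E.

Lemma size_word m J (f : {ffun 'I_m -> 'I_J}) : size (word f) = m.
Proof. by rewrite size_map size_enum_ord. Qed.

Lemma word_surj u J : (size u < J)%N -> (forall i, (i \in u) -> (i < J)%N) ->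
  exists f : {ffun 'I_(size u) -> 'I_J}, word f = u.
Proof.
case: J => [//|J] _ uJ; exists [ffun i : 'I_(size u) => inord (nth 0%N u i)].
apply: (@eq_from_nth _ 0%N); first exact: size_word.
move=> i; rewrite size_word => iu.
rewrite (nth_map (Ordinal iu)) ?size_enum_ord// ffunE nth_enum_ord// inordK//.
by apply: uJ; rewrite mem_nth.
Qed.

Lemma weight_ge0 u w : (0 <= weight u w)%E.
Proof. by rewrite mule_ge0// poweR_ge0. Qed.

Lemma measurable_total_weight J : measurable_fun setT (total_weight J).
Proof.
apply: emeasurable_sum => m; apply: measurable_funeM; apply: emeasurable_sum => f.
exact: measurable_weight.
Qed.

Lemma total_weight_ge0 J w : (0 <= total_weight J w)%E.
Proof.
apply: sume_ge0 => m _; rewrite mule_ge0 ?lee_fin ?exprn_ge0//.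
by apply: sume_ge0 => f _; exact: weight_ge0.
Qed.

Lemma integral_total_weight J :
  (\int[P]_w total_weight J w <= (a / (1 - kap * M))%:E)%E.
Proof.
have mw u : measurable_fun setT (weight u) by exact: measurable_weight.
have M0 : 0 <= M by apply: le_trans (gM 0); rewrite big_ord0.
rewrite ge0_integral_sum//; last 2 first.
- move=> m; apply: measurable_funeM; apply: emeasurable_sum => f; exact: mw.
- move=> m w _; rewrite mule_ge0 ?lee_fin ?exprn_ge0//.
  by apply: sume_ge0 => f _; exact: weight_ge0.
apply: (@le_trans _ _ (\sum_(m < J) (a * (kap * M) ^+ m)%:E)%E).
  apply: lee_sum => m _; rewrite ge0_integralZl ?lee_fin ?exprn_ge0//; last 2 first.
  - apply: emeasurable_sum => f; exact: mw.
  - by move=> w _; apply: sume_ge0 => f _; exact: weight_ge0.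
  rewrite ge0_integral_sum//; last by move=> f w _; exact: weight_ge0.
  rewrite (_ : \sum_(f : {ffun 'I_m -> 'I_J}) _ = ((\sum_(j < J) g j) ^+ m * a)%:E)%E.
    rewrite -EFinM lee_fin exprMn mulrA [leLHS]mulrC ler_wpM2l// ler_wpM2l ?exprn_ge0//.
    by rewrite lerXn2r ?nnegrE// sumr_ge0.
  (* The power m of the sum of g expands into the sum, over words of length m, of the products of g
     along the letters. *)
  rewrite -[X in _ ^+ X]card_ord -prodr_const bigA_distr_bigA/= mulr_suml -sumEFin.
  apply: eq_bigr => f _; rewrite integral_weight// aE EFinM; congr (_ * _)%E.
  rewrite (eq_bigr (fun i : 'I_(size (word f)) => (g (nth 0%N (word f) i))%:E)); last first.
    by move=> i _; exact: gE.
  rewrite prodEFin size_word; congr (_%:E).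
  apply: eq_bigr => i _; rewrite (nth_map i) ?size_enum_ord//.
  by rewrite nth_ord_enum.
have kM0 : 0 <= kap * M by rewrite mulr_ge0.
rewrite sumEFin lee_fin -mulr_sumr ler_wpM2l// -[leRHS]mul1r ler_pdivlMr ?subr_gt0//.
by have := subrX1 (kap * M) J; have := exprn_ge0 J kM0; lra.
Qed.

Lemma weight_le_total u w :
  ((kap ^+ size u)%:E * weight u w <= limn_einf (total_weight ^~ w))%E.
Proof.
apply: (@cvg_le_limn_einf _ (cst ((kap ^+ size u)%:E * weight u w)%E)); last exact: cvg_cst.
near=> J.
have uJ : (size u < J)%N by near: J; exact: nbhs_infty_gt.
have /(word_surj uJ)[f fE] : forall i, (i \in u) -> (i < J)%N.
  move=> i iu; apply: (@leq_ltn_trans (\sum_(i <- u) i)%N).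
    by rewrite (big_rem i)//= leq_addr.
  by near: J; exact: nbhs_infty_gt.
rewrite /total_weight (bigD1 (Ordinal uJ))//=.
rewrite -[leLHS]adde0 leeD//; last first.
  apply: sume_ge0 => m _; rewrite mule_ge0 ?lee_fin ?exprn_ge0//.
  by apply: sume_ge0 => f' _; exact: weight_ge0.
apply: lee_wpmul2l; first by rewrite lee_fin exprn_ge0.
rewrite (bigD1 f)//= fE -[leLHS]adde0 leeD//.
by apply: sume_ge0 => f' _; exact: weight_ge0.
Unshelve. all: by end_near.
Qed.

Lemma integral_limn_total_weight :
  (\int[P]_w limn_einf (total_weight ^~ w) <= (a / (1 - kap * M))%:E)%E.
Proof.
apply: le_trans (fatou _ _ _ _) _ => //.
- exact: measurable_total_weight.
- by move=> J w _; exact: total_weight_ge0.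
by apply: limn_einf_le => J; exact: integral_total_weight.
Qed.

End identical_laws.

End expected_generations.

(** * Assembly of the moment bound *)

Theorem corollary4p4 (R : realType)
  (k b sigma2 : R) (nu : {measure set R -> \bar R})
  (d' : measure_display) (T' : measurableType d') (P' : probability T' R)
  (xi : R -> T' -> R) (e : T' -> \bar R)
  (beta : R)
  (d : measure_display) (T : measurableType d) (P : probability T R)
  (Z : seq nat -> R -> T -> R) (ZZ : R -> T -> nat -> R)
  (Tree : T -> compact_rtree R)
  (k_ge0 : 0 <= k) (sigma2_ge0 : 0 <= sigma2) (nu_levy : levy_measure nu)
  (Y_levy : killed_levy_process P' k b sigma2 nu xi e)
  (Y_drift_or_killed : 0 < k \/ {ae P', forall w, xi t w @[t --> +oo] --> -oo})
  (beta_gt0 : 0 < beta)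
  (ZZ_gf : growth_fragmentation beta P'
     (fun t w => lamperti beta (killed_path (xi ^~ w) (e w)) t) P Z ZZ)
  (kappa_neg : exists q : R,
     [/\ 0 < q, (levy_kappa k b sigma2 nu q < 0)%E & beta <= q])
  (Tree_limit : {ae P, forall w,
     gromov_hausdorff_dist
       (genealogical_tree beta (fun u t => Z u t w) n)
       (rooted_of_rtree (Tree w)) @[n --> \oo] --> 0%E})
  (p : R) (p_gt0 : 0 < p)
  (p_lt : (p%:E <
     ereal_sup [set q%:E | q in
                 [set q : R | (0 < q)%R /\ levy_kappa k b sigma2 nu q < 0]]
     * (beta^-1)%:E)%E) :
  (\int[P]_w (poweR (tree_height (rooted_of_rtree (Tree w))) p) < +oo)%E.
Proof.
(* One exponent comes from the supremum and exceeds p beta, another from the assumption and is at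
   least beta; the larger of the two has both properties. *)
have [q [q0 kq betaq pq]] : exists q, [/\ 0 < q, (levy_kappa k b sigma2 nu q < 0)%E,
    beta <= q & p * beta < q].
  have : ((p * beta)%:E < ereal_sup [set q%:E | q in
      [set q : R | (0 < q)%R /\ levy_kappa k b sigma2 nu q < 0]])%E.
    by move: p_lt; rewrite lte_pdivlMr// -EFinM.
  move=> /ereal_sup_gt[_ [q1 [q10 kq1] <-]]; rewrite lte_fin => pq1.
  have [q2 [q20 kq2 bq2]] := kappa_neg.
  have [q12|q12] := leP q1 q2; first by exists q2; split=> //; exact: lt_le_trans q12.
  by exists q1; split=> //; rewrite (le_trans bq2)// ltW.
have [psi [G [psiE GE G0 psiG]]] := levy_kappa_split Y_levy q0 kq.
have psi0 : psi < 0 by lra.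
pose p1 := q / beta.
have betap1 : beta * p1 = q by rewrite mulrC divfK ?gt_eqF.
have p1_ge1 : 1 <= p1 by rewrite ler_pdivlMr// mul1r.
have p1_gt0 : 0 < p1 by exact: lt_le_trans p1_ge1.
have pp1 : p < p1 by rewrite ltr_pdivlMr.
pose X t w := lamperti beta (killed_path (xi ^~ w) (e w)) t.
have levy := klevy_levy Y_levy.
have mX t : 0 <= t -> measurable_fun setT (X t).
  apply: measurable_lamperti => //.
  - exact: levy_measurable levy.
  - exact: klevy_measurable Y_levy.
  - by move=> w; exact: (levy_cadlag levy w).1.
have mZ := gf_measurable ZZ_gf.
pose M := G / - psi.
have M0 : 0 <= M by rewrite divr_ge0// oppr_ge0 ltW.
have M1 : M < 1 by rewrite ltr_pdivrMr ?oppr_gt0// mul1r; lra.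
have drops J : (\int[P']_w (\sum_(j < J) poweR (big_drop (X ^~ w) j) q) <= M%:E)%E.
  exact: (integral_big_drops_lamperti k_ge0 Y_levy Y_drift_or_killed q0 psiE psi0 beta_gt0 J GE).
have mdrop j : measurable_fun setT (fun z : path_space R => poweR (big_drop z j) q).
  by apply: (measurableT_comp (@measurable_poweR R q)); exact: measurable_big_drop.
have mabs : measurable_fun setT (fun z : path_space R => poweR (absorption z) p1).
  by apply: (measurableT_comp (@measurable_poweR R p1)); exact: measurable_absorption.
pose g j := fine (\int[P']_w poweR (big_drop (X ^~ w) j) q)%E.
have g_fin j : ((g j)%:E = \int[P']_w poweR (big_drop (X ^~ w) j) q)%E.
  rewrite /g fineK// ge0_fin_numE; last by apply: integral_ge0 => w _; exact: poweR_ge0.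
  apply: (@le_lt_trans _ _ M%:E); last exact: ltry.
  apply: le_trans (drops j.+1); apply: le_integral_nonmeasurable => w; first exact: poweR_ge0.
  rewrite big_ord_recr/= leeDr// sume_ge0// => i _; exact: poweR_ge0.
have g0 j : 0 <= g j by apply: fine_ge0; apply: integral_ge0 => w _; exact: poweR_ge0.
have gM J : \sum_(j < J) g j <= M.
  rewrite -lee_fin -sumEFin; under eq_bigr do rewrite g_fin.
  rewrite -ge0_integral_sum//.
  - by move=> j; exact: (measurableT_comp (mdrop j) (measurable_path mX)).
  - by move=> j w _; exact: poweR_ge0.
have gE u j : (\int[P]_w poweR (big_drop (Z u ^~ w) j) q = (g j)%:E)%E.
  rewrite g_fin; apply: (same_law_integral (mZ u) mX (gf_copies ZZ_gf u) (mdrop j)).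
  by move=> z; exact: poweR_ge0.
have A_fin := integral_absorption_lamperti Y_levy q0 psiE psi0 beta_gt0 p1_ge1 betap1.
pose a := fine (\int[P']_w poweR (absorption (X ^~ w)) p1)%E.
have a0 : 0 <= a by apply: fine_ge0; apply: integral_ge0 => w _; exact: poweR_ge0.
have aE u : (\int[P]_w poweR (absorption (Z u ^~ w)) p1 = a%:E)%E.
  rewrite /a fineK; last first.
    by rewrite ge0_fin_numE//; apply: integral_ge0 => w _; exact: poweR_ge0.
  apply: (same_law_integral (mZ u) mX (gf_copies ZZ_gf u) mabs).
  by move=> z; exact: poweR_ge0.
(* As the midpoint of M and 1, rho leaves room on both sides: the weights rho^-m still give a
   convergent series of expectations, and lam < 1 makes the lifetimes decay along lines. *)
pose rho := (M + 1) / 2; pose lam := rho `^ p1^-1.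
have rho01 : 0 < rho < 1 by rewrite /rho; lra.
have [rho0 rho1] := andP rho01.
have lamp : lam `^ p1 = rho by rewrite -powRrM mulVf ?gt_eqF// powRr1// ltW.
have lam01 : 0 < lam < 1.
  rewrite powR_gt0//= ltNge; apply/negP => l1.
  have := ge0_ler_powR (ltW p1_gt0) _ _ l1.
  by rewrite !nnegrE ler01 powR_ge0 lamp powR1 leNgt rho1 => /(_ isT isT).
pose kap := rho^-1.
have kapM : kap * M < 1 by rewrite mulrC ltr_pdivrMr// mul1r /rho; lra.
have kap0 : 0 <= kap by rewrite invr_ge0 ltW.
pose V w := limn_einf (total_weight Z p1 q kap ^~ w).
have V0 w : (0 <= V w)%E.
  apply: (@cvg_le_limn_einf _ (cst 0%E)); last exact: cvg_cst.
  by apply: nearW => J; exact: total_weight_ge0.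
have mV : measurable_fun setT V.
  by apply: measurable_limn_einf => J; exact: measurable_total_weight.
have IV := integral_limn_total_weight mZ (gf_independent ZZ_gf) g0 a0 kap0 gE aE gM kapM.
pose c := (1 - lam)^-1.
have c0 : 0 < c by rewrite invr_gt0 subr_gt0; case/andP: lam01.
have height_le : {ae P, forall w,
    (tree_height (rooted_of_rtree (Tree w)) <= c%:E * poweR (V w) p1^-1)%E}.
  have cZ : {ae P, forall w, forall u, cadlag (Z u ^~ w)}.
    (* There are countably many individuals, so a single null set serves them all. *)
    have h (n : nat) : {ae P, forall w, forall u, unpickle n = Some u -> cadlag (Z u ^~ w)}.
      case: (unpickle n) => [u|]; last exact: aeW.
      by apply: filterS (gf_cadlag ZZ_gf u) => w cu _ [<-].
    apply: filterS (ae_foralln h) => w hw u.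
    exact: (hw (pickle u) u (pickleK u)).
  apply: filterS2 cZ Tree_limit => w cZ lim_w.
  apply: limit_height_le lim_w => n; apply: genealogical_height_le => u.
  apply: line_lifetime_le => // v; rewrite lamp.
  apply: le_trans (lifetime_cell_power cZ v p1_gt0 betap1 q0) _.
  rewrite -lee_pdivrMl ?exprn_gt0// -exprVn.
  exact: weight_le_total.
(* As p < p1, the power p of the height is at most 1 plus its power p1, which is dominated by a
   measurable function of finite expectation. *)
apply: (@le_lt_trans _ _ (\int[P]_w (1 + (c `^ p1)%:E * V w))%E).
  apply: ae_le_integral_nonmeasurable => //.
  - by move=> w; exact: poweR_ge0.
  - by move=> w; rewrite adde_ge0// mule_ge0// lee_fin powR_ge0.
  - by apply: emeasurable_funD => //; exact: measurable_funeM.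
  apply: filterS height_le => w; set h := tree_height _ => hle.
  have h0 : (0 <= h)%E.
    apply: le_trans (_ : 0 <= (mdist (rtree_root (Tree w)) (rtree_root (Tree w)))%:E)%E _.
      by rewrite lee_fin mdist_ge0.
    by apply: ereal_sup_ubound; exists (rtree_root (Tree w)).
  have hp1 : (poweR h p1 <= (c `^ p1)%:E * V w)%E.
    have -> : ((c `^ p1)%:E * V w = poweR (c%:E * poweR (V w) p1^-1) p1)%E.
      rewrite poweRM ?poweR_ge0 ?lee_fin ?(ltW c0)// poweR_EFin -poweRrM.
      by rewrite mulVf ?gt_eqF// poweRe1.
    apply: gt0_ler_poweR hle; rewrite ?(ltW p1_gt0)// in_itv/= leey andbT//.
    by rewrite mule_ge0 ?poweR_ge0 ?lee_fin ?(ltW c0).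
  apply: (@le_trans _ _ (1 + poweR h p1)%E); last exact: leeD2l.
  case: (h) h0 => [r||//] r0; last first.
    by rewrite !poweRyr ?gt_eqF.
  rewrite lee_fin in r0; rewrite !poweR_EFin -EFinD lee_fin.
  have [r1|r1] := leP r 1.
    rewrite (@le_trans _ _ 1) ?lerDl ?powR_ge0//.
    have := ge0_ler_powR (ltW p_gt0) _ _ r1.
    by rewrite !nnegrE ler01 powR1 r0 => /(_ isT isT).
  by rewrite (@le_trans _ _ (r `^ p1)) ?lerDr// ler_powR ?(ltW r1)// ltW.
rewrite ge0_integralD//; last 2 first.
- by move=> w _; rewrite mule_ge0// lee_fin powR_ge0.
- exact: measurable_funeM.
rewrite ge0_integralZl ?lee_fin ?powR_ge0// lte_add_pinfty//.
  rewrite (_ : (\int[P]_w 1 = \int[P]_w cst 1 w)%E)// integral_cst// mul1e.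
  by rewrite (le_lt_trans (probability_le1 _ _))// ltry.
rewrite lte_mul_pinfty ?lee_fin ?powR_ge0//.
by apply: le_lt_trans IV _; exact: ltry.
Qed.
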